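(* Let $m\in\mathbb{N}_0$, $0<\alpha<\infty$ and let $v$ be a weight on $\mathbb{D}$. Suppose $u_1,u_2\in H(\mathbb{D})$ and $\varphi_1,\varphi_2\in S(\mathbb{D})$. Then the following statements are equivalent: (i) $D_{\varphi_1,u_1}^{m}-D_{\varphi_2,u_2}^{m}:\mathcal{B}^\alpha\to H_v^\infty$ is bounded; (ii) both $$\sup_{z\in\mathbb{D}}|\mathcal{T}_{\alpha+m-1}^{\varphi_1}(vu_1)(z)|\rho(z)+\sup_{z\in\mathbb{D}}\left|\mathcal{T}_{\alpha+m-1}^{\varphi_1}(vu_1)(z)-\mathcal{T}_{\alpha+m-1}^{\varphi_2}(vu_2)(z)\right|<\infty$$ and $$\sup_{z\in\mathbb{D}}|\mathcal{T}_{\alpha+m-1}^{\varphi_2}(vu_2)(z)|\rho(z)+\sup_{z\in\mathbb{D}}\left|\mathcal{T}_{\alpha+m-1}^{\varphi_1}(vu_1)(z)-\mathcal{T}_{\alpha+m-1}^{\varphi_2}(vu_2)(z)\right|<\infty;$$ (iii) $$\sup_{a\in\mathbb{D}}\|(D_{\varphi_1,u_1}^m-D_{\varphi_2,u_2}^m)f_a\|_v+\sup_{a\in\mathbb{D}}\|(D_{\varphi_1,u_1}^m-D_{\varphi_2,u_2}^m)g_a\|_v<\infty;$$ (iv) $$\sup_{n\in\mathbb{N}_0}n^{\alpha+m-1}\|u_1\varphi_1^{n}-u_2\varphi_2^n\|_v<\infty.$$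
   Context: $\mathbb{N}_0$ is the set of nonnegative integers, $\mathbb{D}$ the open unit disk in $\mathbb{C}$, $H(\mathbb{D})$ the space of holomorphic functions on $\mathbb{D}$, and $S(\mathbb{D})$ the set of holomorphic self-maps of $\mathbb{D}$. A weight is a strictly positive, continuous and bounded function $v$ on $\mathbb{D}$. For $f\in H(\mathbb{D})$, $\|f\|_v=\sup_{z\in\mathbb{D}}v(z)|f(z)|\in[0,\infty]$, and $H_v^\infty=\{f\in H(\mathbb{D}):\|f\|_v<\infty\}$ with norm $\|\cdot\|_v$. For $0<\alpha<\infty$, the Bloch-type space $\mathcal{B}^\alpha$ is the Banach space of all $f\in H(\mathbb{D})$ with $\|f\|_{\mathcal{B}^\alpha}=|f(0)|+\sup_{z\in\mathbb{D}}(1-|z|^2)^\alpha|f'(z)|<\infty$. For $u\in H(\mathbb{D})$, $\varphi\in S(\mathbb{D})$, $m\in\mathbb{N}_0$, the weighted differentiation composition operator is $(D_{\varphi,u}^mf)(z)=u(z)f^{(m)}(\varphi(z))$, $f\in H(\mathbb{D})$. $\varphi^n$ denotes the $n$-th (pointwise) power of $\varphi$. The pseudo-hyperbolic distance is $\rho(z,w)=\left|\frac{z-w}{1-\bar wz}\right|$, and $\rho(z)=\rho(\varphi_1(z),\varphi_2(z))$. For $i=1,2$, $\mathcal{T}_{\alpha+m-1}^{\varphi_i}(vu_i)(z)=\frac{v(z)u_i(z)}{(1-|\varphi_i(z)|^2)^{\alpha+m-1}}$. For $a\in\mathbb{D}$, the test functions are $$f_a(z)=\int_0^z\int_0^{t_m}\cdots\int_0^{t_2}\frac{(1-|a|^2)^\alpha}{(1-\bar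 at_1)^{2\alpha+m-1}}\,dt_1dt_2\cdots dt_m,$$ $$g_a(z)=\int_0^z\int_0^{t_m}\cdots\int_0^{t_2}\frac{(1-|a|^2)^\alpha}{(1-\bar at_1)^{2\alpha+m-1}}\cdot\frac{a-t_1}{1-\bar at_1}\,dt_1dt_2\cdots dt_m$$ ($m$-fold iterated integrals; for $m=0$ there is no integration and the integrand is evaluated at $z$).
   Formalization: Assumes α+m−1>0, excluding m=0 with 0<α≤1, where (ii) does not imply (i) (e.g. α=1, v=u₁=1, u₂=0, φ₁=φ₂=id); and (iv) is read as also requiring every ‖u₁φ₁ⁿ−u₂φ₂ⁿ‖_v to be finite, including n=0, where 0·∞ is undefined. *)

(* Defs.v *)
From Stdlib Require Import Reals.
From Coquelicot Require Import Coquelicot.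
Open Scope R_scope.

(* Functions on the unit disk are total functions on C; only their values on
   the disk matter, since the disk is open and every notion below quantifies
   over it. *)
Definition disk (z : C) : Prop := Cmod z < 1.

Definition sup_disk (F : C -> Rbar) : Rbar :=
  Rbar_lub (fun y => exists z, disk z /\ y = F z).

Definition holomorphic (f : C -> C) : Prop :=
  forall z, disk z -> ex_derive (K := C_AbsRing) (V := C_NormedModule) f z.

Definition self_map (phi : C -> C) : Prop :=
  holomorphic phi /\ forall z, disk z -> disk (phi z).

Definition weight (v : C -> R) : Prop :=
  (forall z, disk z -> 0 < v z) /\
  (forall z, disk z -> continuous (T := C_UniformSpace) (U := R_UniformSpace) v z) /\
  (exists M : R, forall z, disk z -> v z <= M).

Definition norm_v (v : C -> R) (f : C -> C) : Rbar :=
  sup_disk (fun z => v z * Cmod (f z)).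

Definition in_Hv (v : C -> R) (f : C -> C) : Prop :=
  holomorphic f /\ Rbar_lt (norm_v v f) p_infty.

Definition norm_Bloch (alpha : R) (f : C -> C) : Rbar :=
  Rbar_plus (Cmod (f (RtoC 0)))
    (sup_disk (fun z => Rpower (1 - Cmod z ^ 2) alpha * Cmod (C_derive f z))).

Definition in_Bloch (alpha : R) (f : C -> C) : Prop :=
  holomorphic f /\ Rbar_lt (norm_Bloch alpha f) p_infty.

Definition bounded_Bloch_Hv (alpha : R) (v : C -> R) (T : (C -> C) -> C -> C) : Prop :=
  exists K : R, forall f, in_Bloch alpha f ->
    in_Hv v (T f) /\ Rbar_le (norm_v v (T f)) (Rbar_mult K (norm_Bloch alpha f)).

Definition C_derive_n (f : C -> C) (m : nat) : C -> C := Nat.iter m C_derive f.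

Definition wdc_op (m : nat) (phi u f : C -> C) (z : C) : C :=
  (u z * C_derive_n f m (phi z))%C.

Definition wdc_diff (m : nat) (phi1 u1 phi2 u2 f : C -> C) (z : C) : C :=
  (wdc_op m phi1 u1 f z - wdc_op m phi2 u2 f z)%C.

Definition rho (z w : C) : R := Cmod ((z - w) / (1 - Cconj w * z)).

Definition Tcal (s : R) (v : C -> R) (phi u : C -> C) (z : C) : C :=
  (RtoC (v z) * u z / RtoC (Rpower (1 - Cmod (phi z) ^ 2) s))%C.

Definition Cexp (z : C) : C :=
  (exp (Re z) * cos (Im z), exp (Re z) * sin (Im z)).

(* The principal power, for bases with positive real part; [1 - Cconj a * t]
   with a and t in the disk is such a base. *)
Definition Cpower (z : C) (s : R) : C :=
  Cexp (s * ln (Cmod z), s * atan (Im z / Re z)).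

(* The integral of h from 0 to z, along the segment [0, z]. *)
Definition primitive0 (h : C -> C) (z : C) : C :=
  RInt (V := C_R_CompleteNormedModule) (fun s : R => (z * h (RtoC s * z))%C) 0 1.

Definition f_test (m : nat) (alpha : R) (a : C) : C -> C :=
  Nat.iter m primitive0 (fun t =>
    (RtoC (Rpower (1 - Cmod a ^ 2) alpha)
     / Cpower (1 - Cconj a * t) (2 * alpha + INR m - 1))%C).

Definition g_test (m : nat) (alpha : R) (a : C) : C -> C :=
  Nat.iter m primitive0 (fun t =>
    (RtoC (Rpower (1 - Cmod a ^ 2) alpha)
     / Cpower (1 - Cconj a * t) (2 * alpha + INR m - 1)
     * ((a - t) / (1 - Cconj a * t)))%C).

(* n ^ s for s > 0, so that 0 ^ s = 0; [Rpower] is junk at base 0. *)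
Definition nat_Rpower (n : nat) (s : R) : R :=
  match n with O => 0 | S _ => Rpower (INR n) s end.

(* A finite supremum of products c_n * norm_n presupposes that every norm_n is
   finite.  This is stated explicitly because c_0 = 0 here and the Coquelicot
   product 0 * p_infty is 0, which would hide the condition at n = 0. *)
Definition power_condition (s : R) (v : C -> R) (phi1 u1 phi2 u2 : C -> C) : Prop :=
  let d n z := (u1 z * phi1 z ^ n - u2 z * phi2 z ^ n)%C in
  (forall n, Rbar_lt (norm_v v (d n)) p_infty) /\
  Rbar_lt (Sup_seq (fun n => Rbar_mult (nat_Rpower n s) (norm_v v (d n)))) p_infty.

(* Main.v *)
Require Import Defs.
From Stdlib Require Import Reals.
From Coquelicot Require Import Coquelicot.
From Stdlib Require Import Lra Lia Classical ClassicalEpsilon.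
Open Scope R_scope.

(** Why the four conditions agree.  Put [s = alpha + m - 1 > 0] and call
    [1 - |z|^2] the defect of [z].  For fixed [z] write [l_i = v(z) u_i(z)] and
    [x_i = phi_i(z)].  Then [v |D f|] at [z] is
    [|l_1 f^(m)(x_1) - l_2 f^(m)(x_2)|], and [T_i] is [l_i / defect(x_i)^s].  All
    four conditions are thus bounds, uniform in [z], on expressions in the two
    numbers [l_i] and the two points [x_i], and the proof runs round the cycle
    [i -> iv -> iii -> ii -> i].

    [i -> iv] ([bounded_implies_power]).  Apply the operator to [z^(n+m)].  Its
    [m]-th derivative is [z^n] times a factor of at least [n^m], and its Bloch norm
    is of order [n^(1 - alpha)].

    [iv -> iii] ([kernel_difference], [kernel_moebius_difference]).  The [m]-th
    derivative of [f_a] is [defect(a)^alpha (1 - conj a x)^-(alpha + s)], that of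
    [g_a] is the same times the disk automorphism [(a - x) / (1 - conj a x)].
    Expand in powers of [conj a x].  Condition [iv] bounds the term of degree [k] by
    [k^-s |a|^k] times the coefficient of exponent [alpha + s], hence by a multiple
    of [|a|^k] times the coefficient of exponent [alpha]
    ([binom_coef_growth]), and these sum to [(1 - |a|)^-alpha].

    [iii -> ii] ([test_points]).  Take [a = x_1].  Then [f_a] yields
    [T_1 - T_2 X] with [X = defect(x_2)^s f_a^(m)(x_2)], and [g_a], whose [m]-th
    derivative vanishes at [x_1], yields [|T_2 X| rho].  Together they bound [|T_1| rho].
    By symmetry [|T_2| rho] is bounded, and since [X - 1 = O(rho)] so is
    [T_1 - T_2].

    [ii -> i] ([symbols_bound_operator]).  For [f] in the Bloch-type space the
    function [F = defect^s f^(m)] is bounded and Lipschitz for [rho], and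
    [l_1 f^(m)(x_1) - l_2 f^(m)(x_2)
     = T_1 (F(x_1) - F(x_2)) + (T_1 - T_2) F(x_2)].

    The last two steps rest on [weighted_lipschitz]: a function with
    [|h| defect^s] and [|h'| defect^(s+1)] bounded has [defect^s h] Lipschitz for
    [rho].  For Bloch functions these bounds come from Cauchy's estimate
    [cauchy_estimate].

    Holomorphy means here that a complex derivative exists at each point, so the
    basic facts have to be derived from that alone.  Goursat's theorem ([goursat])
    gives a primitive [F] of [f].  As [F' = f] is continuous, the integral of
    [F(z + t e^(i theta)) e^(-i theta)] over [theta] may be differentiated in [t]; it
    turns out to be linear in [t], so it equals [2 pi t f(z)].  This formula
    expresses [f] through [F], and differentiating it in [z] gives both the
    holomorphy of [f'] and the estimate for it. *)

(** * Derivatives and continuity *)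

Definition cderiv (f : C -> C) (z l : C) : Prop :=
  is_derive (K := C_AbsRing) (V := C_NormedModule) f z l.

Definition curve_deriv (g : R -> C) (t : R) (l : C) : Prop :=
  is_derive (K := R_AbsRing) (V := C_R_NormedModule) g t l.

Lemma cderiv_eps (f : C -> C) (z l : C) :
  cderiv f z l <->
  forall eps, 0 < eps -> exists d, 0 < d /\
    forall w, Cmod (w - z) < d ->
      Cmod (f w - f z - (w - z) * l) <= eps * Cmod (w - z).
Proof.
  split.
  - intros [_ H] eps He.
    destruct (H z (fun P HP => HP) (mkposreal eps He)) as [d Hd].
    exists d; split; [apply cond_pos|].
    intros w Hw. exact (Hd w Hw).
  - intros H; split.
    + apply (is_linear_scal_l (K := C_AbsRing) (V := C_NormedModule)).
    + intros x Hx eps.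
      assert (Ez : z = x).
      { apply (is_filter_lim_locally_unique (K := C_AbsRing) (V := AbsRing_NormedModule C_AbsRing)).
        exact Hx. }
      subst x.
      destruct (H eps (cond_pos eps)) as [d [Hd Hd']].
      exists (mkposreal d Hd). intros w Hw. exact (Hd' w Hw).
Qed.

Lemma curve_deriv_eps (g : R -> C) (t : R) (l : C) :
  curve_deriv g t l <->
  forall eps, 0 < eps -> exists d, 0 < d /\
    forall s, Rabs (s - t) < d ->
      Cmod (g s - g t - RtoC (s - t) * l) <= eps * Rabs (s - t).
Proof.
  assert (Es : forall s, Cmod (g s - g t - RtoC (s - t) * l)
    = norm (V := C_R_NormedModule) (minus (minus (g s) (g t)) (scal (minus s t) l))).
  { intros s. rewrite <- Cmod_norm. f_equal.
    apply injective_projections; cbn; unfold mult; cbn; unfold minus, plus, opp; cbn; ring. }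
  split.
  - intros [_ H] eps He.
    destruct (H t (fun P HP => HP) (mkposreal eps He)) as [d Hd].
    exists d; split; [apply cond_pos|].
    intros s Hs. rewrite Es. exact (Hd s Hs).
  - intros H; split.
    + apply (is_linear_scal_l (K := R_AbsRing) (V := C_R_NormedModule)).
    + intros x Hx eps.
      assert (Ez : t = x).
      { apply (is_filter_lim_locally_unique (K := R_AbsRing) (V := AbsRing_NormedModule R_AbsRing)).
        exact Hx. }
      subst x.
      destruct (H eps (cond_pos eps)) as [d [Hd Hd']].
      exists (mkposreal d Hd). intros s Hs.
      specialize (Hd' s Hs). rewrite Es in Hd'. exact Hd'.
Qed.


(** Continuity is taken for the uniform structure given by [Cmod], for which the
    algebraic continuity rules hold; it agrees with the product structure that
    integration uses ([curve_cont_prod]). *)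
Definition Cmod_space : UniformSpace := AbsRing_UniformSpace C_AbsRing.

Definition ccont (f : C -> C) (z : C) : Prop :=
  continuous (T := Cmod_space)
    (U := Cmod_space) f z.

Definition curve_cont (g : R -> C) (t : R) : Prop :=
  continuous (T := R_UniformSpace) (U := Cmod_space) g t.

Lemma continuous_Cmod_eps (T : UniformSpace) (g : T -> C) (t : T) :
  continuous (U := Cmod_space) g t <->
  forall eps, 0 < eps -> exists d, 0 < d /\ forall s, ball t d s -> Cmod (g s - g t) < eps.
Proof.
  split.
  - intros H eps He.
    destruct (proj1 (filterlim_locally (U := Cmod_space) _ _) H
                (mkposreal eps He)) as [d Hd].
    exists d; split; [apply cond_pos|exact Hd].
  - intros H.
    apply (proj2 (filterlim_locally (U := Cmod_space) _ _)).
    intros eps. destruct (H eps (cond_pos eps)) as [d [Hd Hd']].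
    exists (mkposreal d Hd). exact Hd'.
Qed.

Lemma ccont_eps (f : C -> C) (z : C) :
  ccont f z <->
  forall eps, 0 < eps -> exists d, 0 < d /\
    forall w, Cmod (w - z) < d -> Cmod (f w - f z) < eps.
Proof. exact (continuous_Cmod_eps (Cmod_space) f z). Qed.

Lemma curve_cont_eps (g : R -> C) (t : R) :
  curve_cont g t <->
  forall eps, 0 < eps -> exists d, 0 < d /\
    forall s, Rabs (s - t) < d -> Cmod (g s - g t) < eps.
Proof. exact (continuous_Cmod_eps R_UniformSpace g t). Qed.

Lemma curve_cont_prod (g : R -> C) (t : R) :
  curve_cont g t <->
  continuous (T := R_UniformSpace) (U := C_R_CompleteNormedModule) g t.
Proof.
  split; intros H P HP; apply H; apply locally_C; exact HP.
Qed.

Lemma ccont_id (z : C) : ccont (fun w => w) z.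
Proof. apply (continuous_id (U := Cmod_space)). Qed.

Lemma ccont_const (c z : C) : ccont (fun _ => c) z.
Proof.
  apply (continuous_const (U := Cmod_space)
    (V := Cmod_space)).
Qed.

Lemma ccont_plus (f g : C -> C) (z : C) :
  ccont f z -> ccont g z -> ccont (fun w => (f w + g w)%C) z.
Proof.
  apply (continuous_plus (U := Cmod_space) (K := C_AbsRing)
    (V := AbsRing_NormedModule C_AbsRing) f g).
Qed.

Lemma ccont_mult (f g : C -> C) (z : C) :
  ccont f z -> ccont g z -> ccont (fun w => (f w * g w)%C) z.
Proof. apply (continuous_mult (U := Cmod_space) (K := C_AbsRing) f g). Qed.

Lemma ccont_comp (f g : C -> C) (z : C) :
  ccont f z -> ccont g (f z) -> ccont (fun w => g (f w)) z.
Proof.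
  apply (continuous_comp (U := Cmod_space)
    (V := Cmod_space) (W := Cmod_space) f g).
Qed.

Lemma ccont_inv (z : C) : z <> 0 -> ccont (fun w => (/ w)%C) z.
Proof.
  intros Hz. apply ccont_eps. intros eps He.
  assert (Pz := proj1 (Cmod_gt_0 z) Hz).
  exists (Rmin (Cmod z / 2) (eps * Cmod z * Cmod z / 2)). split.
  { apply Rmin_pos; [lra|]. apply Rdiv_lt_0_compat; [|lra].
    repeat apply Rmult_lt_0_compat; assumption. }
  intros w Hw.
  assert (H1 := Rlt_le_trans _ _ _ Hw (Rmin_l _ _)).
  assert (H2 := Rlt_le_trans _ _ _ Hw (Rmin_r _ _)).
  assert (Hwz : Cmod z / 2 < Cmod w).
  { assert (T := Cmod_triangle w (z - w)%C).
    replace (w + (z - w))%C with z in T by ring.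
    replace (z - w)%C with (- (w - z))%C in T by ring. rewrite Cmod_opp in T. lra. }
  assert (Hw0 : w <> 0) by (apply Cmod_gt_0; lra).
  replace (/ w - / z)%C with (- (w - z) / (w * z))%C by (field; split; assumption).
  assert (w * z <> 0)%C by (apply Cmult_neq_0; assumption).
  rewrite Cmod_div, Cmod_opp, Cmod_mult by assumption.
  apply Rmult_lt_reg_r with (Cmod w * Cmod z). { apply Rmult_lt_0_compat; lra. }
  unfold Rdiv at 1. rewrite Rmult_assoc, Rinv_l, Rmult_1_r.
  2: { apply Rgt_not_eq. apply Rmult_lt_0_compat; lra. }
  apply Rlt_le_trans with (1 := H2).
  replace (eps * Cmod z * Cmod z / 2) with (eps * ((Cmod z / 2) * Cmod z)) by field.
  apply Rmult_le_compat_l; [lra|]. apply Rmult_le_compat_r; lra.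
Qed.

Lemma curve_cont_const (c : C) (t : R) : curve_cont (fun _ => c) t.
Proof.
  apply (continuous_const (U := R_UniformSpace) (V := Cmod_space)).
Qed.

Lemma curve_cont_plus (f g : R -> C) (t : R) :
  curve_cont f t -> curve_cont g t -> curve_cont (fun s => (f s + g s)%C) t.
Proof.
  apply (continuous_plus (U := R_UniformSpace) (K := C_AbsRing) (V := AbsRing_NormedModule C_AbsRing) f g).
Qed.

Lemma curve_cont_mult (f g : R -> C) (t : R) :
  curve_cont f t -> curve_cont g t -> curve_cont (fun s => (f s * g s)%C) t.
Proof. apply (continuous_mult (U := R_UniformSpace) (K := C_AbsRing) f g). Qed.

Lemma curve_cont_comp (g : R -> C) (f : C -> C) (t : R) :
  curve_cont g t -> ccont f (g t) -> curve_cont (fun s => f (g s)) t.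
Proof.
  apply (continuous_comp (U := R_UniformSpace) (V := Cmod_space)
    (W := Cmod_space) g f).
Qed.

Lemma slope_cderiv (f q : C -> C) (z l : C) (r : R) :
  0 < r -> ccont q z -> q z = l ->
  (forall w, Cmod (w - z) < r -> (f w - f z = (w - z) * q w)%C) -> cderiv f z l.
Proof.
  intros Hr Hq El Hf. apply cderiv_eps. intros eps He.
  destruct (proj1 (ccont_eps _ _) Hq eps He) as [d [Hd H]].
  exists (Rmin d r); split; [now apply Rmin_pos|]. intros w Hw.
  assert (W1 := Rlt_le_trans _ _ _ Hw (Rmin_l _ _)).
  assert (W2 := Rlt_le_trans _ _ _ Hw (Rmin_r _ _)).
  rewrite Hf, <- El by exact W2.
  replace ((w - z) * q w - (w - z) * q z)%C with ((q w - q z) * (w - z))%C by ring.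
  rewrite Cmod_mult. apply Rmult_le_compat_r; [apply Cmod_ge_0|]. apply Rlt_le, H, W1.
Qed.

(** Caratheodory's form of the derivative: the product, chain and quotient rules
    become algebra together with continuity of the slope [q]. *)
Lemma cderiv_slope (f : C -> C) (z l : C) :
  cderiv f z l <->
  exists q, ccont q z /\ q z = l /\ forall w, (f w - f z = (w - z) * q w)%C.
Proof.
  split.
  - intros H.
    exists (fun w => if Ceq_dec w z then l else ((f w - f z) / (w - z))%C).
    split; [|split].
    + apply ccont_eps. intros eps He.
      destruct (proj1 (cderiv_eps _ _ _) H (eps / 2)) as [d [Hd H']]; [lra|].
      exists d; split; [exact Hd|]. intros w Hw.
      destruct (Ceq_dec z z) as [_|n]; [|now elim n].
      destruct (Ceq_dec w z) as [E|n].
      { replace (l - l)%C with (RtoC 0) by ring. rewrite Cmod_0. exact He. }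
      assert (Nz : (w - z)%C <> 0).
      { intros E. apply n. replace w with (w - z + z)%C by ring. rewrite E. ring. }
      assert (P := proj1 (Cmod_gt_0 _) Nz).
      replace ((f w - f z) / (w - z) - l)%C with ((f w - f z - (w - z) * l) / (w - z))%C
        by (field; exact Nz).
      rewrite Cmod_div by exact Nz.
      apply Rle_lt_trans with (eps / 2); [|lra].
      apply Rmult_le_reg_r with (Cmod (w - z)); [exact P|].
      unfold Rdiv at 1. rewrite Rmult_assoc, Rinv_l, Rmult_1_r by lra.
      apply H', Hw.
    + destruct (Ceq_dec z z) as [_|n]; [reflexivity|now elim n].
    + intros w. destruct (Ceq_dec w z) as [E|n].
      * subst w. ring.
      * field. intros E. apply n. replace w with (w - z + z)%C by ring. rewrite E. ring.
  - intros [q [Hq [El Hf]]]. apply (slope_cderiv f q z l 1); [lra|assumption|assumption|].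
    intros; apply Hf.
Qed.

Lemma curve_deriv_slope (g : R -> C) (t : R) (l : C) :
  curve_deriv g t l <->
  exists q, curve_cont q t /\ q t = l /\ forall s, (g s - g t = RtoC (s - t) * q s)%C.
Proof.
  split.
  - intros H.
    exists (fun s => if Req_dec_T s t then l else ((g s - g t) / RtoC (s - t))%C).
    split; [|split].
    + apply curve_cont_eps. intros eps He.
      destruct (proj1 (curve_deriv_eps _ _ _) H (eps / 2)) as [d [Hd H']]; [lra|].
      exists d; split; [exact Hd|]. intros s Hs.
      destruct (Req_dec_T t t) as [_|n]; [|now elim n].
      destruct (Req_dec_T s t) as [E|n].
      { replace (l - l)%C with (RtoC 0) by ring. rewrite Cmod_0. exact He. }
      assert (Nz : RtoC (s - t) <> 0).
      { intros E. apply n. apply RtoC_inj in E. lra. }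
      assert (P : 0 < Rabs (s - t)) by (apply Rabs_pos_lt; lra).
      replace ((g s - g t) / RtoC (s - t) - l)%C
        with ((g s - g t - RtoC (s - t) * l) / RtoC (s - t))%C
        by (field; exact Nz).
      rewrite Cmod_div, Cmod_R by exact Nz.
      apply Rle_lt_trans with (eps / 2); [|lra].
      apply Rmult_le_reg_r with (Rabs (s - t)); [exact P|].
      unfold Rdiv at 1. rewrite Rmult_assoc, Rinv_l, Rmult_1_r by lra.
      apply H', Hs.
    + destruct (Req_dec_T t t) as [_|n]; [reflexivity|now elim n].
    + intros s. destruct (Req_dec_T s t) as [E|n].
      * subst s. rewrite Rminus_diag. ring.
      * field. intros E. apply n. apply RtoC_inj in E. lra.
  - intros [q [Hq [El Hf]]]. apply curve_deriv_eps. intros eps He.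
    destruct (proj1 (curve_cont_eps _ _) Hq eps He) as [d [Hd H]].
    exists d; split; [exact Hd|]. intros s Hs.
    rewrite Hf, <- El.
    replace (RtoC (s - t) * q s - RtoC (s - t) * q t)%C
      with ((q s - q t) * RtoC (s - t))%C by ring.
    rewrite Cmod_mult, Cmod_R. apply Rmult_le_compat_r; [apply Rabs_pos|].
    apply Rlt_le, H, Hs.
Qed.

Lemma cderiv_cont (f : C -> C) (z l : C) : cderiv f z l -> ccont f z.
Proof.
  intros H. destruct (proj1 (cderiv_slope _ _ _) H) as [q [Hq [_ Hf]]].
  apply (continuous_ext (T := Cmod_space)
    (U := Cmod_space) (fun w => f z + (w + - z) * q w)%C).
  - intros w. assert (E : (f z + (f w - f z))%C = f w) by ring.
    rewrite Hf in E. exact E.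
  - apply ccont_plus; [apply ccont_const|]. apply ccont_mult; [|exact Hq].
    apply ccont_plus; [apply ccont_id|apply ccont_const].
Qed.

Lemma curve_deriv_cont (g : R -> C) (t : R) (l : C) : curve_deriv g t l -> curve_cont g t.
Proof.
  intros H. apply curve_cont_prod. apply (ex_derive_continuous (V := C_R_NormedModule)).
  exists l. exact H.
Qed.

Lemma cderiv_ext_loc (f g : C -> C) (z l : C) (d : R) :
  0 < d -> (forall w, Cmod (w - z) < d -> f w = g w) -> cderiv f z l -> cderiv g z l.
Proof.
  intros Hd E H. apply (is_derive_ext_loc (K := C_AbsRing) (V := C_NormedModule) f g).
  - exists (mkposreal d Hd). exact E.
  - exact H.
Qed.

Lemma cderiv_ext (f g : C -> C) (z l : C) :
  (forall w, f w = g w) -> cderiv f z l -> cderiv g z l.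
Proof. intros E. apply (cderiv_ext_loc f g z l 1); [lra|]. intros; apply E. Qed.

Lemma cderiv_unique (f : C -> C) (z l : C) : cderiv f z l -> C_derive f z = l.
Proof. apply is_C_derive_unique. Qed.

Lemma cderiv_const (c z : C) : cderiv (fun _ => c) z 0.
Proof. apply (is_derive_const (K := C_AbsRing) (V := C_NormedModule)). Qed.

Lemma cderiv_id (z : C) : cderiv (fun w => w) z 1.
Proof.
  apply cderiv_slope. exists (fun _ => RtoC 1). split; [apply ccont_const|].
  split; [reflexivity|]. intros; ring.
Qed.

Lemma cderiv_plus (f g : C -> C) (z l k : C) :
  cderiv f z l -> cderiv g z k -> cderiv (fun w => (f w + g w)%C) z (l + k)%C.
Proof. apply (is_derive_plus (K := C_AbsRing) (V := C_NormedModule) f g). Qed.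

Lemma cderiv_minus (f g : C -> C) (z l k : C) :
  cderiv f z l -> cderiv g z k -> cderiv (fun w => (f w - g w)%C) z (l - k)%C.
Proof. apply (is_derive_minus (K := C_AbsRing) (V := C_NormedModule) f g). Qed.

Lemma cderiv_mult (f g : C -> C) (z l k : C) :
  cderiv f z l -> cderiv g z k ->
  cderiv (fun w => (f w * g w)%C) z (l * g z + f z * k)%C.
Proof.
  intros Hf Hg. assert (Cg := cderiv_cont _ _ _ Hg).
  destruct (proj1 (cderiv_slope _ _ _) Hf) as [p [Hp [<- Ef]]].
  destruct (proj1 (cderiv_slope _ _ _) Hg) as [q [Hq [<- Eg]]].
  apply cderiv_slope. exists (fun w => p w * g w + f z * q w)%C. split; [|split].
  - apply ccont_plus; apply ccont_mult; try assumption. apply ccont_const.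
  - reflexivity.
  - intros w. transitivity ((f w - f z) * g w + f z * (g w - g z))%C; [ring|].
    rewrite Ef, Eg. ring.
Qed.

Lemma cderiv_scal (c : C) (f : C -> C) (z l : C) :
  cderiv f z l -> cderiv (fun w => (c * f w)%C) z (c * l)%C.
Proof.
  intros H. replace (c * l)%C with (0 * f z + c * l)%C by ring.
  apply (cderiv_mult (fun _ => c)); [apply cderiv_const|exact H].
Qed.

Lemma cderiv_comp (f g : C -> C) (z l k : C) :
  cderiv f (g z) l -> cderiv g z k -> cderiv (fun w => f (g w)) z (l * k)%C.
Proof.
  intros Hf Hg. assert (Cg := cderiv_cont _ _ _ Hg).
  destruct (proj1 (cderiv_slope _ _ _) Hf) as [p [Hp [<- Ef]]].
  destruct (proj1 (cderiv_slope _ _ _) Hg) as [q [Hq [<- Eg]]].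
  apply cderiv_slope. exists (fun w => p (g w) * q w)%C. split; [|split].
  - apply ccont_mult; [|assumption]. now apply (ccont_comp g p).
  - reflexivity.
  - intros w. rewrite Ef, Eg. ring.
Qed.

Lemma cderiv_inv (f : C -> C) (z l : C) :
  f z <> 0 -> cderiv f z l -> cderiv (fun w => (/ f w)%C) z (- l / (f z * f z))%C.
Proof.
  intros Hz Hf.
  replace (- l / (f z * f z))%C with (- / (f z * f z) * l)%C by (field; exact Hz).
  apply (cderiv_comp Cinv f); [|exact Hf].
  assert (P := proj1 (Cmod_gt_0 _) Hz).
  apply (slope_cderiv _ (fun w => - (1) * (/ w * / f z))%C _ _ (Cmod (f z))); [exact P| | |].
  - apply ccont_mult; [apply ccont_const|]. apply ccont_mult; [|apply ccont_const].
    now apply ccont_inv.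
  - field. exact Hz.
  - intros w Hw. field. split; [exact Hz|].
    intros ->. replace (0 - f z)%C with (- f z)%C in Hw by ring.
    rewrite Cmod_opp in Hw. lra.
Qed.

Lemma curve_deriv_comp (f : C -> C) (g : R -> C) (t : R) (l k : C) :
  cderiv f (g t) l -> curve_deriv g t k -> curve_deriv (fun s => f (g s)) t (l * k)%C.
Proof.
  intros Hf Hg. assert (Cg := curve_deriv_cont _ _ _ Hg).
  destruct (proj1 (cderiv_slope _ _ _) Hf) as [p [Hp [<- Ef]]].
  destruct (proj1 (curve_deriv_slope _ _ _) Hg) as [q [Hq [<- Eg]]].
  apply curve_deriv_slope. exists (fun s => p (g s) * q s)%C. split; [|split].
  - apply curve_cont_mult; [|assumption]. now apply (curve_cont_comp g p).
  - reflexivity.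
  - intros s. rewrite Ef, Eg. ring.
Qed.

Lemma curve_deriv_mult (f g : R -> C) (t : R) (l k : C) :
  curve_deriv f t l -> curve_deriv g t k ->
  curve_deriv (fun s => (f s * g s)%C) t (l * g t + f t * k)%C.
Proof.
  intros Hf Hg. assert (Cg := curve_deriv_cont _ _ _ Hg).
  destruct (proj1 (curve_deriv_slope _ _ _) Hf) as [p [Hp [<- Ef]]].
  destruct (proj1 (curve_deriv_slope _ _ _) Hg) as [q [Hq [<- Eg]]].
  apply curve_deriv_slope. exists (fun w => p w * g w + f t * q w)%C. split; [|split].
  - apply curve_cont_plus; apply curve_cont_mult; try assumption. apply curve_cont_const.
  - reflexivity.
  - intros w. transitivity ((f w - f t) * g w + f t * (g w - g t))%C; [ring|].
    rewrite Ef, Eg. ring.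
Qed.

Lemma curve_deriv_line (a b : C) (t : R) :
  curve_deriv (fun s => (a + RtoC s * b)%C) t b.
Proof.
  apply curve_deriv_slope. exists (fun _ => b). split; [apply curve_cont_const|].
  split; [reflexivity|]. intros s. rewrite RtoC_minus. ring.
Qed.

Lemma curve_deriv_Re (c : C) (g : R -> C) (t : R) (l : C) :
  curve_deriv g t l -> is_derive (fun s => Re (c * g s)) t (Re (c * l)).
Proof.
  intros H. apply is_derive_Reals. intros eps He.
  assert (Pc : 0 < Cmod c + 1) by (generalize (Cmod_ge_0 c); lra).
  destruct (proj1 (curve_deriv_eps _ _ _) H (eps / 2 / (Cmod c + 1))) as [d [Hd H']].
  { apply Rdiv_lt_0_compat; lra. }
  exists (mkposreal d Hd). intros h Hh Hd'. cbn in Hd'.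
  specialize (H' (t + h)). replace (t + h - t) with h in H' by ring.
  specialize (H' Hd').
  replace ((Re (c * g (t + h)) - Re (c * g t)) / h - Re (c * l))
    with (Re (c * (g (t + h)%R - g t - RtoC h * l)) / h).
  2: { unfold Re, Cmult, Cminus, Cplus, Copp, RtoC; cbn; field; exact Hh. }
  unfold Rdiv. rewrite Rabs_mult, Rabs_inv.
  assert (Ph : 0 < Rabs h) by (apply Rabs_pos_lt; exact Hh).
  apply Rmult_lt_reg_r with (Rabs h); [exact Ph|].
  rewrite Rmult_assoc, Rinv_l, Rmult_1_r by lra.
  eapply Rle_lt_trans; [apply re_le_Cmod|]. rewrite Cmod_mult.
  apply Rle_lt_trans with ((Cmod c + 1) * (eps / 2 / (Cmod c + 1) * Rabs h)).
  - apply Rmult_le_compat; try apply Cmod_ge_0; [lra|exact H'].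
  - replace ((Cmod c + 1) * (eps / 2 / (Cmod c + 1) * Rabs h)) with (eps / 2 * Rabs h)
      by (field; lra).
    apply Rmult_lt_compat_r; lra.
Qed.

Lemma cderiv_eq (f : C -> C) (z l k : C) : cderiv f z l -> l = k -> cderiv f z k.
Proof. now intros H <-. Qed.

Lemma curve_deriv_eq (f : R -> C) (t : R) (l k : C) :
  curve_deriv f t l -> l = k -> curve_deriv f t k.
Proof. now intros H <-. Qed.

(** * Mean value inequalities *)

(** A vector-valued mean value theorem fails, but after projecting on the direction
    [conj (g b - g a)] the real one applies to [Re (c g) - |c| G]. *)
Lemma curve_mean_value (g dg : R -> C) (G dG : R -> R) (a b : R) :
  a <= b ->
  (forall t, a <= t <= b -> curve_deriv g t (dg t)) ->
  (forall t, a <= t <= b -> is_derive G t (dG t)) ->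
  (forall t, a <= t <= b -> Cmod (dg t) <= dG t) ->
  Cmod (g b - g a) <= G b - G a.
Proof.
  intros Hab Hg HG Hle.
  assert (Main : forall c, Re (c * (g b - g a)) <= Cmod c * (G b - G a)).
  { intros c.
    destruct (MVT_gen (fun t => Re (c * g t) - Cmod c * G t) a b
                (fun t => Re (c * dg t) - Cmod c * dG t)) as [x [Hx E]].
    - intros x Hx. rewrite Rmin_left, Rmax_right in Hx by exact Hab.
      apply (is_derive_minus (fun t => Re (c * g t)) (fun t => Cmod c * G t)).
      + apply curve_deriv_Re, Hg; lra.
      + apply (is_derive_scal G), HG; lra.
    - intros x Hx. rewrite Rmin_left, Rmax_right in Hx by exact Hab.
      apply derivable_continuous_pt. exists (Re (c * dg x) - Cmod c * dG x).
      apply is_derive_Reals.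
      apply (is_derive_minus (fun t => Re (c * g t)) (fun t => Cmod c * G t)).
      + apply curve_deriv_Re, Hg; lra.
      + apply (is_derive_scal G), HG; lra.
    - rewrite Rmin_left, Rmax_right in Hx by exact Hab.
      assert (S : Re (c * dg x) - Cmod c * dG x <= 0).
      { assert (H1 := Rle_abs (Re (c * dg x))). assert (H2 := re_le_Cmod (c * dg x)).
        rewrite Cmod_mult in H2.
        assert (H3 := Rmult_le_compat_l _ _ _ (Cmod_ge_0 c) (Hle x Hx)). lra. }
      replace (Re (c * (g b - g a))) with (Re (c * g b) - Re (c * g a))
        by (unfold Re, Cmult, Cminus, Cplus, Copp; cbn; ring).
      nra. }
  destruct (Ceq_dec (g b - g a) 0) as [E|N].
  - rewrite E, Cmod_0. specialize (Main 1). rewrite Cmod_1, E in Main.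
    unfold Re, Cmult in Main; cbn in Main. lra.
  - specialize (Main (Cconj (g b - g a))).
    rewrite Cmult_comm, <- Cmod2_conj, Cmod_conj in Main.
    assert (P := proj1 (Cmod_gt_0 _) N).
    cbn -[Cmod] in Main. nra.
Qed.

Lemma Cmod_minus_diag (x : C) : Cmod (x - x) = 0.
Proof. replace (x - x)%C with (RtoC 0) by ring. apply Cmod_0. Qed.

Lemma Cmod_diff_le (x y : C) : Rabs (Cmod x - Cmod y) <= Cmod (x - y).
Proof.
  assert (T1 := Cmod_triangle (x - y) y). assert (T2 := Cmod_triangle (- (x - y)) x).
  rewrite Cmod_opp in T2. replace (x - y + y)%C with x in T1 by ring.
  replace (- (x - y) + x)%C with y in T2 by ring. apply Rabs_le. lra.
Qed.

Lemma segment_in_ball (p a b : C) (r t : R) :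
  Cmod (a - p) <= r -> Cmod (b - p) <= r -> 0 <= t <= 1 ->
  Cmod (a + RtoC t * (b - a) - p) <= r.
Proof.
  intros Ha Hb Ht.
  replace (a + RtoC t * (b - a) - p)%C
    with (RtoC (1 - t) * (a - p) + RtoC t * (b - p))%C
    by (rewrite RtoC_minus; ring).
  eapply Rle_trans; [apply Cmod_triangle|].
  rewrite !Cmod_mult, !Cmod_R, !Rabs_pos_eq by lra. nra.
Qed.

Lemma segment_in_disk (a b : C) (t : R) :
  disk a -> disk b -> 0 <= t <= 1 -> disk (a + RtoC t * (b - a)).
Proof.
  unfold disk. intros Ha Hb Ht.
  apply Rle_lt_trans with (Rmax (Cmod a) (Cmod b)); [|now apply Rmax_lub_lt].
  replace (a + RtoC t * (b - a))%C with (a + RtoC t * (b - a) - 0)%C by ring.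
  apply segment_in_ball; [| |exact Ht].
  - replace (a - 0)%C with a by ring. apply Rmax_l.
  - replace (b - 0)%C with b by ring. apply Rmax_r.
Qed.

(** Subtracting the linear function [z -> z l] first makes this serve both as a
    Lipschitz bound ([l = 0]) and as a bound on first order remainders. *)
Lemma complex_mean_value (f df : C -> C) (a b l : C) (M : R) :
  (forall t, 0 <= t <= 1 -> let z := (a + RtoC t * (b - a))%C in
     cderiv f z (df z) /\ Cmod (df z - l) <= M) ->
  Cmod (f b - f a - (b - a) * l) <= M * Cmod (b - a).
Proof.
  intros H.
  set (h := fun t : R => (f (a + RtoC t * (b - a)) - (a + RtoC t * (b - a)) * l)%C).
  replace (f b - f a - (b - a) * l)%C with (h 1 - h 0)%C.
  2: { unfold h. replace (a + 1 * (b - a))%C with b by ring.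
       replace (a + 0 * (b - a))%C with a by ring. ring. }
  replace (M * Cmod (b - a))
    with ((fun t => t * (M * Cmod (b - a))) 1 - (fun t => t * (M * Cmod (b - a))) 0)
    by (cbn beta; ring).
  apply (curve_mean_value h
    (fun t => ((df (a + RtoC t * (b - a)) - l) * (b - a))%C)
    (fun t => t * (M * Cmod (b - a))) (fun _ => M * Cmod (b - a))); [lra| | |].
  - intros t Ht. unfold h.
    apply (curve_deriv_comp (fun z => f z - z * l)%C (fun t => a + RtoC t * (b - a))%C).
    + apply cderiv_minus; [apply H, Ht|].
      apply (cderiv_ext (fun z => l * z)%C); [intros; ring|].
      apply cderiv_eq with (l * 1)%C; [apply cderiv_scal, cderiv_id|ring].
    + apply curve_deriv_line.
  - intros t _. auto_derive; [exact I|ring].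
  - intros t Ht. rewrite Cmod_mult. apply Rmult_le_compat_r; [apply Cmod_ge_0|].
    apply H, Ht.
Qed.

(** * Integrals of complex-valued functions of a real variable *)

Definition is_CInt (g : R -> C) (a b : R) (l : C) : Prop :=
  is_RInt (V := C_R_CompleteNormedModule) g a b l.

Definition CInt (g : R -> C) (a b : R) : C := RInt (V := C_R_CompleteNormedModule) g a b.

Lemma CInt_correct (g : R -> C) (a b : R) :
  a <= b -> (forall t, a <= t <= b -> curve_cont g t) -> is_CInt g a b (CInt g a b).
Proof.
  intros Hab H. apply (RInt_correct (V := C_R_CompleteNormedModule)).
  apply (ex_RInt_continuous (V := C_R_CompleteNormedModule)).
  intros t. rewrite Rmin_left, Rmax_right by exact Hab. intros Ht.
  apply curve_cont_prod, H, Ht.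
Qed.

Lemma is_CInt_unique (g : R -> C) (a b : R) (l : C) : is_CInt g a b l -> CInt g a b = l.
Proof. apply (is_RInt_unique (V := C_R_CompleteNormedModule)). Qed.

Lemma is_CInt_ext (f g : R -> C) (a b : R) (l : C) :
  (forall t, f t = g t) -> is_CInt f a b l -> is_CInt g a b l.
Proof.
  intros E. apply (is_RInt_ext (V := C_R_CompleteNormedModule)). intros; apply E.
Qed.

Lemma is_CInt_minus (f g : R -> C) (a b : R) (l k : C) :
  is_CInt f a b l -> is_CInt g a b k -> is_CInt (fun t => (f t - g t)%C) a b (l - k)%C.
Proof. apply (is_RInt_minus (V := C_R_CompleteNormedModule)). Qed.

Lemma is_CInt_scal (c : C) (g : R -> C) (a b : R) (l : C) :
  is_CInt g a b l -> is_CInt (fun t => (c * g t)%C) a b (c * l)%C.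
Proof.
  intros H.
  assert (H1 := is_RInt_fct_extend_fst (U := R_NormedModule) (V := R_NormedModule) _ _ _ _ H).
  assert (H2 := is_RInt_fct_extend_snd (U := R_NormedModule) (V := R_NormedModule) _ _ _ _ H).
  apply (is_RInt_fct_extend_pair (U := R_NormedModule) (V := R_NormedModule)).
  - apply (is_RInt_minus (V := R_NormedModule) (fun t => fst c * fst (g t)) (fun t => snd c * snd (g t)));
      now apply (is_RInt_scal (V := R_NormedModule)).
  - apply (is_RInt_plus (V := R_NormedModule) (fun t => fst c * snd (g t)) (fun t => snd c * fst (g t)));
      now apply (is_RInt_scal (V := R_NormedModule)).
Qed.

Lemma is_CInt_derive (F g : R -> C) (a b : R) :
  a <= b -> (forall t, a <= t <= b -> curve_deriv F t (g t)) ->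
  (forall t, a <= t <= b -> curve_cont g t) -> is_CInt g a b (F b - F a)%C.
Proof.
  intros Hab HF Hg. apply (is_RInt_derive (V := C_R_CompleteNormedModule));
    intros t; rewrite Rmin_left, Rmax_right by exact Hab; intros Ht.
  - apply HF, Ht.
  - apply curve_cont_prod, Hg, Ht.
Qed.

Lemma is_CInt_bound (g : R -> C) (a b M : R) (l : C) :
  a <= b -> (forall t, a <= t <= b -> Cmod (g t) <= M) -> is_CInt g a b l ->
  Cmod l <= (b - a) * M.
Proof.
  intros Hab H HI. rewrite Cmod_norm.
  apply (norm_RInt_le_const (V := C_R_NormedModule) g); [exact Hab| |exact HI].
  intros t Ht. rewrite <- Cmod_norm. apply H, Ht.
Qed.

(** * Goursat's theorem and primitives *)

Definition segment_int (f : C -> C) (a b : C) : C :=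
  CInt (fun s => ((b - a) * f (a + RtoC s * (b - a)))%C) 0 1.

Definition cont_on_disk (f : C -> C) : Prop := forall z, disk z -> ccont f z.

Lemma segment_cont (f : C -> C) (a b : C) (t : R) :
  cont_on_disk f -> disk a -> disk b -> 0 <= t <= 1 ->
  curve_cont (fun s => ((b - a) * f (a + RtoC s * (b - a)))%C) t.
Proof.
  intros Hf Ha Hb Ht. apply curve_cont_mult; [apply curve_cont_const|].
  apply (curve_cont_comp (fun s => a + RtoC s * (b - a))%C f).
  - apply (curve_deriv_cont _ _ (b - a)%C), curve_deriv_line.
  - now apply Hf, segment_in_disk.
Qed.

Lemma segment_int_correct (f : C -> C) (a b : C) :
  cont_on_disk f -> disk a -> disk b ->
  is_CInt (fun s => ((b - a) * f (a + RtoC s * (b - a)))%C) 0 1 (segment_int f a b).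
Proof.
  intros Hf Ha Hb. apply CInt_correct; [lra|]. intros t Ht. now apply segment_cont.
Qed.

Lemma is_CInt_lin (g : R -> C) (u v : R) (l : C) :
  is_CInt g v (u + v) l -> is_CInt (fun s => (RtoC u * g (u * s + v)%R)%C) 0 1 l.
Proof.
  intros H. apply is_CInt_ext with (f := fun s => scal (V := C_R_NormedModule) u (g (u * s + v))).
  - intros s. apply injective_projections; cbn; unfold mult; cbn; ring.
  - apply (is_RInt_comp_lin (V := C_R_CompleteNormedModule)).
    replace (u * 0 + v) with v by ring. replace (u * 1 + v) with (u + v) by ring. exact H.
Qed.

Lemma segment_int_swap (f : C -> C) (a b : C) :
  cont_on_disk f -> disk a -> disk b -> segment_int f b a = (- segment_int f a b)%C.
Proof.
  intros Hf Ha Hb. apply is_CInt_unique.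
  apply is_CInt_ext with
    (f := fun s => (RtoC (-1) * ((b - a) * f (a + RtoC (-1 * s + 1) * (b - a))))%C).
  - intros s. rewrite RtoC_plus, RtoC_mult.
    replace (RtoC (-1)) with (- (1))%C by (rewrite <- RtoC_opp; f_equal; ring).
    replace (a + (- (1) * s + 1) * (b - a))%C with (b + s * (a - b))%C by ring. ring.
  - apply (is_CInt_lin (fun x => ((b - a) * f (a + RtoC x * (b - a)))%C)).
    replace (-1 + 1) with 0 by ring.
    apply (is_RInt_swap (V := C_R_CompleteNormedModule)), segment_int_correct; assumption.
Qed.

Definition midpoint (a b : C) : C := (a + RtoC (/ 2) * (b - a))%C.

Lemma segment_int_midpoint (f : C -> C) (a b : C) :
  cont_on_disk f -> disk a -> disk b ->
  segment_int f a b = (segment_int f a (midpoint a b) + segment_int f (midpoint a b) b)%C.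
Proof.
  intros Hf Ha Hb.
  set (g := fun s => ((b - a) * f (a + RtoC s * (b - a)))%C).
  assert (I1 : is_CInt g 0 (/ 2) (CInt g 0 (/ 2))).
  { apply CInt_correct; [lra|]. intros; apply segment_cont; try assumption; lra. }
  assert (I2 : is_CInt g (/ 2) 1 (CInt g (/ 2) 1)).
  { apply CInt_correct; [lra|]. intros; apply segment_cont; try assumption; lra. }
  assert (E1 : segment_int f a (midpoint a b) = CInt g 0 (/ 2)).
  { apply is_CInt_unique. apply is_CInt_ext with (f := fun s => (RtoC (/ 2) * g (/ 2 * s + 0)%R)%C).
    - intros s. unfold g, midpoint. rewrite Rplus_0_r, RtoC_mult.
      replace (a + RtoC (/ 2) * s * (b - a))%C
        with (a + s * (a + RtoC (/ 2) * (b - a) - a))%C by ring. ring.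
    - apply (is_CInt_lin g). rewrite Rplus_0_r. exact I1. }
  assert (E2 : segment_int f (midpoint a b) b = CInt g (/ 2) 1).
  { assert (H2 : RtoC (/ 2) = (1 - RtoC (/ 2))%C)
      by (rewrite <- RtoC_minus; f_equal; field).
    apply is_CInt_unique. apply is_CInt_ext with (f := fun s => (RtoC (/ 2) * g (/ 2 * s + / 2)%R)%C).
    - intros s. unfold g, midpoint. rewrite RtoC_plus, RtoC_mult.
      replace (b - (a + RtoC (/ 2) * (b - a)))%C with ((1 - RtoC (/ 2)) * (b - a))%C by ring.
      rewrite <- H2.
      replace (a + (RtoC (/ 2) * s + RtoC (/ 2)) * (b - a))%C
        with (a + RtoC (/ 2) * (b - a) + s * (RtoC (/ 2) * (b - a)))%C by ring. ring.
    - apply (is_CInt_lin g). replace (/ 2 + / 2) with 1 by field. exact I2. }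
  rewrite E1, E2. apply is_CInt_unique.
  apply (is_RInt_Chasles (V := C_R_CompleteNormedModule) g 0 (/ 2) 1); assumption.
Qed.

(** Comparison of [f] with a function [g] whose integral [k] along the segment is
    known explicitly; [g] will be affine or constant. *)
Lemma segment_int_bound (f : C -> C) (a b : C) (M : R) (g : C -> C) (k : C) :
  cont_on_disk f -> disk a -> disk b ->
  is_CInt (fun s => ((b - a) * g (a + RtoC s * (b - a)))%C) 0 1 k ->
  (forall t, 0 <= t <= 1 ->
     Cmod (f (a + RtoC t * (b - a))%C - g (a + RtoC t * (b - a))%C) <= M) ->
  Cmod (segment_int f a b - k) <= Cmod (b - a) * M.
Proof.
  intros Hf Ha Hb Hg HM.
  replace (Cmod (b - a) * M) with ((1 - 0) * (Cmod (b - a) * M)) by ring.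
  apply (is_CInt_bound (fun s => ((b - a) * f (a + RtoC s * (b - a))
     - (b - a) * g (a + RtoC s * (b - a)))%C)); [lra| |].
  - intros t Ht.
    replace ((b - a) * f (a + RtoC t * (b - a)) - (b - a) * g (a + RtoC t * (b - a)))%C
      with ((b - a) * (f (a + RtoC t * (b - a)) - g (a + RtoC t * (b - a))))%C by ring.
    rewrite Cmod_mult. apply Rmult_le_compat_l; [apply Cmod_ge_0|]. apply HM, Ht.
  - apply is_CInt_minus; [|exact Hg]. now apply segment_int_correct.
Qed.

Lemma segment_int_derive (F f : C -> C) (a b : C) :
  (forall z, cderiv F z (f z)) -> (forall z, ccont f z) ->
  is_CInt (fun s => ((b - a) * f (a + RtoC s * (b - a)))%C) 0 1 (F b - F a)%C.
Proof.
  intros HF Hf.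
  replace (F b - F a)%C with ((fun s => F (a + RtoC s * (b - a))%C) 1 - (fun s => F (a + RtoC s * (b - a))%C) 0)%C.
  2: { cbv beta. replace (a + 1 * (b - a))%C with b by ring.
       replace (a + 0 * (b - a))%C with a by ring. reflexivity. }
  apply (is_CInt_derive (fun s => F (a + RtoC s * (b - a))%C)); [lra| |].
  - intros t _. rewrite Cmult_comm.
    apply (curve_deriv_comp F (fun s => a + RtoC s * (b - a))%C); [apply HF|apply curve_deriv_line].
  - intros t _. apply curve_cont_mult; [apply curve_cont_const|].
    apply (curve_cont_comp (fun s => a + RtoC s * (b - a))%C f); [|apply Hf].
    apply (curve_deriv_cont _ _ (b - a)%C), curve_deriv_line.
Qed.

Definition vertices : Type := (C * C * C)%type.

Definition triangle_int (f : C -> C) (T : vertices) : C :=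
  let '(a, b, c) := T in (segment_int f a b + segment_int f b c + segment_int f c a)%C.

Definition perimeter (T : vertices) : R :=
  let '(a, b, c) := T in Cmod (b - a) + Cmod (c - b) + Cmod (a - c).

Definition triangle_within (r : R) (T : vertices) : Prop :=
  let '(a, b, c) := T in Cmod a <= r /\ Cmod b <= r /\ Cmod c <= r.

Definition corner (T : vertices) : C := fst (fst T).

Definition quarter (T T' : vertices) : Prop :=
  let '(a, b, c) := T in
  let p := midpoint a b in let q := midpoint b c in let r := midpoint c a in
  T' = (a, p, r) \/ T' = (p, b, q) \/ T' = (r, q, c) \/ T' = (p, q, r).

Lemma midpoint_within (a b : C) (r : R) :
  Cmod a <= r -> Cmod b <= r -> Cmod (midpoint a b) <= r.
Proof.
  intros Ha Hb. replace (midpoint a b) with (a + RtoC (/ 2) * (b - a) - 0)%C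
    by (unfold midpoint; ring).
  apply segment_in_ball; [| |lra].
  - now replace (a - 0)%C with a by ring.
  - now replace (b - 0)%C with b by ring.
Qed.

Lemma half_sum : (RtoC (/ 2) + RtoC (/ 2))%C = RtoC 1.
Proof. rewrite <- RtoC_plus. f_equal. field. Qed.

Lemma Cmod_half (x y : C) : x = (RtoC (/ 2) * y)%C -> Cmod x = / 2 * Cmod y.
Proof. intros ->. rewrite Cmod_mult, Cmod_R, Rabs_pos_eq by lra. reflexivity. Qed.

Lemma midline (a b c : C) : (midpoint b c - midpoint a b = RtoC (/ 2) * (c - a))%C.
Proof.
  unfold midpoint.
  replace (b + RtoC (/ 2) * (c - b) - (a + RtoC (/ 2) * (b - a)))%C
    with ((1 - (RtoC (/ 2) + RtoC (/ 2))) * (b - a) + RtoC (/ 2) * (c - a))%C by ring.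
  rewrite half_sum. ring.
Qed.

Lemma midpoint_sym (a b : C) : midpoint a b = midpoint b a.
Proof.
  unfold midpoint.
  replace (a + RtoC (/ 2) * (b - a))%C
    with ((1 - (RtoC (/ 2) + RtoC (/ 2))) * (a - b) + (b + RtoC (/ 2) * (a - b)))%C by ring.
  rewrite half_sum. ring.
Qed.

Lemma midpoint_l (a b : C) : (midpoint a b - a = RtoC (/ 2) * (b - a))%C.
Proof. unfold midpoint. ring. Qed.

Lemma midpoint_r (a b : C) : (b - midpoint a b = RtoC (/ 2) * (b - a))%C.
Proof.
  rewrite midpoint_sym. unfold midpoint. ring.
Qed.

Lemma quarter_perimeter (T T' : vertices) : quarter T T' -> perimeter T' = / 2 * perimeter T.
Proof.
  destruct T as [[a b] c]. unfold quarter, perimeter.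
  assert (Rw : forall x y z t : C, (x - y = RtoC (/ 2) * (z - t))%C -> Cmod (x - y) = / 2 * Cmod (z - t))
    by (intros; now apply Cmod_half).
  intros [->|[->|[->| ->]]].
  - rewrite (Rw _ _ _ _ (midpoint_l a b)), (Rw _ _ _ _ (midpoint_r c a)).
    rewrite (Rw (midpoint c a) (midpoint a b) c b).
    2: { rewrite (midpoint_sym c a), (midpoint_sym a b). apply midline. }
    ring.
  - rewrite (Rw _ _ _ _ (midpoint_r a b)), (Rw _ _ _ _ (midpoint_l b c)).
    rewrite (Rw (midpoint a b) (midpoint b c) a c).
    2: { rewrite (midpoint_sym b c), (midpoint_sym a b). apply midline. }
    ring.
  - rewrite (Rw _ _ _ _ (midpoint_r b c)), (Rw _ _ _ _ (midpoint_l c a)).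
    rewrite (Rw (midpoint b c) (midpoint c a) b a).
    2: { rewrite (midpoint_sym b c), (midpoint_sym c a). apply midline. }
    ring.
  - rewrite (Rw _ _ _ _ (midline a b c)), (Rw _ _ _ _ (midline b c a)), (Rw _ _ _ _ (midline c a b)).
    replace (Cmod (c - a)) with (Cmod (a - c)) by (rewrite <- Cmod_opp; f_equal; ring).
    replace (Cmod (a - b)) with (Cmod (b - a)) by (rewrite <- Cmod_opp; f_equal; ring).
    replace (Cmod (b - c)) with (Cmod (c - b)) by (rewrite <- Cmod_opp; f_equal; ring).
    ring.
Qed.

Lemma quarter_within (r : R) (T T' : vertices) :
  quarter T T' -> triangle_within r T -> triangle_within r T'.
Proof.
  destruct T as [[a b] c]. unfold quarter, triangle_within.
  intros [->|[->|[->| ->]]] [Ha [Hb Hc]]; repeat split; try assumption;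
    apply midpoint_within; assumption.
Qed.

Lemma quarter_corner (T T' : vertices) : quarter T T' -> Cmod (corner T' - corner T) <= perimeter T.
Proof.
  destruct T as [[a b] c]. unfold quarter, perimeter, corner.
  assert (P1 := Cmod_ge_0 (b - a)). assert (P2 := Cmod_ge_0 (c - b)). assert (P3 := Cmod_ge_0 (a - c)).
  intros [->|[->|[->| ->]]]; cbn [fst].
  - rewrite Cmod_minus_diag. lra.
  - rewrite (Cmod_half _ _ (midpoint_l a b)). lra.
  - rewrite midpoint_sym, (Cmod_half _ _ (midpoint_l a c)).
    replace (Cmod (c - a)) with (Cmod (a - c)) by (rewrite <- Cmod_opp; f_equal; ring). lra.
  - rewrite (Cmod_half _ _ (midpoint_l a b)). lra.
Qed.

(** The inner edges cancel, so one of the four quarters carries at least a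
    fourth of the integral. *)
Lemma quarter_exists (f : C -> C) (r : R) (T : vertices) :
  cont_on_disk f -> r < 1 -> triangle_within r T ->
  exists T', quarter T T' /\ Cmod (triangle_int f T) <= 4 * Cmod (triangle_int f T').
Proof.
  destruct T as [[a b] c]. intros Hf Hr [Ha [Hb Hc]].
  set (p := midpoint a b). set (q := midpoint b c). set (s := midpoint c a).
  assert (D : forall z, Cmod z <= r -> disk z) by (unfold disk; intros; lra).
  assert (Hp : Cmod p <= r) by now apply midpoint_within.
  assert (Hq : Cmod q <= r) by now apply midpoint_within.
  assert (Hs : Cmod s <= r) by now apply midpoint_within.
  assert (E : triangle_int f (a, b, c) =
    (triangle_int f (a, p, s) + triangle_int f (p, b, q)
     + triangle_int f (s, q, c) + triangle_int f (p, q, s))%C).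
  { unfold triangle_int.
    rewrite (segment_int_midpoint f a b), (segment_int_midpoint f b c), (segment_int_midpoint f c a) by auto.
    fold p q s.
    rewrite (segment_int_swap f p s), (segment_int_swap f q p), (segment_int_swap f s q) by auto.
    ring. }
  assert (Tr : Cmod (triangle_int f (a, b, c)) <=
    Cmod (triangle_int f (a, p, s)) + Cmod (triangle_int f (p, b, q))
     + Cmod (triangle_int f (s, q, c)) + Cmod (triangle_int f (p, q, s))).
  { rewrite E. eapply Rle_trans; [apply Cmod_triangle|]. apply Rplus_le_compat_r.
    eapply Rle_trans; [apply Cmod_triangle|]. apply Rplus_le_compat_r. apply Cmod_triangle. }
  apply NNPP. intros N.
  assert (K : forall T', quarter (a, b, c) T' ->
            4 * Cmod (triangle_int f T') < Cmod (triangle_int f (a, b, c))).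
  { intros T' HT'. apply Rnot_le_lt. intros L. apply N. exists T'. split; assumption. }
  assert (K1 := K (a, p, s) (or_introl eq_refl)).
  assert (K2 := K (p, b, q) (or_intror (or_introl eq_refl))).
  assert (K3 := K (s, q, c) (or_intror (or_intror (or_introl eq_refl)))).
  assert (K4 := K (p, q, s) (or_intror (or_intror (or_intror eq_refl)))).
  lra.
Qed.

Lemma geometric_steps_telescope (u : nat -> R) (d : R) :
  (forall n, Rabs (u (S n) - u n) <= d * (/ 2) ^ n) ->
  forall n k, Rabs (u (n + k)%nat - u n) <= 2 * d * (/ 2) ^ n * (1 - (/ 2) ^ k).
Proof.
  intros H n k. induction k as [|k IH].
  - rewrite Nat.add_0_r, Rminus_diag, Rabs_R0. cbn. lra.
  - rewrite Nat.add_succ_r. specialize (H (n + k)%nat). rewrite pow_add in H.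
    replace (u (S (n + k)) - u n) with ((u (S (n + k)) - u (n + k)%nat) + (u (n + k)%nat - u n)) by ring.
    eapply Rle_trans; [apply Rabs_triang|].
    cbn [pow]. lra.
Qed.

Lemma half_pow_pos (n : nat) : 0 < (/ 2) ^ n.
Proof. apply pow_lt. lra. Qed.

Lemma half_pow_small (eps : R) : 0 < eps -> exists N, forall n, (N <= n)%nat -> (/ 2) ^ n < eps.
Proof.
  intros He. destruct (pow_lt_1_zero (/ 2)) with (y := eps) as [N HN].
  - rewrite Rabs_pos_eq; lra.
  - exact He.
  - exists N. intros n Hn. specialize (HN n Hn).
    rewrite Rabs_pos_eq in HN; [exact HN|]. apply Rlt_le, half_pow_pos.
Qed.

Lemma geometric_steps_limit (u : nat -> R) (d : R) :
  0 <= d -> (forall n, Rabs (u (S n) - u n) <= d * (/ 2) ^ n) ->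
  exists l, forall n, Rabs (u n - l) <= 2 * d * (/ 2) ^ n.
Proof.
  intros Hd H. assert (T := geometric_steps_telescope u d H).
  assert (T' : forall n k, Rabs (u (n + k)%nat - u n) <= 2 * d * (/ 2) ^ n).
  { intros n k. eapply Rle_trans; [apply T|].
    assert (P := half_pow_pos k). assert (Q := half_pow_pos n).
    assert (0 <= 2 * d * (/ 2) ^ n) by (apply Rmult_le_pos; lra). nra. }
  destruct (Rcomplete.R_complete u) as [l Hl].
  { intros eps He. destruct (half_pow_small (eps / (4 * d + 1))) as [N HN].
    { apply Rdiv_lt_0_compat; lra. }
    exists N. intros n m Hn Hm.
    replace n with (N + (n - N))%nat by lia. replace m with (N + (m - N))%nat by lia.
    unfold Rdist.
    replace (u (N + (n - N))%nat - u (N + (m - N))%nat)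
      with ((u (N + (n - N))%nat - u N) + - (u (N + (m - N))%nat - u N)) by ring.
    eapply Rle_lt_trans; [apply Rabs_triang|]. rewrite Rabs_Ropp.
    assert (T1 := T' N (n - N)%nat). assert (T2 := T' N (m - N)%nat).
    specialize (HN N (Nat.le_refl N)).
    apply (Rmult_lt_compat_r (4 * d + 1)) in HN; [|lra].
    unfold Rdiv in HN. rewrite Rmult_assoc, Rinv_l in HN by lra.
    assert (P := half_pow_pos N). nra. }
  exists l. intros n. apply le_epsilon. intros eps He.
  destruct (Hl eps He) as [N HN].
  specialize (HN (n + N)%nat ltac:(lia)). unfold Rdist in HN.
  replace (u n - l) with (- (u (n + N)%nat - u n) + (u (n + N)%nat - l)) by ring.
  eapply Rle_trans; [apply Rabs_triang|]. rewrite Rabs_Ropp.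
  assert (T1 := T' n N). lra.
Qed.

Lemma Cmod_le_sum (z : C) : Cmod z <= Rabs (Re z) + Rabs (Im z).
Proof.
  replace z with (RtoC (Re z) + Ci * RtoC (Im z))%C at 1.
  - eapply Rle_trans; [apply Cmod_triangle|].
    rewrite Cmod_mult, Cmod_Ci, !Cmod_R. lra.
  - destruct z. apply injective_projections; cbn; ring.
Qed.

Lemma Im_le_Cmod (z : C) : Rabs (Im z) <= Cmod z.
Proof. eapply Rle_trans; [apply Rmax_r|apply Rmax_Cmod]. Qed.

Lemma Re_minus (x y : C) : Re (x - y) = Re x - Re y.
Proof. reflexivity. Qed.

Lemma Im_minus (x y : C) : Im (x - y) = Im x - Im y.
Proof. reflexivity. Qed.

Lemma geometric_steps_limit_C (u : nat -> C) (d : R) :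
  0 <= d -> (forall n, Cmod (u (S n) - u n) <= d * (/ 2) ^ n) ->
  exists l, forall n, Cmod (u n - l) <= 4 * d * (/ 2) ^ n.
Proof.
  intros Hd H.
  destruct (geometric_steps_limit (fun n => Re (u n)) d Hd) as [x Hx].
  { intros n. eapply Rle_trans; [|apply H].
    rewrite <- Re_minus. apply re_le_Cmod. }
  destruct (geometric_steps_limit (fun n => Im (u n)) d Hd) as [y Hy].
  { intros n. eapply Rle_trans; [|apply H].
    rewrite <- Im_minus. apply Im_le_Cmod. }
  exists (x, y). intros n. eapply Rle_trans; [apply Cmod_le_sum|].
  rewrite Re_minus, Im_minus. cbn [Re Im fst snd].
  specialize (Hx n). specialize (Hy n). lra.
Qed.

Definition next_quarter (f : C -> C) (T : vertices) : vertices :=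
  epsilon (inhabits T)
    (fun T' => quarter T T' /\ Cmod (triangle_int f T) <= 4 * Cmod (triangle_int f T')).

Definition nested (f : C -> C) (T : vertices) (n : nat) : vertices :=
  Nat.iter n (next_quarter f) T.

Lemma nested_within (f : C -> C) (r : R) (T : vertices) (n : nat) :
  cont_on_disk f -> r < 1 -> triangle_within r T ->
  triangle_within r (nested f T n) /\
  (quarter (nested f T n) (nested f T (S n)) /\
   Cmod (triangle_int f (nested f T n)) <= 4 * Cmod (triangle_int f (nested f T (S n)))).
Proof.
  intros Hf Hr HT.
  assert (St : forall n, triangle_within r (nested f T n) -> quarter (nested f T n) (nested f T (S n)) /\
    Cmod (triangle_int f (nested f T n)) <= 4 * Cmod (triangle_int f (nested f T (S n)))).
  { intros k Hk. cbn. apply (epsilon_spec (inhabits (nested f T k))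
      (fun T' => quarter (nested f T k) T' /\ Cmod (triangle_int f (nested f T k)) <= 4 * Cmod (triangle_int f T'))).
    now apply (quarter_exists f r). }
  induction n as [|n [IH1 [IH2 _]]].
  - split; [exact HT|]. apply St, HT.
  - assert (K : triangle_within r (nested f T (S n))) by (eapply quarter_within; eassumption).
    split; [exact K|]. apply St, K.
Qed.

Lemma nested_perimeter (f : C -> C) (r : R) (T : vertices) (n : nat) :
  cont_on_disk f -> r < 1 -> triangle_within r T ->
  perimeter (nested f T n) = perimeter T * (/ 2) ^ n.
Proof.
  intros Hf Hr HT. induction n as [|n IH]; [cbn; ring|].
  destruct (nested_within f r T n Hf Hr HT) as [_ [Q _]]. rewrite (quarter_perimeter _ _ Q), IH. cbn. ring.
Qed.

Lemma nested_int (f : C -> C) (r : R) (T : vertices) (n : nat) :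
  cont_on_disk f -> r < 1 -> triangle_within r T ->
  Cmod (triangle_int f T) * ((/ 2) ^ n * (/ 2) ^ n) <= Cmod (triangle_int f (nested f T n)).
Proof.
  intros Hf Hr HT. induction n as [|n IH]; [cbn; lra|].
  destruct (nested_within f r T n Hf Hr HT) as [_ [_ Q]]. cbn [pow]. lra.
Qed.

Lemma perimeter_pos (U : vertices) : 0 <= perimeter U.
Proof.
  destruct U as [[a b] c]. cbn.
  generalize (Cmod_ge_0 (b - a)) (Cmod_ge_0 (c - b)) (Cmod_ge_0 (a - c)). lra.
Qed.

Lemma nested_limit (f : C -> C) (r : R) (T : vertices) :
  cont_on_disk f -> r < 1 -> triangle_within r T ->
  exists p, disk p /\
  forall n, Cmod (corner (nested f T n) - p) <= 4 * perimeter T * (/ 2) ^ n.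
Proof.
  intros Hf Hr HT.
  destruct (geometric_steps_limit_C (fun n => corner (nested f T n)) (perimeter T)) as [p Hp].
  - apply perimeter_pos.
  - intros n. rewrite <- (nested_perimeter f r) by assumption. apply quarter_corner. now apply (nested_within f r).
  - exists p. split; [|exact Hp].
    destruct (half_pow_small ((1 - r) / (4 * perimeter T + 1))) as [N HN].
    { apply Rdiv_lt_0_compat; [lra|]. generalize (perimeter_pos T). lra. }
    specialize (HN N (Nat.le_refl N)). specialize (Hp N).
    destruct (nested_within f r T N Hf Hr HT) as [W _].
    assert (Hc : Cmod (corner (nested f T N)) <= r).
    { destruct (nested f T N) as [[a b] c]. apply W. }
    red. replace p with (corner (nested f T N) + - (corner (nested f T N) - p))%C by ring.
    eapply Rle_lt_trans; [apply Cmod_triangle|]. rewrite Cmod_opp.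
    assert (P := perimeter_pos T). assert (Q := half_pow_pos N).
    apply (Rmult_lt_compat_r (4 * perimeter T + 1)) in HN; [|lra].
    unfold Rdiv in HN. rewrite Rmult_assoc, Rinv_l in HN by lra. nra.
Qed.


(** Near a point of differentiability [f] differs from an affine function, whose
    integral over a triangle vanishes, by at most [eps] times the distance. *)
Lemma triangle_int_small (f : C -> C) (p l : C) (T : vertices) (eps R1 : R) :
  cont_on_disk f -> (exists r, r < 1 /\ triangle_within r T) -> 0 <= eps ->
  (forall w, Cmod (w - p) <= R1 -> Cmod (f w - f p - (w - p) * l) <= eps * Cmod (w - p)) ->
  Cmod (corner T - p) + perimeter T <= R1 ->
  Cmod (triangle_int f T) <= eps * R1 * perimeter T.
Proof.
  destruct T as [[a b] c]. intros Hf [r [Hr [Ha [Hb Hc]]]] He Hl HR. cbn in HR.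
  assert (Da : disk a) by (red; lra). assert (Db : disk b) by (red; lra).
  assert (Dc : disk c) by (red; lra).
  assert (P1 := Cmod_ge_0 (b - a)). assert (P2 := Cmod_ge_0 (c - b)). assert (P3 := Cmod_ge_0 (a - c)).
  assert (Na : Cmod (a - p) <= R1) by lra.
  assert (Nb : Cmod (b - p) <= R1).
  { replace (b - p)%C with ((a - p) + (b - a))%C by ring.
    eapply Rle_trans; [apply Cmod_triangle|lra]. }
  assert (Nc : Cmod (c - p) <= R1).
  { replace (c - p)%C with ((a - p) + - (a - c))%C by ring.
    eapply Rle_trans; [apply Cmod_triangle|rewrite Cmod_opp; lra]. }
  set (g := fun w => (f p + (w - p) * l)%C).
  set (G := fun w => (f p * w + RtoC (/ 2) * (w - p) * (w - p) * l)%C).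
  assert (HG : forall z, cderiv G z (g z)).
  { intros z. unfold G.
    assert (S1 : cderiv (fun w => w - p)%C z 1).
    { apply cderiv_eq with (1 - 0)%C; [|ring]. apply cderiv_minus; [apply cderiv_id|apply cderiv_const]. }
    apply cderiv_eq with (f p * 1 + RtoC (/ 2) * l * (1 * (z - p) + (z - p) * 1))%C.
    - apply cderiv_plus; [apply cderiv_scal, cderiv_id|].
      apply cderiv_ext with (fun w => (RtoC (/ 2) * l * ((w - p) * (w - p)))%C); [intros; ring|].
      apply cderiv_scal. now apply (cderiv_mult (fun w => (w - p)%C) (fun w => (w - p)%C)).
    - unfold g. transitivity (f p + (RtoC (/ 2) + RtoC (/ 2)) * l * (z - p))%C; [ring|].
      rewrite half_sum. ring. }
  assert (Cg : forall z, ccont g z).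
  { intros z. apply ccont_plus; [apply ccont_const|].
    apply ccont_mult; [|apply ccont_const].
    apply (ccont_plus (fun w => w) (fun _ => (- p)%C)); [apply ccont_id|apply ccont_const]. }
  assert (B : forall x y, disk x -> disk y -> Cmod (x - p) <= R1 -> Cmod (y - p) <= R1 ->
     Cmod (segment_int f x y - (G y - G x)) <= Cmod (y - x) * (eps * R1)).
  { intros x y Dx Dy Nx Ny.
    apply (segment_int_bound f x y (eps * R1) g); try assumption.
    - now apply segment_int_derive.
    - intros t Ht. unfold g.
      set (w := (x + RtoC t * (y - x))%C).
      assert (Nw : Cmod (w - p) <= R1) by now apply segment_in_ball.
      replace (f w - (f p + (w - p) * l))%C with (f w - f p - (w - p) * l)%C by ring.
      eapply Rle_trans; [apply Hl, Nw|]. now apply Rmult_le_compat_l. }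
  unfold triangle_int, perimeter.
  replace (segment_int f a b + segment_int f b c + segment_int f c a)%C
    with ((segment_int f a b - (G b - G a)) + (segment_int f b c - (G c - G b))
          + (segment_int f c a - (G a - G c)))%C by ring.
  eapply Rle_trans; [apply Cmod_triangle|].
  eapply Rle_trans; [apply Rplus_le_compat_r, Cmod_triangle|].
  generalize (B a b Da Db Na Nb) (B b c Db Dc Nb Nc) (B c a Dc Da Nc Na).
  lra.
Qed.

Lemma holomorphic_cderiv (f : C -> C) (z : C) :
  holomorphic f -> disk z -> cderiv f z (C_derive f z).
Proof. intros H Hz. apply (C_derive_correct f z z), H, Hz. Qed.

Lemma holomorphic_cont (f : C -> C) : holomorphic f -> cont_on_disk f.
Proof. intros H z Hz. eapply cderiv_cont, holomorphic_cderiv; eassumption. Qed.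

(** Cutting a triangle of perimeter [d] repeatedly leaves triangles of perimeter
    [d / 2^n] that shrink to a point [p] and carry at least [4^-n] of the integral;
    differentiability at [p] makes that share at most [5 eps d^2 / 4^n]. *)
Theorem goursat (f : C -> C) (a b c : C) :
  holomorphic f -> disk a -> disk b -> disk c -> triangle_int f (a, b, c) = 0.
Proof.
  intros H Ha Hb Hc. assert (Hf := holomorphic_cont f H).
  set (T := (a, b, c)). set (r := Rmax (Cmod a) (Rmax (Cmod b) (Cmod c))).
  assert (Hr : r < 1) by (unfold r; repeat apply Rmax_lub_lt; assumption).
  assert (HT : triangle_within r T).
  { unfold r; repeat split; [apply Rmax_l| |]; (eapply Rle_trans; [|apply Rmax_r]);
      [apply Rmax_l|apply Rmax_r]. }
  destruct (nested_limit f r T Hf Hr HT) as [p [Hp HL]].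
  set (d := perimeter T) in *. assert (Pd : 0 <= d) by apply perimeter_pos.
  apply Cmod_eq_0. apply Rle_antisym; [|apply Cmod_ge_0].
  apply le_epsilon. intros eps He. rewrite Rplus_0_l.
  (* [5 d h], with [h = 2^-N], bounds the distance from [p] to the [N]-th triangle:
     [4 d h] for its corner and [d h] for its perimeter. *)
  set (e := eps / (5 * d * d + 1)).
  assert (Pe : 0 < e) by (apply Rdiv_lt_0_compat; nra).
  destruct (proj1 (cderiv_eps _ _ _) (holomorphic_cderiv f p H Hp) e Pe) as [dl [Hdl HD]].
  destruct (half_pow_small (dl / (5 * d + 1))) as [N HN]; [apply Rdiv_lt_0_compat; lra|].
  specialize (HN N (Nat.le_refl N)). specialize (HL N).
  assert (Q := half_pow_pos N).
  apply (Rmult_lt_compat_r (5 * d + 1)) in HN; [|lra].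
  unfold Rdiv in HN. rewrite Rmult_assoc, Rinv_l in HN by lra.
  set (h := (/ 2) ^ N) in *.
  assert (B : Cmod (triangle_int f (nested f T N)) <= e * (5 * d * h) * (d * h)).
  { replace (d * h) with (perimeter (nested f T N))
      by (apply (nested_perimeter f r); assumption).
    apply (triangle_int_small f p (C_derive f p)).
    - exact Hf.
    - exists r. split; [exact Hr|]. now apply (nested_within f r).
    - lra.
    - intros w Hw. apply HD. nra.
    - rewrite (nested_perimeter f r) by assumption. fold d h. lra. }
  assert (B' := nested_int f r T N Hf Hr HT). fold h in B'.
  assert (Cmod (triangle_int f T) <= e * (5 * d * d)).
  { apply Rmult_le_reg_r with (h * h); [nra|].
    eapply Rle_trans; [apply B'|]. eapply Rle_trans; [apply B|]. right. ring. }
  apply Rle_trans with (e * (5 * d * d + 1)); [nra|].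
  unfold e. right. field. nra.
Qed.

Lemma disk_0 : disk 0.
Proof. red. rewrite Cmod_0. lra. Qed.

Lemma primitive0_segment (f : C -> C) (z : C) : primitive0 f z = segment_int f 0 z.
Proof.
  apply (RInt_ext (V := C_R_CompleteNormedModule)). intros s _.
  replace (z - 0)%C with z by ring. replace (0 + RtoC s * z)%C with (RtoC s * z)%C by ring.
  reflexivity.
Qed.

Lemma disk_open (z : C) : disk z -> forall w, Cmod (w - z) < 1 - Cmod z -> disk w.
Proof.
  unfold disk. intros Hz w Hw. replace w with ((w - z) + z)%C by ring.
  eapply Rle_lt_trans; [apply Cmod_triangle|]. lra.
Qed.

(** By Goursat's theorem for the triangle [0, z, w], the increment of the primitive
    from [z] to [w] is the integral along that side. *)
Theorem primitive0_deriv (f : C -> C) (z : C) :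
  holomorphic f -> disk z -> cderiv (primitive0 f) z (f z).
Proof.
  intros H Hz. assert (Hf := holomorphic_cont f H).
  assert (Dp : forall w, disk w -> (primitive0 f w - primitive0 f z = segment_int f z w)%C).
  { intros w Hw. rewrite !primitive0_segment.
    assert (G := goursat f 0 z w H disk_0 Hz Hw). unfold triangle_int in G.
    rewrite (segment_int_swap f 0 w Hf disk_0 Hw) in G.
    replace (segment_int f z w) with (segment_int f 0 w - segment_int f 0 z
      + (segment_int f 0 z + segment_int f z w + - segment_int f 0 w))%C by ring.
    rewrite G. ring. }
  apply cderiv_eps. intros eps He.
  destruct (proj1 (ccont_eps _ _) (Hf z Hz) eps He) as [d [Hd HD]].
  exists (Rmin d (1 - Cmod z)). split; [apply Rmin_pos; [exact Hd|red in Hz; lra]|].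
  intros w Hw.
  assert (W1 := Rlt_le_trans _ _ _ Hw (Rmin_l _ _)).
  assert (W2 := Rlt_le_trans _ _ _ Hw (Rmin_r _ _)).
  assert (Dw := disk_open z Hz w W2).
  rewrite Dp by exact Dw.
  replace (eps * Cmod (w - z)) with (Cmod (w - z) * eps) by ring.
  replace ((w - z) * f z)%C with (f z * w - f z * z)%C by ring.
  apply (segment_int_bound f z w eps (fun _ => f z)); try assumption.
  - apply (segment_int_derive (fun x => f z * x)%C (fun _ => f z)).
    + intros x. apply cderiv_eq with (f z * 1)%C; [apply cderiv_scal, cderiv_id|ring].
    + intros x. apply ccont_const.
  - intros t Ht. apply Rlt_le, HD.
    apply Rle_lt_trans with (2 := W1). apply segment_in_ball; [| |exact Ht].
    + rewrite Cmod_minus_diag. apply Cmod_ge_0.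
    + apply Rle_refl.
Qed.

(** * Integrals depending on a complex parameter *)

Definition joint_cont (k : C -> R -> C) (x : C) (t : R) : Prop :=
  continuous (T := prod_UniformSpace (Cmod_space) R_UniformSpace)
    (U := Cmod_space) (fun p => k (fst p) (snd p)) (x, t).

Lemma joint_cont_eps (k : C -> R -> C) (x : C) (t : R) :
  joint_cont k x t -> forall eps, 0 < eps -> exists d : posreal,
    forall y s, Cmod (y - x) < d -> Rabs (s - t) < d -> Cmod (k y s - k x t) < eps.
Proof.
  intros H eps He.
  destruct (proj1 (filterlim_locally (U := Cmod_space) _ _) H
              (mkposreal eps He)) as [d Hd].
  exists d. intros y s Hy Hs. apply (Hd (y, s)). split; assumption.
Qed.

Lemma joint_cont_curve (k : C -> R -> C) (x : C) (t : R) :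
  joint_cont k x t -> curve_cont (k x) t.
Proof.
  intros H. apply curve_cont_eps. intros eps He.
  destruct (joint_cont_eps k x t H eps He) as [d Hd].
  exists d. split; [apply cond_pos|]. intros s Hs. apply Hd; [|exact Hs].
  rewrite Cmod_minus_diag. apply cond_pos.
Qed.

(** The tube lemma over the compact interval [[a, b]]. *)
Lemma joint_cont_uniform (k : C -> R -> C) (x : C) (a b : R) :
  (forall t, a <= t <= b -> joint_cont k x t) ->
  forall eps, 0 < eps -> exists d, 0 < d /\
    forall y t, Cmod (y - x) < d -> a <= t <= b -> Cmod (k y t - k x t) < eps.
Proof.
  intros H eps He.
  set (P := fun t (d : posreal) => forall y s, Cmod (y - x) < d -> Rabs (s - t) < d ->
      Cmod (k y s - k x t) < eps / 2).
  set (delta := fun t => epsilon (inhabits (mkposreal 1 Rlt_0_1)) (P t)).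
  assert (Hdelta : forall t, a <= t <= b -> P t (delta t)).
  { intros t Ht. apply epsilon_spec. apply joint_cont_eps; [apply H, Ht|lra]. }
  destruct (compactness_value_1d a b delta) as [d Hd].
  exists d. split; [apply cond_pos|]. intros y t Hy Ht.
  destruct (NNPP _ (Hd t Ht)) as [s [Hs [Hts Hds]]].
  replace (k y t - k x t)%C with ((k y t - k x s) + - (k x t - k x s))%C by ring.
  eapply Rle_lt_trans; [apply Cmod_triangle|]. rewrite Cmod_opp.
  assert (K1 : Cmod (k y t - k x s) < eps / 2) by (apply (Hdelta s Hs); [lra|exact Hts]).
  assert (K2 : Cmod (k x t - k x s) < eps / 2).
  { apply (Hdelta s Hs); [|exact Hts].
    rewrite Cmod_minus_diag. apply cond_pos. }
  lra.
Qed.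

Lemma joint_cont_affine (f : C -> C) (p q g : R -> C) (x : C) (t : R) :
  curve_cont p t -> curve_cont q t -> curve_cont g t -> ccont f (x * p t + q t) ->
  joint_cont (fun y s => (f (y * p s + q s) * g s)%C) x t.
Proof.
  intros Hp Hq Hg Hf. unfold joint_cont.
  set (U := prod_UniformSpace (Cmod_space) R_UniformSpace).
  assert (S : forall h : R -> C, curve_cont h t ->
    continuous (T := U) (U := Cmod_space) (fun u => h (snd u)) (x, t)).
  { intros h Hh. apply (continuous_comp (U := U) (V := R_UniformSpace)
      (W := Cmod_space) (fun u => snd u) h); [|exact Hh].
    apply (continuous_snd (U := Cmod_space) (V := R_UniformSpace)). }
  apply (continuous_mult (U := U) (K := C_AbsRing)
    (fun u => f (fst u * p (snd u) + q (snd u))%C) (fun u => g (snd u))); [|now apply S].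
  apply (continuous_comp (U := U) (V := Cmod_space)
    (W := Cmod_space) (fun u => (fst u * p (snd u) + q (snd u))%C) f);
    [|exact Hf].
  apply (continuous_plus (U := U) (K := C_AbsRing) (V := AbsRing_NormedModule C_AbsRing)
    (fun u => (fst u * p (snd u))%C) (fun u => q (snd u))); [|now apply S].
  apply (continuous_mult (U := U) (K := C_AbsRing) (fun u => fst u) (fun u => p (snd u)));
    [|now apply S].
  apply (continuous_fst (U := Cmod_space) (V := R_UniformSpace)).
Qed.

(** The first order remainder of the integrand is bounded uniformly in [t] by the
    mean value inequality, because [dk] is uniformly close to [dk x]. *)
Lemma param_int_deriv (k dk : C -> R -> C) (x : C) (a b rad : R) :
  a <= b -> 0 < rad ->
  (forall y t, Cmod (y - x) < rad -> a <= t <= b ->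
     cderiv (fun w => k w t) y (dk y t) /\ curve_cont (k y) t) ->
  (forall t, a <= t <= b -> joint_cont dk x t) ->
  cderiv (fun y => CInt (k y) a b) x (CInt (dk x) a b).
Proof.
  intros Hab Hrad Hk Hdk. apply cderiv_eps. intros eps He.
  destruct (joint_cont_uniform dk x a b Hdk (eps / (b - a + 1))) as [d [Hd HD]].
  { apply Rdiv_lt_0_compat; lra. }
  exists (Rmin d rad). split; [now apply Rmin_pos|].
  intros y Hy.
  assert (Y1 := Rlt_le_trans _ _ _ Hy (Rmin_l _ _)).
  assert (Y2 := Rlt_le_trans _ _ _ Hy (Rmin_r _ _)).
  assert (X2 : Cmod (x - x) < rad).
  { rewrite Cmod_minus_diag. exact Hrad. }
  apply Rle_trans with ((b - a) * (eps / (b - a + 1) * Cmod (y - x))).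
  - apply (is_CInt_bound (fun t => (k y t - k x t - (y - x) * dk x t)%C)); [exact Hab| |].
    + intros t Ht.
      apply (complex_mean_value (fun w => k w t) (fun w => dk w t) x y (dk x t)).
      intros s Hs w.
      assert (W : Cmod (w - x) <= Cmod (y - x)).
      { apply segment_in_ball; [| |exact Hs]; [|apply Rle_refl].
        rewrite Cmod_minus_diag. apply Cmod_ge_0. }
      split; [apply Hk; [lra|exact Ht]|]. apply Rlt_le, HD; [lra|exact Ht].
    + apply (is_CInt_minus (fun t => (k y t - k x t)%C) (fun t => ((y - x) * dk x t)%C)).
      * apply is_CInt_minus; apply CInt_correct; try assumption; intros t Ht; now apply Hk.
      * apply is_CInt_scal, CInt_correct; [exact Hab|]. intros t Ht.
        now apply joint_cont_curve, Hdk.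
  - replace ((b - a) * (eps / (b - a + 1) * Cmod (y - x)))
      with ((b - a) / (b - a + 1) * (eps * Cmod (y - x))) by (field; lra).
    rewrite <- (Rmult_1_l (eps * Cmod (y - x))) at 2.
    apply Rmult_le_compat_r.
    { apply Rmult_le_pos; [lra|apply Cmod_ge_0]. }
    apply Rmult_le_reg_r with (b - a + 1); [lra|].
    unfold Rdiv. rewrite Rmult_assoc, Rinv_l; lra.
Qed.

Lemma param_int_cont (k : C -> R -> C) (x : C) (a b rad : R) :
  a <= b -> 0 < rad ->
  (forall y t, Cmod (y - x) < rad -> a <= t <= b -> joint_cont k y t) ->
  ccont (fun y => CInt (k y) a b) x.
Proof.
  intros Hab Hrad Hk. apply ccont_eps. intros eps He.
  assert (X2 : Cmod (x - x) < rad).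
  { rewrite Cmod_minus_diag. exact Hrad. }
  destruct (joint_cont_uniform k x a b (fun t => Hk x t X2) (eps / (b - a + 1)))
    as [d [Hd HD]]; [apply Rdiv_lt_0_compat; lra|].
  exists (Rmin d rad). split; [now apply Rmin_pos|].
  intros y Hy.
  assert (Y1 := Rlt_le_trans _ _ _ Hy (Rmin_l _ _)).
  assert (Y2 := Rlt_le_trans _ _ _ Hy (Rmin_r _ _)).
  apply Rle_lt_trans with ((b - a) * (eps / (b - a + 1))).
  - apply (is_CInt_bound (fun t => (k y t - k x t)%C)); [exact Hab| |].
    + intros t Ht. apply Rlt_le, HD; assumption.
    + apply is_CInt_minus; apply CInt_correct; try assumption;
        intros t Ht; now apply joint_cont_curve, Hk.
  - apply Rmult_lt_reg_r with (b - a + 1); [lra|].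
    replace ((b - a) * (eps / (b - a + 1)) * (b - a + 1)) with ((b - a) * eps) by (field; lra).
    nra.
Qed.

(** * Cauchy's formula for the derivative *)

Definition cis (t : R) : C := (cos t, sin t).

Lemma cis_deriv (t : R) : curve_deriv cis t (Ci * cis t)%C.
Proof.
  replace (Ci * cis t)%C with (- sin t, cos t)
    by (apply injective_projections; cbn; ring).
  assert (Hc : is_derive cos t (- sin t)) by (apply is_derive_Reals, derivable_pt_lim_cos).
  assert (Hs : is_derive sin t (cos t)) by (apply is_derive_Reals, derivable_pt_lim_sin).
  apply curve_deriv_eps. intros eps He.
  apply is_derive_Reals in Hc, Hs.
  destruct (Hc (eps / 2)) as [d1 H1]; [lra|]. destruct (Hs (eps / 2)) as [d2 H2]; [lra|].
  exists (Rmin d1 d2). split; [apply Rmin_pos; apply cond_pos|].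
  intros s Hst.
  destruct (Req_dec s t) as [->|N].
  { rewrite Rminus_diag, Rabs_R0, Rmult_0_r.
    replace (cis t - cis t - RtoC 0 * (- sin t, cos t)%R)%C with (RtoC 0) by ring.
    rewrite Cmod_0. lra. }
  assert (N' : s - t <> 0) by lra.
  assert (P : 0 < Rabs (s - t)) by now apply Rabs_pos_lt.
  specialize (H1 (s - t) N' (Rlt_le_trans _ _ _ Hst (Rmin_l _ _))).
  specialize (H2 (s - t) N' (Rlt_le_trans _ _ _ Hst (Rmin_r _ _))).
  replace (t + (s - t)) with s in H1, H2 by ring.
  assert (Q : forall u v, Rabs (u / (s - t) - v) < eps / 2 ->
                Rabs (u - (s - t) * v) <= eps / 2 * Rabs (s - t)).
  { intros u v Huv. replace (u - (s - t) * v) with ((u / (s - t) - v) * (s - t)) by (field; exact N').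
    rewrite Rabs_mult. apply Rmult_le_compat_r; lra. }
  apply Q in H1. apply Q in H2.
  eapply Rle_trans; [apply Cmod_le_sum|].
  replace (Re (cis s - cis t - RtoC (s - t) * (- sin t, cos t)%R))
    with (cos s - cos t - (s - t) * - sin t) by (cbn; ring).
  replace (Im (cis s - cis t - RtoC (s - t) * (- sin t, cos t)%R))
    with (sin s - sin t - (s - t) * cos t) by (cbn; ring).
  lra.
Qed.

Lemma cis_cont (t : R) : curve_cont cis t.
Proof. eapply curve_deriv_cont, cis_deriv. Qed.

Lemma Cmod_cis (t : R) : Cmod (cis t) = 1.
Proof.
  unfold Cmod, cis; cbn [fst snd]. replace (cos t ^ 2 + sin t ^ 2) with 1; [apply sqrt_1|].
  generalize (sin2_cos2 t). unfold Rsqr. lra.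
Qed.

Lemma cis_neq_0 (t : R) : cis t <> 0.
Proof. apply Cmod_gt_0. rewrite Cmod_cis. lra. Qed.

Lemma inv_cis_deriv (t : R) : curve_deriv (fun s => (/ cis s)%C) t (- Ci * / cis t)%C.
Proof.
  apply curve_deriv_eq with (- (1) / (cis t * cis t) * (Ci * cis t))%C.
  - apply (curve_deriv_comp Cinv cis); [|apply cis_deriv].
    apply (cderiv_inv (fun w => w)); [apply cis_neq_0|apply cderiv_id].
  - field. apply cis_neq_0.
Qed.

Lemma inv_cis_cont (t : R) : curve_cont (fun s => (/ cis s)%C) t.
Proof. eapply curve_deriv_cont, inv_cis_deriv. Qed.

Lemma circle_in_disk (z w : C) (t : R) : Cmod z + Cmod w < 1 -> disk (z + w * cis t).
Proof.
  intros H. red. eapply Rle_lt_trans; [apply Cmod_triangle|].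
  rewrite Cmod_mult, Cmod_cis. lra.
Qed.

Lemma two_PI_pos : 0 <= 2 * PI.
Proof. generalize PI_RGT_0. lra. Qed.

Lemma joint_cont_radius (f : C -> C) (g : R -> C) (z w : C) (s : R) :
  ccont f (w * cis s + z) -> curve_cont g s ->
  joint_cont (fun y s => (f (y * cis s + z) * g s)%C) w s.
Proof.
  intros Hf Hg. apply (joint_cont_affine f cis (fun _ => z) g); try assumption.
  - apply cis_cont.
  - apply curve_cont_const.
Qed.

Lemma joint_cont_centre (f : C -> C) (r : R) (w : C) (s : R) :
  ccont f (w * 1 + RtoC r * cis s) ->
  joint_cont (fun y s => (f (y * 1 + RtoC r * cis s) * / cis s)%C) w s.
Proof.
  intros Hf.
  apply (joint_cont_affine f (fun _ => RtoC 1) (fun s => (RtoC r * cis s)%C)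
    (fun s => (/ cis s)%C)); try assumption.
  - apply curve_cont_const.
  - apply curve_cont_mult; [apply curve_cont_const|apply cis_cont].
  - apply inv_cis_cont.
Qed.

Lemma circle_int_deriv (F f : C -> C) (z t : C) :
  (forall z, disk z -> cderiv F z (f z)) -> cont_on_disk f ->
  Cmod z + Cmod t < 1 ->
  cderiv (fun t => CInt (fun s => (F (t * cis s + z) * / cis s)%C) 0 (2 * PI)) t
    (CInt (fun s => (f (t * cis s + z) * 1)%C) 0 (2 * PI)).
Proof.
  intros HF Hf Ht.
  apply (param_int_deriv (fun t s => (F (t * cis s + z) * / cis s)%C)
    (fun t s => (f (t * cis s + z) * 1)%C) t 0 (2 * PI) (1 - Cmod z - Cmod t));
    [apply two_PI_pos|lra| |].
  - intros y s Hy _.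
    assert (D : disk (y * cis s + z)).
    { rewrite Cplus_comm. apply circle_in_disk.
      replace y with (t + (y - t))%C by ring. generalize (Cmod_triangle t (y - t)). lra. }
    split.
    + apply cderiv_eq with (/ cis s * (f (y * cis s + z) * (cis s * 1 + 0)))%C.
      * apply cderiv_ext with (fun w => (/ cis s * F (w * cis s + z))%C); [intros; ring|].
        apply cderiv_scal, (cderiv_comp F (fun w => (w * cis s + z)%C)); [now apply HF|].
        apply cderiv_plus; [|apply cderiv_const].
        apply cderiv_ext with (fun w => (cis s * w)%C); [intros; ring|].
        apply cderiv_scal, cderiv_id.
      * field. apply cis_neq_0.
    + apply joint_cont_curve with (k := fun y s => (F (y * cis s + z) * / cis s)%C).
      apply (joint_cont_radius F (fun s => (/ cis s)%C)); [|apply inv_cis_cont].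
      eapply cderiv_cont, HF, D.
  - intros s _. apply (joint_cont_radius f (fun _ => RtoC 1)); [|apply curve_cont_const].
    apply Hf. rewrite Cplus_comm. now apply circle_in_disk.
Qed.

(** The total derivative of [F(t e^is + z) e^-is] in [s] integrates to 0 over a
    period; it equals [i t f(t e^is + z) - i F(t e^is + z) e^-is]. *)
Lemma circle_int_homogeneous (F f : C -> C) (z t : C) :
  (forall z, disk z -> cderiv F z (f z)) -> cont_on_disk f ->
  Cmod z + Cmod t < 1 ->
  CInt (fun s => (F (t * cis s + z) * / cis s)%C) 0 (2 * PI)
  = (t * CInt (fun s => (f (t * cis s + z) * 1)%C) 0 (2 * PI))%C.
Proof.
  intros HF Hf Ht.
  assert (D : forall s, disk (t * cis s + z)) by (intros; rewrite Cplus_comm; now apply circle_in_disk).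
  set (G := CInt (fun s => (F (t * cis s + z) * / cis s)%C) 0 (2 * PI)).
  set (H := CInt (fun s => (f (t * cis s + z) * 1)%C) 0 (2 * PI)).
  assert (CF : forall s, curve_cont (fun s => (F (t * cis s + z) * / cis s)%C) s).
  { intros s. apply joint_cont_curve with (k := fun y s => (F (y * cis s + z) * / cis s)%C).
    apply (joint_cont_radius F (fun s => (/ cis s)%C)); [|apply inv_cis_cont].
    eapply cderiv_cont, HF, D. }
  assert (Cf : forall s, curve_cont (fun s => (f (t * cis s + z) * 1)%C) s).
  { intros s. apply joint_cont_curve with (k := fun y s => (f (y * cis s + z) * 1)%C).
    apply (joint_cont_radius f (fun _ => RtoC 1)); [|apply curve_cont_const].
    apply Hf, D. }
  assert (IG : is_CInt (fun s => (F (t * cis s + z) * / cis s)%C) 0 (2 * PI) G)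
    by (apply CInt_correct; [apply two_PI_pos|intros; apply CF]).
  assert (IH : is_CInt (fun s => (f (t * cis s + z) * 1)%C) 0 (2 * PI) H)
    by (apply CInt_correct; [apply two_PI_pos|intros; apply Cf]).
  set (h := fun s => (Ci * t * (f (t * cis s + z) * 1) - Ci * (F (t * cis s + z) * / cis s))%C).
  assert (I1 : is_CInt h 0 (2 * PI) (Ci * t * H - Ci * G)%C).
  { apply is_CInt_minus; now apply is_CInt_scal. }
  assert (I2 : is_CInt h 0 (2 * PI)
    (F (t * cis (2 * PI) + z) * / cis (2 * PI) - F (t * cis 0 + z) * / cis 0)%C).
  { apply (is_CInt_derive (fun s => (F (t * cis s + z) * / cis s)%C)); [apply two_PI_pos| |].
    - intros s _.
      apply curve_deriv_eq with
        (f (t * cis s + z) * (t * (Ci * cis s)) * / cis s + F (t * cis s + z) * (- Ci * / cis s))%C.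
      + apply (curve_deriv_mult (fun s => F (t * cis s + z)%C)); [|apply inv_cis_deriv].
        apply (curve_deriv_comp F (fun s => (t * cis s + z)%C)); [apply HF, D|].
        apply curve_deriv_eq with ((t * 1 + 0) * (Ci * cis s))%C; [|ring].
        apply (curve_deriv_comp (fun w => (t * w + z)%C) cis); [|apply cis_deriv].
        apply cderiv_plus; [apply cderiv_scal, cderiv_id|apply cderiv_const].
      + unfold h. field. apply cis_neq_0.
    - intros s _. unfold h.
      apply (curve_cont_plus (fun s => (Ci * t * (f (t * cis s + z) * 1))%C)
        (fun s => (- (Ci * (F (t * cis s + z) * / cis s)))%C)).
      + apply curve_cont_mult; [apply curve_cont_const|apply Cf].
      + apply (continuous_opp (U := R_UniformSpace) (K := C_AbsRing) (V := AbsRing_NormedModule C_AbsRing)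
          (fun s => (Ci * (F (t * cis s + z) * / cis s))%C)).
        apply (curve_cont_mult (fun _ => Ci) (fun s => (F (t * cis s + z) * / cis s)%C)); [apply curve_cont_const|apply CF]. }
  assert (E : (Ci * t * H - Ci * G)%C = 0).
  { rewrite <- (is_CInt_unique _ _ _ _ I1), (is_CInt_unique _ _ _ _ I2).
    replace (cis (2 * PI)) with (cis 0).
    - ring.
    - unfold cis. now rewrite cos_2PI, sin_2PI, cos_0, sin_0. }
  assert (NC : Ci <> 0) by (apply Cmod_gt_0; rewrite Cmod_Ci; lra).
  replace G with (t * H - (Ci * t * H - Ci * G) / Ci)%C by (field; exact NC).
  rewrite E. field. exact NC.
Qed.

(** Let [G(t)] be the left side for radius [t] and [H(t)] the integral of
    [f(t e^is + z)].  Then [G' = H] and [G = t H], so [G / t = H] has derivative 0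
    for [t > 0] and [H] keeps its value [2 pi f(z)] at [t = 0]. *)
Lemma cauchy_first_coefficient (F f : C -> C) (z : C) (r : R) :
  (forall z, disk z -> cderiv F z (f z)) -> cont_on_disk f ->
  0 < r -> Cmod z + r < 1 ->
  CInt (fun s => (F (RtoC r * cis s + z) * / cis s)%C) 0 (2 * PI)
  = (RtoC (2 * PI * r) * f z)%C.
Proof.
  intros HF Hf Hr Hz.
  set (G := fun t => CInt (fun s => (F (t * cis s + z) * / cis s)%C) 0 (2 * PI)).
  set (H := fun t => CInt (fun s => (f (t * cis s + z) * 1)%C) 0 (2 * PI)).
  assert (DH : forall t, 0 < t <= r -> cderiv H (RtoC t) 0).
  { intros t Ht.
    assert (Mt : Cmod t = t) by (rewrite Cmod_R; apply Rabs_pos_eq; lra).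
    assert (Nt : RtoC t <> 0) by (apply Cmod_gt_0; lra).
    apply (cderiv_ext_loc (fun w => G w * / w)%C H _ _ (Rmin t (1 - Cmod z - t))).
    - apply Rmin_pos; lra.
    - intros w Hw.
      assert (W1 := Rlt_le_trans _ _ _ Hw (Rmin_l _ _)).
      assert (W2 := Rlt_le_trans _ _ _ Hw (Rmin_r _ _)).
      assert (Nw : w <> 0).
      { intros ->. replace (0 - RtoC t)%C with (- RtoC t)%C in W1 by ring.
        rewrite Cmod_opp in W1. lra. }
      unfold G. rewrite (circle_int_homogeneous F f); try assumption.
      + fold (H w). field. exact Nw.
      + replace w with (RtoC t + (w - RtoC t))%C by ring.
        generalize (Cmod_triangle t (w - RtoC t)). lra.
    - apply cderiv_eq with (H (RtoC t) * / RtoC t + G (RtoC t) * (- (1) / (RtoC t * RtoC t)))%C.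
      + apply cderiv_mult; [apply circle_int_deriv; assumption || lra|].
        apply (cderiv_inv (fun w => w)); [exact Nt|apply cderiv_id].
      + unfold G. rewrite (circle_int_homogeneous F f) by (assumption || lra). fold (H (RtoC t)). field. exact Nt. }
  assert (EH : forall t, 0 < t <= r -> H (RtoC r) = H (RtoC t)).
  { intros t Ht.
    assert (K : Cmod (H (RtoC r) - H (RtoC t) - (RtoC r - RtoC t) * 0) <= 0 * Cmod (RtoC r - RtoC t)).
    { apply (complex_mean_value H (fun _ => RtoC 0)). intros s Hs w.
      assert (Ew : w = RtoC (t + s * (r - t))).
      { unfold w. now rewrite RtoC_plus, RtoC_mult, RtoC_minus. }
      split; [rewrite Ew; apply DH; nra|].
      rewrite Cmod_minus_diag. lra. }
    rewrite Rmult_0_l in K. apply Rle_antisym in K; [|apply Cmod_ge_0]. symmetry in K.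
    apply Cmod_eq_0 in K.
    replace (H (RtoC r)) with (H (RtoC t) + (H (RtoC r) - H (RtoC t) - (RtoC r - RtoC t) * 0))%C by ring.
    rewrite K. ring. }
  assert (CH : ccont H 0).
  { apply (param_int_cont (fun t s => (f (t * cis s + z) * 1)%C) 0 0 (2 * PI) r);
      [apply two_PI_pos|exact Hr|].
    intros y s Hy _. apply (joint_cont_radius f (fun _ => RtoC 1)); [|apply curve_cont_const].
    apply Hf. rewrite Cplus_comm. apply circle_in_disk.
    replace (y - 0)%C with y in Hy by ring. lra. }
  assert (H0 : H 0 = (RtoC (2 * PI) * f z)%C).
  { apply is_CInt_unique.
    replace (RtoC (2 * PI) * f z)%C with ((fun s => 0 + RtoC s * f z)%C (2 * PI)%R - (fun s => 0 + RtoC s * f z)%C 0%R)%C by ring.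
    apply (is_CInt_derive (fun s => 0 + RtoC s * f z)%C); [apply two_PI_pos| |].
    - intros s _. apply curve_deriv_eq with (f z); [apply curve_deriv_line|].
      replace (0 * cis s + z)%C with z by ring. ring.
    - intros s _. apply (continuous_ext (T := R_UniformSpace) (U := Cmod_space) (fun _ => f z)).
      + intros u. match goal with |- ?a = ?b => change (@eq C a b) end.
        replace (0 * cis u + z)%C with z by ring. ring.
      + apply curve_cont_const. }
  assert (Hlim : H (RtoC r) = H 0).
  { assert (K : Cmod (H (RtoC r) - H 0) = 0).
    { apply Rle_antisym; [|apply Cmod_ge_0]. apply le_epsilon. intros eps He.
      rewrite Rplus_0_l.
      destruct (proj1 (ccont_eps _ _) CH eps He) as [d [Hd HD]].
      set (t := Rmin r (d / 2)).
      assert (Ht : 0 < t) by (apply Rmin_pos; lra).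
      assert (T1 : t <= r) by apply Rmin_l. assert (T2 : t <= d / 2) by apply Rmin_r.
      rewrite (EH t) by lra. apply Rlt_le, HD.
      replace (RtoC t - 0)%C with (RtoC t) by ring. rewrite Cmod_R, Rabs_pos_eq; lra. }
    apply Cmod_eq_0 in K.
    replace (H (RtoC r)) with (H 0 + (H (RtoC r) - H 0))%C by ring. rewrite K. ring. }
  rewrite (circle_int_homogeneous F f); try assumption.
  - fold (H (RtoC r)). rewrite Hlim, H0, !RtoC_mult. ring.
  - rewrite Cmod_R, Rabs_pos_eq; lra.
Qed.


(** The contour integral of [f(w) / (w - z)^2] over the circle of radius [r] about
    [z], divided by [2 pi i].  The factor 1 after [z] fits the affine dependence on
    the parameter in [joint_cont_affine]. *)
Definition cauchy_deriv (f : C -> C) (r : R) (z : C) : C :=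
  (/ RtoC (2 * PI * r) * CInt (fun s => (f (z * 1 + RtoC r * cis s) * / cis s)%C) 0 (2 * PI))%C.

Lemma shifted_ball (z w : C) (r : R) :
  Cmod (w - z) < (1 - Cmod z - r) -> Cmod w + r < 1.
Proof.
  intros H. replace w with (z + (w - z))%C by ring. generalize (Cmod_triangle z (w - z)). lra.
Qed.

(** Near [z] the previous formula represents [f] as an integral of [F] with a fixed
    radius, which can be differentiated under the integral sign. *)
Lemma derivative_of_primitive (F f : C -> C) (z : C) (r : R) :
  (forall z, disk z -> cderiv F z (f z)) -> cont_on_disk f ->
  0 < r -> Cmod z + r < 1 -> cderiv f z (cauchy_deriv f r z).
Proof.
  intros HF Hf Hr Hz.
  assert (Pr : 0 < 2 * PI * r) by (generalize PI_RGT_0; nra).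
  assert (Nr : RtoC (2 * PI * r) <> 0).
  { intros E. apply RtoC_inj in E. lra. }
  assert (Mr : Cmod r = r) by (rewrite Cmod_R; apply Rabs_pos_eq; lra).
  apply (cderiv_ext_loc (fun w => / RtoC (2 * PI * r) *
     CInt (fun s => (F (w * 1 + RtoC r * cis s) * / cis s)%C) 0 (2 * PI))%C _ _ _ (1 - Cmod z - r)); [lra| |].
  - intros w Hw. apply shifted_ball in Hw.
    replace (f w) with (/ RtoC (2 * PI * r) * (RtoC (2 * PI * r) * f w))%C by (field; exact Nr).
    f_equal.
    rewrite <- (cauchy_first_coefficient F f w r HF Hf Hr Hw).
    apply (RInt_ext (V := C_R_CompleteNormedModule)). intros s _.
    replace (w * 1 + RtoC r * cis s)%C with (RtoC r * cis s + w)%C by ring. reflexivity.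
  - apply cderiv_scal.
    apply (param_int_deriv (fun w s => (F (w * 1 + RtoC r * cis s) * / cis s)%C)
      (fun w s => (f (w * 1 + RtoC r * cis s) * / cis s)%C) z 0 (2 * PI) (1 - Cmod z - r));
      [apply two_PI_pos|lra| |].
    + intros w s Hw _. apply shifted_ball in Hw.
      assert (D : disk (w * 1 + RtoC r * cis s)) by (rewrite Cmult_1_r; apply circle_in_disk; lra).
      split.
      * apply cderiv_ext with (fun w => (/ cis s * F (w * 1 + RtoC r * cis s))%C); [intros; ring|].
        apply cderiv_eq with (/ cis s * (f (w * 1 + RtoC r * cis s) * (1 + 0)))%C; [|ring].
        apply cderiv_scal, (cderiv_comp F (fun w => (w * 1 + RtoC r * cis s)%C)); [apply HF, D|].
        apply cderiv_plus; [|apply cderiv_const].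
        apply cderiv_ext with (fun w => w); [intros; ring|apply cderiv_id].
      * apply joint_cont_curve with (k := fun y s => (F (y * 1 + RtoC r * cis s) * / cis s)%C).
        apply (joint_cont_centre F).
        eapply cderiv_cont, HF, D.
    + intros s _.
      apply (joint_cont_centre f).
      apply Hf. rewrite Cmult_1_r. apply circle_in_disk. lra.
Qed.

Lemma cauchy_deriv_cont (f : C -> C) (z : C) (r : R) :
  cont_on_disk f -> 0 < r -> Cmod z + r < 1 -> ccont (cauchy_deriv f r) z.
Proof.
  intros Hf Hr Hz.
  assert (Mr : Cmod r = r) by (rewrite Cmod_R; apply Rabs_pos_eq; lra).
  apply (ccont_mult (fun _ => (/ RtoC (2 * PI * r))%C)
    (fun w => CInt (fun s => (f (w * 1 + RtoC r * cis s) * / cis s)%C) 0 (2 * PI))); [apply ccont_const|].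
  apply (param_int_cont (fun w s => (f (w * 1 + RtoC r * cis s) * / cis s)%C) z 0 (2 * PI) (1 - Cmod z - r));
    [apply two_PI_pos|lra|].
  intros w s Hw _. apply shifted_ball in Hw.
  apply (joint_cont_centre f).
  apply Hf. rewrite Cmult_1_r. apply circle_in_disk. lra.
Qed.

Lemma holomorphic_cauchy (f : C -> C) (z : C) (r : R) :
  holomorphic f -> 0 < r -> Cmod z + r < 1 -> C_derive f z = cauchy_deriv f r z.
Proof.
  intros H Hr Hz. apply cderiv_unique, (derivative_of_primitive (primitive0 f)).
  - intros w Hw. now apply primitive0_deriv.
  - now apply holomorphic_cont.
  - exact Hr.
  - exact Hz.
Qed.

(** Apply [derivative_of_primitive] once to the primitive of [f], to see that [f'] is
    continuous, and then to [f] itself as a primitive of [f']. *)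
Theorem holomorphic_derive (f : C -> C) : holomorphic f -> holomorphic (C_derive f).
Proof.
  intros H z Hz.
  exists (cauchy_deriv (C_derive f) ((1 - Cmod z) / 2) z).
  red in Hz.
  apply (derivative_of_primitive f); [| |lra|lra].
  - intros w Hw. now apply holomorphic_cderiv.
  - intros w Hw. red in Hw. set (r := (1 - Cmod w) / 2).
    apply (continuous_ext_loc (T := Cmod_space)
      (U := Cmod_space) _ (cauchy_deriv f r)).
    + assert (P : 0 < 1 - Cmod w - r) by (unfold r; lra).
      exists (mkposreal _ P). intros y Hy. symmetry. apply holomorphic_cauchy.
      * exact H.
      * unfold r; lra.
      * now apply (shifted_ball w).
    + apply cauchy_deriv_cont; [now apply holomorphic_cont| |]; unfold r; lra.
Qed.

Theorem cauchy_estimate (f : C -> C) (z : C) (r M : R) :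
  holomorphic f -> 0 < r -> Cmod z + r < 1 ->
  (forall w, Cmod (w - z) = r -> Cmod (f w) <= M) -> Cmod (C_derive f z) <= M / r.
Proof.
  intros H Hr Hz HM.
  assert (Mr : Cmod r = r) by (rewrite Cmod_R; apply Rabs_pos_eq; lra).
  assert (PP := PI_RGT_0).
  assert (Pr : 0 < 2 * PI * r) by nra.
  assert (Nr : RtoC (2 * PI * r) <> 0) by (intros E; apply RtoC_inj in E; lra).
  rewrite (holomorphic_cauchy f z r) by assumption.
  unfold cauchy_deriv. rewrite Cmod_mult, Cmod_inv, Cmod_R, Rabs_pos_eq by (assumption || lra).
  apply Rle_trans with (/ (2 * PI * r) * ((2 * PI - 0) * M)).
  - apply Rmult_le_compat_l; [apply Rlt_le, Rinv_0_lt_compat, Pr|].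
    apply (is_CInt_bound (fun s => (f (z * 1 + RtoC r * cis s) * / cis s)%C)); [lra| |].
    + intros s _. rewrite Cmod_mult, Cmod_inv, Cmod_cis by apply cis_neq_0.
      rewrite Rinv_1, Rmult_1_r. apply HM.
      replace (z * 1 + RtoC r * cis s - z)%C with (RtoC r * cis s)%C by ring.
      rewrite Cmod_mult, Cmod_cis. lra.
    + apply CInt_correct; [lra|]. intros s _.
      apply joint_cont_curve with (k := fun y s => (f (y * 1 + RtoC r * cis s) * / cis s)%C).
      apply (joint_cont_centre f).
      apply (holomorphic_cont f H). rewrite Cmult_1_r. apply circle_in_disk. lra.
  - right. field. lra.
Qed.

(** * The principal power *)

Lemma Cexp_plus (z w : C) : Cexp (z + w) = (Cexp z * Cexp w)%C.
Proof.
  unfold Cexp. destruct z as [a b], w as [c d]. cbn.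
  rewrite exp_plus, cos_plus, sin_plus. apply injective_projections; cbn; ring.
Qed.

Lemma Cexp_0 : Cexp 0 = 1.
Proof.
  unfold Cexp. cbn. rewrite exp_0, cos_0, sin_0. apply injective_projections; cbn; ring.
Qed.

Lemma Cmod_Cexp (z : C) : Cmod (Cexp z) = exp (Re z).
Proof.
  replace (Cexp z) with (RtoC (exp (Re z)) * cis (Im z))%C
    by (apply injective_projections; cbn; ring).
  rewrite Cmod_mult, Cmod_cis, Cmod_R, Rabs_pos_eq; [ring|]. apply Rlt_le, exp_pos.
Qed.

Lemma Cexp_neq_0 (z : C) : Cexp z <> 0.
Proof. apply Cmod_gt_0. rewrite Cmod_Cexp. apply exp_pos. Qed.

Lemma Cexp_deriv_0 : cderiv Cexp 0 1.
Proof.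
  apply cderiv_eps. intros eps He.
  set (e := Rmin (eps / 4) 1).
  assert (Pe : 0 < e) by (apply Rmin_pos; lra).
  assert (e1 : e <= eps / 4) by apply Rmin_l. assert (e2 : e <= 1) by apply Rmin_r.
  destruct (proj1 (curve_deriv_eps _ _ _) (cis_deriv 0) e Pe) as [d1 [Hd1 H1]].
  destruct (derivable_pt_lim_exp_0 e Pe) as [d2 H2].
  exists (Rmin e (Rmin d1 d2)). split.
  { apply Rmin_pos; [exact Pe|]. apply Rmin_pos; [exact Hd1|apply cond_pos]. }
  intros w Hw. replace (w - 0)%C with w in * by ring.
  assert (W1 := Rlt_le_trans _ _ _ Hw (Rmin_l _ _)).
  assert (W := Rlt_le_trans _ _ _ Hw (Rmin_r _ _)).
  assert (W2 := Rlt_le_trans _ _ _ W (Rmin_l _ _)).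
  assert (W3 := Rlt_le_trans _ _ _ W (Rmin_r _ _)). clear W.
  assert (Mx := re_le_Cmod w). assert (My := Im_le_Cmod w).
  set (x := Re w) in *. set (y := Im w) in *.
  assert (Ex : Rabs (exp x - 1 - x) <= e * Rabs x).
  { destruct (Req_dec x 0) as [->|N].
    - rewrite exp_0. replace (1 - 1 - 0) with 0 by ring. rewrite Rabs_R0. lra.
    - specialize (H2 x N ltac:(lra)). rewrite Rplus_0_l, exp_0 in H2.
      replace (exp x - 1 - x) with (((exp x - 1) / x - 1) * x) by (field; exact N).
      rewrite Rabs_mult. apply Rmult_le_compat_r; [apply Rabs_pos|lra]. }
  assert (Ey : Cmod (cis y - 1 - RtoC y * Ci) <= e * Rabs y).
  { specialize (H1 y). rewrite Rminus_0_r in H1. specialize (H1 ltac:(lra)).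
    replace (cis 0) with (RtoC 1) in H1
      by (unfold cis; now rewrite cos_0, sin_0).
    rewrite Cmult_1_r in H1. exact H1. }
  rewrite Cexp_0.
  assert (Ew : w = (RtoC x + RtoC y * Ci)%C).
  { unfold x, y. destruct w. apply injective_projections; cbn; ring. }
  (* With [w = x + i y]: separate the remainders of [e^x] and of [e^(i y)]; the
     mixed term is [i x y]. *)
  replace (Cexp w - 1 - w * 1)%C with
    (RtoC (exp x - 1 - x) * cis y + RtoC (1 + x) * (cis y - 1 - RtoC y * Ci)
      + RtoC x * RtoC y * Ci)%C.
  2: { replace (Cexp w) with (RtoC (exp x) * cis y)%C
         by (unfold x, y; apply injective_projections; cbn; ring).
       rewrite Ew, !RtoC_minus, RtoC_plus. ring. }
  eapply Rle_trans; [apply Cmod_triangle|].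
  eapply Rle_trans; [apply Rplus_le_compat_r, Cmod_triangle|].
  rewrite !Cmod_mult, Cmod_cis, Cmod_Ci, !Cmod_R.
  assert (B1 : Rabs (1 + x) <= 2).
  { eapply Rle_trans; [apply Rabs_triang|]. rewrite Rabs_R1. lra. }
  assert (P1 := Rabs_pos x). assert (P2 := Rabs_pos y). assert (P3 := Rabs_pos (1 + x)).
  assert (P4 := Cmod_ge_0 (cis y - 1 - RtoC y * Ci)).
  assert (P5 := Cmod_ge_0 w).
  assert (Rabs (1 + x) * Cmod (cis y - 1 - RtoC y * Ci) <= 2 * (e * Rabs y))
    by (apply Rmult_le_compat; assumption).
  nra.
Qed.

Lemma Cexp_deriv (z : C) : cderiv Cexp z (Cexp z).
Proof.
  apply cderiv_ext with (fun w => (Cexp z * Cexp (w - z))%C).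
  { intros w. rewrite <- Cexp_plus. f_equal. ring. }
  apply cderiv_eq with (Cexp z * (1 * (1 - 0)))%C; [|ring].
  apply cderiv_scal, (cderiv_comp Cexp (fun w => (w - z)%C)).
  - replace (z - z)%C with (RtoC 0) by ring. apply Cexp_deriv_0.
  - apply cderiv_minus; [apply cderiv_id|apply cderiv_const].
Qed.

Definition Clog (z : C) : C := (ln (Cmod z), atan (Im z / Re z)).

Lemma Cmod_pos_of_Re (z : C) : 0 < Re z -> 0 < Cmod z.
Proof.
  intros H. eapply Rlt_le_trans; [|apply re_le_Cmod]. rewrite Rabs_pos_eq; lra.
Qed.

Lemma Cexp_Clog (z : C) : 0 < Re z -> Cexp (Clog z) = z.
Proof.
  intros H. assert (P := Cmod_pos_of_Re z H). unfold Cexp, Clog. cbn [Re Im fst snd].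
  fold (Re z) (Im z).
  rewrite exp_ln by exact P.
  assert (E : sqrt (1 + (Im z / Re z)²) = Cmod z / Re z).
  { replace (1 + (Im z / Re z)²) with ((Cmod z / Re z)²).
    - apply sqrt_Rsqr. apply Rlt_le, Rdiv_lt_0_compat; assumption.
    - unfold Rsqr. replace (Cmod z / Re z * (Cmod z / Re z)) with (Cmod z ^ 2 / (Re z * Re z)) by (field; lra).
      rewrite Cmod2_alt. field. lra. }
  rewrite cos_atan, sin_atan, E. destruct z as [x y]. cbn in H.
  apply injective_projections; cbn [Re Im fst snd] in *; field; lra.
Qed.

Lemma ccont_RtoC (h : C -> R) (z : C) :
  continuous (T := Cmod_space) h z -> ccont (fun w => RtoC (h w)) z.
Proof.
  intros H. apply ccont_eps. intros eps He.
  destruct (proj1 (filterlim_locally _ _) H (mkposreal eps He)) as [d Hd].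
  exists d; split; [apply cond_pos|]. intros w Hw.
  rewrite <- RtoC_minus, Cmod_R. exact (Hd w Hw).
Qed.

Lemma contracting_cont (h : C -> R) (z : C) :
  (forall x y, Rabs (h x - h y) <= Cmod (x - y)) ->
  continuous (T := Cmod_space) h z.
Proof.
  intros Hh. apply filterlim_locally. intros eps. exists eps. intros y Hy.
  eapply Rle_lt_trans; [apply Hh|exact Hy].
Qed.

Lemma Clog_cont (z : C) : 0 < Re z -> ccont Clog z.
Proof.
  intros H.
  assert (C1 : continuous (T := Cmod_space) Re z).
  { apply contracting_cont. intros x y. rewrite <- Re_minus. apply re_le_Cmod. }
  assert (C2 : continuous (T := Cmod_space) Im z).
  { apply contracting_cont. intros x y. rewrite <- Im_minus. apply Im_le_Cmod. }
  assert (C3 : continuous (T := Cmod_space) Cmod z).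
  { apply contracting_cont, Cmod_diff_le. }
  apply (continuous_ext (T := Cmod_space)
    (U := Cmod_space)
    (fun w => RtoC (ln (Cmod w)) + Ci * RtoC (atan (Im w / Re w)))%C).
  { intros w. apply injective_projections; cbn; ring. }
  apply ccont_plus; [|apply ccont_mult; [apply ccont_const|]]; apply ccont_RtoC.
  - apply (continuous_comp (U := Cmod_space) Cmod ln); [exact C3|].
    now apply continuous_ln, Cmod_pos_of_Re.
  - apply (continuous_comp (U := Cmod_space) (fun w => Im w / Re w) atan);
      [|apply continuous_atan].
    apply (continuous_mult (U := Cmod_space) (K := R_AbsRing) Im (fun w => / Re w));
      [exact C2|].
    apply (continuous_comp (U := Cmod_space) Re Rinv); [exact C1|].
    apply continuous_Rinv. lra.
Qed.

(** The derivative of an inverse function: invert the difference quotient of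
    [Cexp] along [Clog]. *)
Lemma Clog_deriv (z : C) : 0 < Re z -> cderiv Clog z (/ z)%C.
Proof.
  intros H. assert (P := Cmod_pos_of_Re z H).
  assert (Nz : z <> 0) by now apply Cmod_gt_0.
  destruct (proj1 (cderiv_slope _ _ _) (Cexp_deriv (Clog z))) as [q [Hq [Eq Hf]]].
  rewrite Cexp_Clog in Eq by exact H.
  assert (Cq : ccont (fun w => q (Clog w)) z) by (apply ccont_comp; [now apply Clog_cont|exact Hq]).
  destruct (proj1 (ccont_eps _ _) Cq (Cmod z) P) as [d [Hd HD]].
  apply (slope_cderiv _ (fun w => / q (Clog w))%C _ _ (Rmin d (Re z))).
  - now apply Rmin_pos.
  - apply (ccont_comp (fun w => q (Clog w)) Cinv); [exact Cq|].
    apply ccont_inv. now rewrite Eq.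
  - now rewrite Eq.
  - intros w Hw.
    assert (W1 := Rlt_le_trans _ _ _ Hw (Rmin_l _ _)).
    assert (W2 := Rlt_le_trans _ _ _ Hw (Rmin_r _ _)).
    assert (Rw : 0 < Re w).
    { assert (T := re_le_Cmod (w - z)). rewrite Re_minus in T.
      apply Rabs_le_between in T. lra. }
    assert (Nq : q (Clog w) <> 0).
    { intros E. specialize (HD w W1). rewrite E, Eq in HD.
      replace (0 - z)%C with (- z)%C in HD by ring. rewrite Cmod_opp in HD. lra. }
    specialize (Hf (Clog w)). rewrite !Cexp_Clog in Hf by assumption.
    rewrite Hf. field. exact Nq.
Qed.

Lemma Cpower_Clog (z : C) (s : R) : Cpower z s = Cexp (RtoC s * Clog z).
Proof.
  unfold Cpower, Clog. f_equal. apply injective_projections; cbn; ring.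
Qed.

Lemma Cpower_deriv (z : C) (s : R) : 0 < Re z ->
  cderiv (fun w => Cpower w s) z (RtoC s * Cpower z s / z)%C.
Proof.
  intros H. apply cderiv_ext with (fun w => Cexp (RtoC s * Clog w)).
  { intros w. now rewrite Cpower_Clog. }
  rewrite Cpower_Clog.
  apply cderiv_eq with (Cexp (RtoC s * Clog z) * (RtoC s * / z))%C.
  - apply (cderiv_comp Cexp (fun w => (RtoC s * Clog w)%C)); [apply Cexp_deriv|].
    now apply cderiv_scal, Clog_deriv.
  - unfold Cdiv. ring.
Qed.

Lemma Cpower_neq_0 (z : C) (s : R) : Cpower z s <> 0.
Proof. apply Cexp_neq_0. Qed.

Lemma Cmod_Cpower (z : C) (s : R) : Cmod (Cpower z s) = Rpower (Cmod z) s.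
Proof. unfold Cpower. now rewrite Cmod_Cexp. Qed.

Lemma Cpower_R (x s : R) : 0 < x -> Cpower (RtoC x) s = RtoC (Rpower x s).
Proof.
  intros Hx. unfold Cpower, Cexp, Rpower. rewrite Cmod_R, Rabs_pos_eq by lra.
  cbn. replace (0 / x) with 0 by (field; lra). rewrite atan_0, Rmult_0_r, cos_0, sin_0.
  apply injective_projections; cbn; ring.
Qed.

Lemma Cpower_plus (z : C) (s t : R) : Cpower z (s + t) = (Cpower z s * Cpower z t)%C.
Proof. rewrite !Cpower_Clog, <- Cexp_plus, RtoC_plus. f_equal. ring. Qed.

Lemma Cpower_1 (z : C) : 0 < Re z -> Cpower z 1 = z.
Proof. intros H. rewrite Cpower_Clog, Cmult_1_l. now apply Cexp_Clog. Qed.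

Lemma Re_one_minus (w : C) : disk w -> 0 < Re (1 - w).
Proof.
  unfold disk. intros H. assert (T := re_le_Cmod w). apply Rabs_le_between in T.
  rewrite Re_minus. cbn [Re fst RtoC]. unfold Re in *. cbn. lra.
Qed.

Lemma Cpower_one_minus_deriv (w : C) (s : R) : disk w ->
  cderiv (fun x => Cpower (1 - x) s) w (- (RtoC s * Cpower (1 - w) s / (1 - w)))%C.
Proof.
  intros H.
  apply cderiv_eq with (RtoC s * Cpower (1 - w) s / (1 - w) * (0 - 1))%C; [|ring].
  apply (cderiv_comp (fun x => Cpower x s) (fun x => (1 - x)%C)).
  - now apply Cpower_deriv, Re_one_minus.
  - apply cderiv_minus; [apply cderiv_const|apply cderiv_id].
Qed.

(** * The binomial series *)

(** The coefficient of [w^k] in [(1 - w)^(-b)]. *)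
Fixpoint binom_coef (b : R) (k : nat) : R :=
  match k with
  | O => 1
  | S j => binom_coef b j * (b + INR j) / INR (S j)
  end.

Lemma binom_coef_pos (b : R) (k : nat) : 0 < b -> 0 < binom_coef b k.
Proof.
  intros Hb. induction k as [|k IH]; [cbn; lra|].
  cbn [binom_coef]. apply Rdiv_lt_0_compat; [|apply lt_0_INR; lia].
  apply Rmult_lt_0_compat; [exact IH|]. generalize (pos_INR k). lra.
Qed.

(** Both sides are [b (b + 1) ... (b + k) / k!].  This identifies the defect term
    [(N + 1) c_(N+1)] of a truncated series as a coefficient for [b + 1]. *)
Lemma binom_coef_shift (b : R) (k : nat) : 0 < b ->
  binom_coef b k * (b + INR k) = b * binom_coef (b + 1) k.
Proof.
  intros Hb. induction k as [|k IH]; [cbn; ring|].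
  assert (P : 0 < INR (S k)) by (apply lt_0_INR; lia).
  cbn [binom_coef]. rewrite IH.
  replace (b * binom_coef (b + 1) k / INR (S k) * (b + INR (S k)))
    with (b * (binom_coef (b + 1) k * (b + INR (S k)) / INR (S k))) by (field; lra).
  rewrite S_INR. do 2 f_equal. ring.
Qed.

(** The quotient of the two coefficients grows by the factor [1 + s / (p + k)],
    which is at most [exp (s / k)], while [k^s] grows at least by
    [exp (s / (k + 1))].  The excess telescopes to at most [exp s]. *)
Lemma binom_coef_growth (p s : R) (k : nat) : 0 < p -> 0 < s ->
  binom_coef (p + s) (S k) <=
  (1 + s / p) * exp s * Rpower (INR (S k)) s * binom_coef p (S k).
Proof.
  intros Hp Hs.
  enough (Main : forall k, binom_coef (p + s) (S k) <=
    (1 + s / p) * exp (s * (1 - / INR (S k))) * Rpower (INR (S k)) s * binom_coef p (S k)).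
  { eapply Rle_trans; [apply Main|].
    assert (P := binom_coef_pos p (S k) Hp).
    assert (0 < / INR (S k)) by (apply Rinv_0_lt_compat, lt_0_INR; lia).
    assert (0 < s / p) by (apply Rdiv_lt_0_compat; assumption).
    apply Rmult_le_compat_r; [lra|]. apply Rmult_le_compat_r; [apply Rlt_le, exp_pos|].
    apply Rmult_le_compat_l; [lra|].
    destruct (Req_dec (s * (1 - / INR (S k))) s) as [->|N]; [lra|].
    apply Rlt_le, exp_increasing. nra. }
  clear k. intros k. induction k as [|k IH].
  - cbn [binom_coef INR]. unfold Rpower. rewrite ln_1, Rmult_0_r, exp_0.
    replace (s * (1 - / 1)) with 0 by field. rewrite exp_0. right. field. lra.
  - set (j := INR (S k)). assert (Pj : 0 < j) by (apply lt_0_INR; lia).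
    assert (Ej : INR (S (S k)) = j + 1) by apply S_INR.
    change (binom_coef (p + s) (S (S k))) with
      (binom_coef (p + s) (S k) * (p + s + j) / INR (S (S k))).
    change (binom_coef p (S (S k))) with (binom_coef p (S k) * (p + j) / INR (S (S k))).
    rewrite Ej.
    assert (P := binom_coef_pos p (S k) Hp).
    assert (Psp : 0 < s / p) by (apply Rdiv_lt_0_compat; assumption).
    assert (K : (p + s + j) * (exp (s * (1 - / j)) * Rpower j s)
      <= exp (s * (1 - / (j + 1))) * Rpower (j + 1) s * (p + j)).
    { assert (K1 : p + s + j <= (p + j) * exp (s / j)).
      { apply Rle_trans with ((p + j) * (1 + s / j)).
        - assert (s <= (p + j) * (s / j)).
          { replace ((p + j) * (s / j)) with (s + p * s / j) by (field; lra).
            assert (0 < p * s / j) by (apply Rdiv_lt_0_compat; nra). lra. }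
          lra.
        - apply Rmult_le_compat_l; [lra|]. apply exp_ineq1_le. }
      assert (K2 : / (j + 1) <= ln (j + 1) - ln j).
      { assert (E := exp_ineq1_le (- (ln (j + 1) - ln j))).
        replace (- (ln (j + 1) - ln j)) with (ln j + - ln (j + 1)) in E at 2 by ring.
        rewrite exp_plus, exp_Ropp, !exp_ln in E by lra.
        replace (/ (j + 1)) with (1 - j * / (j + 1)) by (field; lra). lra. }
      apply Rle_trans with ((p + j) * exp (s / j) * (exp (s * (1 - / j)) * Rpower j s)).
      { apply Rmult_le_compat_r; [|exact K1].
        apply Rlt_le, Rmult_lt_0_compat; apply exp_pos. }
      rewrite (Rmult_comm _ (p + j)), !Rmult_assoc.
      apply Rmult_le_compat_l; [lra|].
      unfold Rpower. rewrite <- !exp_plus.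
      replace (s / j + (s * (1 - / j) + s * ln j)) with (s + s * ln j) by (field; lra).
      apply Rle_trans with (exp (s * (1 - / (j + 1)) + s * ln (j + 1))); [|lra].
      destruct (Rle_lt_or_eq_dec (s + s * ln j) (s * (1 - / (j + 1)) + s * ln (j + 1))) as [L| ->].
      - nra.
      - apply Rlt_le, exp_increasing, L.
      - lra. }
    fold j in IH.
    replace ((1 + s / p) * exp (s * (1 - / (j + 1))) * Rpower (j + 1) s
              * (binom_coef p (S k) * (p + j) / (j + 1)))
      with ((1 + s / p) * binom_coef p (S k) *
              (exp (s * (1 - / (j + 1))) * Rpower (j + 1) s * (p + j)) / (j + 1))
      by (field; lra).
    unfold Rdiv at 1 3. apply Rmult_le_compat_r; [apply Rlt_le, Rinv_0_lt_compat; lra|].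
    eapply Rle_trans; [apply Rmult_le_compat_r; [lra|apply IH]|].
    apply Rle_trans with ((1 + s / p) * binom_coef p (S k) *
      ((p + s + j) * (exp (s * (1 - / j)) * Rpower j s))); [right; ring|].
    apply Rmult_le_compat_l; [nra|exact K].
Qed.

Fixpoint binom_sum (b : R) (N : nat) (w : C) : C :=
  match N with
  | O => 1
  | S n => binom_sum b n w + RtoC (binom_coef b (S n)) * w ^ S n
  end%C.

Lemma cderiv_pow (n : nat) (w : C) :
  cderiv (fun x => (x ^ S n)%C) w (RtoC (INR (S n)) * w ^ n)%C.
Proof.
  induction n as [|n IH].
  - apply cderiv_ext with (fun x => x); [intros; cbn; ring|].
    apply cderiv_eq with (RtoC 1); [apply cderiv_id|cbn; ring].
  - apply cderiv_ext with (fun x => (x * x ^ S n)%C); [intros; cbn; ring|].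
    apply cderiv_eq with (1 * w ^ S n + w * (RtoC (INR (S n)) * w ^ n))%C.
    + apply (cderiv_mult (fun x => x)); [apply cderiv_id|exact IH].
    + rewrite (S_INR (S n)), RtoC_plus. rewrite (Cpow_S w n). ring.
Qed.

(** [(1 - w)^-b] solves [(1 - w) S' = b S]; in a partial sum all terms cancel but
    the last. *)
Lemma binom_sum_deriv (b : R) (N : nat) (w : C) : exists d,
  cderiv (binom_sum b N) w d /\
  ((1 - w) * d - RtoC b * binom_sum b N w = - (RtoC (binom_coef b N * (b + INR N)) * w ^ N))%C.
Proof.
  induction N as [|N [d [Hd E]]].
  - exists (RtoC 0). split; [apply cderiv_const|]. cbn.
    rewrite Rmult_1_l, Rplus_0_r. ring.
  - exists (d + RtoC (binom_coef b (S N)) * (RtoC (INR (S N)) * w ^ N))%C. split.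
    + apply (cderiv_plus (binom_sum b N)); [exact Hd|]. apply cderiv_scal, cderiv_pow.
    + assert (Ec : (RtoC (binom_coef b N * (b + INR N)) = RtoC (binom_coef b (S N)) * RtoC (INR (S N)))%C).
      { rewrite <- RtoC_mult. f_equal. cbn [binom_coef]. field. apply not_0_INR. lia. }
      rewrite Ec in E. change (binom_sum b (S N) w) with
        (binom_sum b N w + RtoC (binom_coef b (S N)) * w ^ S N)%C.
      rewrite RtoC_mult, RtoC_plus, Cpow_S.
      transitivity ((1 - w) * d - RtoC b * binom_sum b N w
        + (1 - w) * (RtoC (binom_coef b (S N)) * (RtoC (INR (S N)) * w ^ N))
        - RtoC b * (RtoC (binom_coef b (S N)) * (w * w ^ N)))%C; [ring|].
      rewrite E. ring.
Qed.

Lemma one_minus_neq_0 (w : C) : disk w -> (1 - w <> 0)%C.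
Proof.
  intros H E. assert (R0 := Re_one_minus w H). rewrite E in R0. cbn in R0. lra.
Qed.

(** The quotient of the partial sum by its limit is nearly constant. *)
Lemma binom_quotient_deriv (b : R) (N : nat) (w : C) : 0 < b -> disk w ->
  cderiv (fun x => (binom_sum b N x * Cpower (1 - x) b)%C) w
    (- (RtoC (b * binom_coef (b + 1) N) * w ^ N * (Cpower (1 - w) b / (1 - w))))%C.
Proof.
  intros Hb Hw. destruct (binom_sum_deriv b N w) as [d [Hd E]].
  rewrite binom_coef_shift in E by exact Hb.
  eapply cderiv_eq.
  - apply (cderiv_mult (binom_sum b N) (fun x => Cpower (1 - x) b)); [exact Hd|].
    now apply Cpower_one_minus_deriv.
  - assert (N1 := one_minus_neq_0 w Hw).
    transitivity (((1 - w) * d - RtoC b * binom_sum b N w) * (Cpower (1 - w) b / (1 - w)))%C;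
      [field; exact N1|].
    rewrite E. ring.
Qed.

Lemma binom_sum_0 (b : R) (N : nat) : binom_sum b N 0 = 1.
Proof.
  induction N as [|N IH]; [reflexivity|]. cbn [binom_sum]. rewrite IH, Cpow_S. ring.
Qed.

Lemma Cpower_at_1 (b : R) : Cpower (1 - 0) b = 1.
Proof.
  replace (1 - 0)%C with (RtoC 1) by ring. rewrite Cpower_R by lra.
  unfold Rpower. now rewrite ln_1, Rmult_0_r, exp_0.
Qed.

Definition binom_sum_R (b : R) (N : nat) (x : R) : R :=
  sum_f_R0 (fun k => binom_coef b k * x ^ k) N.

Lemma binom_sum_RtoC (b : R) (N : nat) (x : R) :
  binom_sum b N (RtoC x) = RtoC (binom_sum_R b N x).
Proof.
  unfold binom_sum_R. induction N as [|N IH]; [cbn; f_equal; ring|].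
  cbn [binom_sum sum_f_R0]. now rewrite IH, RtoC_plus, RtoC_mult, RtoC_pow.
Qed.

Lemma disk_R (x : R) : 0 <= x < 1 -> disk (RtoC x).
Proof. intros H. red. rewrite Cmod_R, Rabs_pos_eq; lra. Qed.

(** On [[0, 1)] the partial sum times [(1 - x)^b] decreases from the value 1, by
    [binom_quotient_deriv]. *)
Lemma binom_sum_R_bound (b : R) (N : nat) (x : R) : 0 < b -> 0 <= x < 1 ->
  binom_sum_R b N x <= Rpower (1 - x) (- b).
Proof.
  intros Hb Hx.
  set (E := fun y : R => (binom_sum b N (RtoC y) * Cpower (1 - RtoC y) b)%C).
  assert (EE : forall y, 0 <= y <= x -> E y = RtoC (binom_sum_R b N y * Rpower (1 - y) b)).
  { intros y Hy. unfold E. rewrite binom_sum_RtoC, <- RtoC_minus, Cpower_R, RtoC_mult by lra.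
    reflexivity. }
  assert (D : forall y, 0 <= y <= x -> is_derive (fun y => Re (1 * E y)) y
    (- (b * binom_coef (b + 1) N * y ^ N * (Rpower (1 - y) b / (1 - y))))).
  { intros y Hy.
    replace (- (b * binom_coef (b + 1) N * y ^ N * (Rpower (1 - y) b / (1 - y))))
      with (Re (1 * (- (RtoC (b * binom_coef (b + 1) N) * RtoC y ^ N
              * (Cpower (1 - RtoC y) b / (1 - RtoC y))) * 1))).
    - apply curve_deriv_Re.
      apply (curve_deriv_comp (fun w => binom_sum b N w * Cpower (1 - w) b)%C RtoC).
      + apply binom_quotient_deriv; [exact Hb|]. apply disk_R. lra.
      + apply curve_deriv_slope. exists (fun _ => RtoC 1).
        split; [apply curve_cont_const|]. split; [reflexivity|].
        intros. rewrite RtoC_minus. ring.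
    - rewrite <- RtoC_minus, Cpower_R, <- RtoC_pow by lra.
      rewrite <- RtoC_div, <- !RtoC_mult, <- RtoC_opp, <- !RtoC_mult by lra.
      cbn [Re fst RtoC]. ring. }
  destruct (MVT_gen (fun y => Re (1 * E y)) 0 x
    (fun y => - (b * binom_coef (b + 1) N * y ^ N * (Rpower (1 - y) b / (1 - y))))) as [c [Hc M]].
  - intros y. rewrite Rmin_left, Rmax_right by lra. intros Hy. apply D. lra.
  - intros y. rewrite Rmin_left, Rmax_right by lra. intros Hy.
    apply derivable_continuous_pt. eexists. apply is_derive_Reals, D. lra.
  - rewrite Rmin_left, Rmax_right in Hc by lra.
    rewrite !EE in M by lra.
    replace (binom_sum_R b N 0) with 1 in M.
    2: { apply RtoC_inj. now rewrite <- binom_sum_RtoC, binom_sum_0. }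
    rewrite !Cmult_1_l in M. cbn [Re fst RtoC] in M.
    replace (Rpower (1 - 0) b) with 1 in M
      by (unfold Rpower; now rewrite Rminus_0_r, ln_1, Rmult_0_r, exp_0).
    assert (Pc : 0 <= b * binom_coef (b + 1) N * c ^ N * (Rpower (1 - c) b / (1 - c))).
    { assert (0 < binom_coef (b + 1) N) by (apply binom_coef_pos; lra).
      assert (0 <= c ^ N) by (apply pow_le; lra).
      assert (0 < Rpower (1 - c) b / (1 - c)) by (apply Rdiv_lt_0_compat; [apply exp_pos|lra]).
      apply Rmult_le_pos; [apply Rmult_le_pos|]; nra. }
    rewrite Rpower_Ropp. assert (Pp : 0 < Rpower (1 - x) b) by apply exp_pos.
    apply Rmult_le_reg_r with (Rpower (1 - x) b); [exact Pp|].
    rewrite Rinv_l by lra. nra.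
Qed.

Lemma binom_term_le_sum (b : R) (N : nat) (x : R) : 0 < b -> 0 <= x ->
  binom_coef b N * x ^ N <= binom_sum_R b N x.
Proof.
  intros Hb Hx. destruct N as [|N]; [unfold binom_sum_R; cbn; lra|].
  unfold binom_sum_R. cbn [sum_f_R0].
  assert (0 <= sum_f_R0 (fun k => binom_coef b k * x ^ k) N).
  { apply cond_pos_sum. intros n. apply Rmult_le_pos; [apply Rlt_le, binom_coef_pos, Hb|].
    now apply pow_le. }
  lra.
Qed.

(** At the larger radius [y = (1 + x) / 2] the terms are bounded by the sum, so at
    [x] they decay like [(x / y)^N]. *)
Lemma binom_term_small (b x eps : R) : 0 < b -> 0 <= x < 1 -> 0 < eps ->
  exists N, binom_coef b N * x ^ N < eps.
Proof.
  intros Hb Hx He.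
  set (y := (1 + x) / 2). set (K := Rpower (1 - y) (- b)).
  assert (PK : 0 < K) by apply exp_pos.
  assert (Hy : 0 < y < 1) by (unfold y; lra).
  assert (Hq : 0 <= x / y < 1).
  { split; [apply Rdiv_le_0_compat; lra|].
    apply Rmult_lt_reg_r with y; [lra|]. unfold Rdiv. rewrite Rmult_assoc, Rinv_l by lra.
    unfold y; lra. }
  destruct (pow_lt_1_zero (x / y)) with (y := eps / K) as [N HN].
  - rewrite Rabs_pos_eq; lra.
  - now apply Rdiv_lt_0_compat.
  - exists N. specialize (HN N (Nat.le_refl N)). rewrite Rabs_pos_eq in HN by (apply pow_le; lra).
    assert (B1 := binom_term_le_sum b N y Hb ltac:(lra)).
    assert (B2 := binom_sum_R_bound b N y Hb ltac:(lra)). fold K in B2.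
    replace (x ^ N) with (y ^ N * (x / y) ^ N).
    2: { rewrite <- Rpow_mult_distr. f_equal. field. lra. }
    apply (Rmult_lt_compat_r K) in HN; [|exact PK].
    unfold Rdiv at 2 in HN. rewrite Rmult_assoc, Rinv_l in HN by lra.
    assert (Q : 0 <= (x / y) ^ N) by (apply pow_le; lra).
    assert (P := binom_coef_pos b N Hb). assert (Py : 0 < y ^ N) by (apply pow_lt; lra).
    nra.
Qed.

Lemma Cmod_one_minus_bounds (w : C) (r : R) : Cmod w <= r -> 1 - r <= Cmod (1 - w) <= 1 + r.
Proof.
  intros H. split.
  - assert (T := Cmod_triangle (1 - w) w). replace (1 - w + w)%C with (RtoC 1) in T by ring.
    rewrite Cmod_1 in T. lra.
  - assert (T := Cmod_triangle 1 (- w)). rewrite Cmod_1, Cmod_opp in T.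
    unfold Cminus. lra.
Qed.

Lemma binom_series (b : R) (w : C) : 0 < b -> disk w ->
  exists K, 0 <= K /\ forall N,
    Cmod (binom_sum b N w - / Cpower (1 - w) b) <= K * (binom_coef (b + 1) N * Cmod w ^ N).
Proof.
  intros Hb Hw. set (r := Cmod w). assert (Hr : 0 <= r < 1) by (split; [apply Cmod_ge_0|exact Hw]).
  set (P := Cpower (1 - w) b). assert (NP : P <> 0) by apply Cpower_neq_0.
  assert (PP : 0 < Cmod P) by now apply Cmod_gt_0.
  set (K0 := b * (Rpower 2 b / (1 - r)) * r).
  assert (PK : 0 <= K0).
  { assert (0 < Rpower 2 b / (1 - r)) by (apply Rdiv_lt_0_compat; [apply exp_pos|lra]).
    unfold K0. apply Rmult_le_pos; nra. }
  exists (K0 / Cmod P). split; [apply Rdiv_le_0_compat; assumption|]. intros N.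
  assert (Pc : 0 < binom_coef (b + 1) N) by (apply binom_coef_pos; lra).
  set (E := fun x => (binom_sum b N x * Cpower (1 - x) b)%C).
  assert (M : Cmod (E w - E 0 - (w - 0) * 0) <=
    b * binom_coef (b + 1) N * r ^ N * (Rpower 2 b / (1 - r)) * Cmod (w - 0)).
  { apply (complex_mean_value E
      (fun x => - (RtoC (b * binom_coef (b + 1) N) * x ^ N * (Cpower (1 - x) b / (1 - x))))%C).
    intros t Ht x.
    assert (Mx : Cmod x <= r).
    { replace x with (RtoC t * w)%C by (unfold x; ring).
      rewrite Cmod_mult, Cmod_R, Rabs_pos_eq by lra. fold r. nra. }
    assert (Dx : disk x) by (red; lra).
    split; [now apply binom_quotient_deriv|].
    assert (N1 := one_minus_neq_0 x Dx).
    destruct (Cmod_one_minus_bounds x r Mx) as [B1 B2].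
    cbv beta. match goal with |- Cmod (?a - _)%C <= _ => replace (a - 0)%C with a by ring end.
    rewrite Cmod_opp, !Cmod_mult, Cmod_R, Cmod_pow, Cmod_div, Cmod_Cpower, Rabs_pos_eq by (assumption || nra).
    apply Rmult_le_compat.
    - apply Rmult_le_pos; [nra|]. apply pow_le, Cmod_ge_0.
    - apply Rdiv_le_0_compat; [apply Rlt_le, exp_pos|lra].
    - apply Rmult_le_compat_l; [nra|]. apply pow_incr. split; [apply Cmod_ge_0|exact Mx].
    - unfold Rdiv. apply Rmult_le_compat.
      + apply Rlt_le, exp_pos.
      + apply Rlt_le, Rinv_0_lt_compat; lra.
      + apply Rle_Rpower_l; lra.
      + apply Rinv_le_contravar; lra. }
  replace (E w - E 0 - (w - 0) * 0)%C with (E w - 1)%C in M.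
  2: { unfold E. rewrite binom_sum_0, Cpower_at_1. ring. }
  replace (w - 0)%C with w in M by ring.
  replace (binom_sum b N w - / P)%C with ((E w - 1) / P)%C by (unfold E; fold P; field; exact NP).
  rewrite Cmod_div by exact NP. unfold Rdiv at 1.
  replace (K0 / Cmod P * (binom_coef (b + 1) N * r ^ N))
    with (K0 * (binom_coef (b + 1) N * r ^ N) * / Cmod P) by (unfold Rdiv; ring).
  apply Rmult_le_compat_r; [apply Rlt_le, Rinv_0_lt_compat, PP|].
  eapply Rle_trans; [exact M|]. fold r. unfold K0. right. ring.
Qed.

Lemma binom_combination_partial (b : R) (l1 l2 a x1 x2 : C) (B : nat -> R) (N : nat) : 0 < b ->
  (forall k, Cmod (l1 * x1 ^ k - l2 * x2 ^ k) <= B k) ->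
  Cmod (l1 * binom_sum b N (a * x1) - l2 * binom_sum b N (a * x2))
  <= sum_f_R0 (fun k => binom_coef b k * Cmod a ^ k * B k) N.
Proof.
  intros Hb HB. induction N as [|N IH].
  - cbn -[Cmod]. rewrite !Rmult_1_l. apply (HB 0%nat).
  - cbn [binom_sum sum_f_R0].
    replace (l1 * (binom_sum b N (a * x1) + RtoC (binom_coef b (S N)) * (a * x1) ^ S N)
       - l2 * (binom_sum b N (a * x2) + RtoC (binom_coef b (S N)) * (a * x2) ^ S N))%C
      with (l1 * binom_sum b N (a * x1) - l2 * binom_sum b N (a * x2)
        + RtoC (binom_coef b (S N)) * a ^ S N * (l1 * x1 ^ S N - l2 * x2 ^ S N))%C
      by (rewrite !Cpow_mult_l; ring).
    eapply Rle_trans; [apply Cmod_triangle|]. apply Rplus_le_compat; [exact IH|].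
    assert (P := binom_coef_pos b (S N) Hb).
    rewrite !Cmod_mult, Cmod_R, Cmod_pow, Rabs_pos_eq by lra.
    apply Rmult_le_compat_l; [|apply HB].
    apply Rmult_le_pos; [lra|]. apply pow_le, Cmod_ge_0.
Qed.

Lemma Cmult_disk (a x : C) : disk a -> disk x -> disk (a * x).
Proof.
  unfold disk. intros Ha Hx. rewrite Cmod_mult.
  assert (P1 := Cmod_ge_0 a). assert (P2 := Cmod_ge_0 x). nra.
Qed.

(** Expanding both kernels in powers reduces an estimate for their difference to
    estimates for monomials. *)
Lemma binom_combination (b : R) (l1 l2 a x1 x2 : C) (B : nat -> R) (M : R) :
  0 < b -> disk a -> disk x1 -> disk x2 ->
  (forall k, Cmod (l1 * x1 ^ k - l2 * x2 ^ k) <= B k) ->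
  (forall N, sum_f_R0 (fun k => binom_coef b k * Cmod a ^ k * B k) N <= M) ->
  Cmod (l1 / Cpower (1 - a * x1) b - l2 / Cpower (1 - a * x2) b) <= M.
Proof.
  intros Hb Ha H1 H2 HB HM. apply le_epsilon. intros eps He.
  destruct (binom_series b (a * x1) Hb (Cmult_disk _ _ Ha H1)) as [K1 [P1 S1]].
  destruct (binom_series b (a * x2) Hb (Cmult_disk _ _ Ha H2)) as [K2 [P2 S2]].
  set (K := Cmod l1 * K1 + Cmod l2 * K2).
  assert (L1 := Cmod_ge_0 l1). assert (L2 := Cmod_ge_0 l2).
  assert (PK : 0 <= K) by (unfold K; apply Rplus_le_le_0_compat; now apply Rmult_le_pos).
  assert (Pa := Cmod_ge_0 a). red in Ha, H1, H2.
  destruct (binom_term_small (b + 1) (Cmod a) (eps / (K + 1))) as [N HN];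
    [lra|lra|apply Rdiv_lt_0_compat; lra|].
  specialize (S1 N). specialize (S2 N).
  set (c := binom_coef (b + 1) N) in *.
  assert (Pc : 0 < c) by (apply binom_coef_pos; lra).
  assert (Q : forall x, Cmod x < 1 -> c * Cmod (a * x) ^ N <= c * Cmod a ^ N).
  { intros x Hx. apply Rmult_le_compat_l; [lra|]. apply pow_incr.
    split; [apply Cmod_ge_0|]. rewrite Cmod_mult. assert (Px := Cmod_ge_0 x). nra. }
  assert (Q1 := Q x1 H1). assert (Q2 := Q x2 H2).
  set (t := c * Cmod a ^ N) in *.
  assert (Pt : 0 <= t) by (apply Rmult_le_pos; [lra|apply pow_le, Pa]).
  replace (l1 / Cpower (1 - a * x1) b - l2 / Cpower (1 - a * x2) b)%C with
    (l1 * binom_sum b N (a * x1) - l2 * binom_sum b N (a * x2)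
     + (- (l1 * (binom_sum b N (a * x1) - / Cpower (1 - a * x1) b))
        + l2 * (binom_sum b N (a * x2) - / Cpower (1 - a * x2) b)))%C
    by (unfold Cdiv; ring).
  eapply Rle_trans; [apply Cmod_triangle|].
  apply Rplus_le_compat.
  - eapply Rle_trans; [now apply binom_combination_partial|apply HM].
  - eapply Rle_trans; [apply Cmod_triangle|].
    rewrite Cmod_opp, !Cmod_mult.
    apply Rle_trans with (K * t).
    + unfold K. rewrite Rmult_plus_distr_r, !Rmult_assoc.
      apply Rplus_le_compat; apply Rmult_le_compat_l; try assumption.
      * eapply Rle_trans; [exact S1|]. now apply Rmult_le_compat_l.
      * eapply Rle_trans; [exact S2|]. now apply Rmult_le_compat_l.
    + apply (Rmult_lt_compat_r (K + 1)) in HN; [|lra].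
      unfold Rdiv in HN. rewrite Rmult_assoc, Rinv_l in HN by lra. nra.
Qed.

(** * Weighted functions and the pseudo-hyperbolic distance *)

Definition defect (z : C) : R := 1 - Cmod z ^ 2.

Lemma defect_bounds (z : C) : disk z -> 1 - Cmod z <= defect z <= 1 /\ 0 < defect z.
Proof. unfold disk, defect. intros H. assert (P := Cmod_ge_0 z). split; [split|]; nra. Qed.

Lemma defect_le_two (z : C) : disk z -> defect z <= 2 * (1 - Cmod z).
Proof. unfold disk, defect. intros H. assert (P := Cmod_ge_0 z). nra. Qed.

Lemma kernel_lower (a z : C) : disk a -> disk z ->
  1 - Cmod a <= Cmod (1 - Cconj a * z) /\ 1 - Cmod z <= Cmod (1 - Cconj a * z) /\
  0 < Cmod (1 - Cconj a * z).
Proof.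
  unfold disk. intros Ha Hz. assert (P := Cmod_ge_0 a). assert (Q := Cmod_ge_0 z).
  destruct (Cmod_one_minus_bounds (Cconj a * z) (Cmod a * Cmod z)) as [H _].
  { rewrite Cmod_mult, Cmod_conj. lra. }
  repeat split; nra.
Qed.

Lemma Cconj_disk (a : C) : disk a -> disk (Cconj a).
Proof. unfold disk. now rewrite Cmod_conj. Qed.

Lemma kernel_neq_0 (a z : C) : disk a -> disk z -> (1 - Cconj a * z)%C <> 0.
Proof. intros Ha Hz. apply Cmod_gt_0. now apply kernel_lower. Qed.

Lemma rho_mul (z w : C) : disk z -> disk w ->
  Cmod (z - w) = rho z w * Cmod (1 - Cconj w * z).
Proof.
  intros Hz Hw. unfold rho. assert (N := kernel_neq_0 w z Hw Hz).
  rewrite Cmod_div by exact N. field. apply Rgt_not_eq, Cmod_gt_0, N.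
Qed.

Lemma rho_sym (z w : C) : disk z -> disk w -> rho z w = rho w z.
Proof.
  intros Hz Hw. unfold rho. rewrite !Cmod_div by now apply kernel_neq_0.
  f_equal.
  - rewrite <- Cmod_opp. f_equal. ring.
  - rewrite <- Cmod_conj. f_equal.
    rewrite Cminus_conj, Cmult_conj, Cconj_conj.
    replace (Cconj 1) with (RtoC 1) by (apply injective_projections; cbn; ring). ring.
Qed.

Lemma rho_ge_0 (z w : C) : 0 <= rho z w.
Proof. apply Cmod_ge_0. Qed.

(** [|1 - conj w z|^2 - |z - w|^2 = defect z * defect w]. *)
Lemma rho_le_1 (z w : C) : disk z -> disk w -> rho z w <= 1.
Proof.
  intros Hz Hw. destruct (kernel_lower w z Hw Hz) as [_ [_ P]].
  apply Rmult_le_reg_r with (Cmod (1 - Cconj w * z)); [exact P|].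
  rewrite <- rho_mul, Rmult_1_l by assumption.
  apply Rsqr_incr_0; [|apply Cmod_ge_0|apply Cmod_ge_0]. unfold Rsqr.
  assert (E : Cmod (1 - Cconj w * z) ^ 2 - Cmod (z - w) ^ 2 = defect z * defect w).
  { unfold defect. rewrite !Cmod2_alt. destruct z as [a b], w as [c d]. cbn. ring. }
  destruct (defect_bounds z Hz) as [_ P1]. destruct (defect_bounds w Hw) as [_ P2].
  nra.
Qed.

Lemma Rpower_deriv (s x : R) : 0 < x -> is_derive (fun y => Rpower y s) x (s * Rpower x (s - 1)).
Proof. intros Hx. apply is_derive_Reals, derivable_pt_lim_power, Hx. Qed.

Lemma Rpower_minus_1 (x s : R) : 0 < x -> Rpower x (s - 1) = Rpower x s / x.
Proof.
  intros Hx. unfold Rminus. rewrite Rpower_plus, Rpower_Ropp, Rpower_1 by exact Hx. reflexivity.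
Qed.

Lemma Rpower_pos (x s : R) : 0 < Rpower x s.
Proof. apply exp_pos. Qed.

Lemma Rpower_variation (s lo hi x y : R) : 0 < s -> 0 < lo ->
  lo <= x <= hi -> lo <= y <= hi ->
  Rabs (Rpower x s - Rpower y s) <= s * Rpower hi s / lo * Rabs (x - y).
Proof.
  intros Hs Hlo Hx Hy.
  destruct (MVT_gen (fun t => Rpower t s) y x (fun t => s * Rpower t (s - 1))) as [c [Hc E]].
  - intros t Ht. apply Rpower_deriv. assert (lo <= Rmin y x) by (apply Rmin_glb; lra). lra.
  - intros t Ht. apply derivable_continuous_pt. eexists. apply is_derive_Reals, Rpower_deriv.
    assert (lo <= Rmin y x) by (apply Rmin_glb; lra). lra.
  - rewrite E, Rabs_mult. apply Rmult_le_compat_r; [apply Rabs_pos|].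
    assert (lo <= Rmin y x) by (apply Rmin_glb; lra).
    assert (Rmax y x <= hi) by (apply Rmax_lub; lra).
    assert (P := Rpower_pos c s).
    rewrite Rpower_minus_1 by lra.
    rewrite Rabs_pos_eq.
    + unfold Rdiv. rewrite <- Rmult_assoc. apply Rmult_le_compat.
      * nra.
      * apply Rlt_le, Rinv_0_lt_compat; lra.
      * apply Rmult_le_compat_l; [lra|]. apply Rle_Rpower_l; lra.
      * apply Rinv_le_contravar; lra.
    + apply Rmult_le_pos; [lra|]. apply Rdiv_le_0_compat; lra.
Qed.

Lemma Rpower_scale (c x s : R) : 0 < c -> 0 < x -> Rpower (c * x) s = Rpower c s * Rpower x s.
Proof. intros. now rewrite Rpower_mult_distr. Qed.

(** The three summands come from the three estimates in [weighted_lipschitz]: distant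
    points, variation of the function, variation of the weight. *)
Definition lipschitz_const (s : R) : R := 8 + 4 * Rpower 5 s + 8 * s * Rpower (5 / 3) s.

Lemma defect_diff (z w : C) : disk z -> disk w -> Rabs (defect z - defect w) <= 2 * Cmod (z - w).
Proof.
  unfold disk, defect. intros Hz Hw.
  assert (P := Cmod_ge_0 z). assert (Q := Cmod_ge_0 w).
  assert (T := Cmod_diff_le z w). apply Rabs_le_between in T.
  apply Rabs_le. nra.
Qed.

(** Points at pseudo-hyperbolic distance below 1/4 have comparable defects,
    also along the segment between them, so the mean value inequality applies to
    each factor of [defect^s h]; beyond 1/4 the size bound alone suffices. *)
Lemma weighted_lipschitz (s A B : R) (h dh : C -> C) (z w : C) :
  0 < s ->
  (forall x, disk x -> cderiv h x (dh x)) ->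
  (forall x, disk x -> Rpower (defect x) s * Cmod (h x) <= A) ->
  (forall x, disk x -> Rpower (defect x) (s + 1) * Cmod (dh x) <= B) ->
  disk z -> disk w ->
  Cmod (RtoC (Rpower (defect z) s) * h z - RtoC (Rpower (defect w) s) * h w)
  <= lipschitz_const s * (A + B) * rho z w.
Proof.
  intros Hs Hd HA HB Hz Hw.
  assert (PA : 0 <= A).
  { eapply Rle_trans; [|apply (HA z Hz)]. apply Rmult_le_pos; [apply Rlt_le, Rpower_pos|apply Cmod_ge_0]. }
  assert (PB : 0 <= B).
  { eapply Rle_trans; [|apply (HB z Hz)]. apply Rmult_le_pos; [apply Rlt_le, Rpower_pos|apply Cmod_ge_0]. }
  assert (P5 := Rpower_pos 5 s). assert (P53 := Rpower_pos (5 / 3) s).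
  assert (Pr := rho_ge_0 z w). set (r := rho z w) in *.
  assert (PsP : 0 < s * Rpower (5 / 3) s) by nra.
  assert (Exp : lipschitz_const s * (A + B) * r =
     8 * A * r + 4 * Rpower 5 s * B * r + 8 * s * Rpower (5 / 3) s * A * r
     + (8 * B * r + 4 * Rpower 5 s * A * r + 8 * s * Rpower (5 / 3) s * B * r))
    by (unfold lipschitz_const; ring).
  assert (X1 : 0 <= A * r) by nra. assert (X2 : 0 <= B * r) by nra.
  assert (Y1 : 0 <= Rpower 5 s * (A * r)) by nra. assert (Y2 : 0 <= Rpower 5 s * (B * r)) by nra.
  assert (Z1 : 0 <= s * Rpower (5 / 3) s * (A * r)) by nra.
  assert (Z2 : 0 <= s * Rpower (5 / 3) s * (B * r)) by nra.
  assert (Mw : forall x, Cmod (RtoC (Rpower (defect x) s) * h x) = Rpower (defect x) s * Cmod (h x)).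
  { intros x. rewrite Cmod_mult, Cmod_R, Rabs_pos_eq; [reflexivity|apply Rlt_le, Rpower_pos]. }
  destruct (Rle_lt_dec (/ 4) r) as [Far|Near].
  - apply Rle_trans with (A + A).
    + eapply Rle_trans; [apply Cmod_triangle|]. rewrite Cmod_opp, !Mw.
      apply Rplus_le_compat; now apply HA.
    + rewrite Exp. nra.
  - set (d := defect w). destruct (defect_bounds w Hw) as [_ Pd]. fold d in Pd.
    assert (Rm := rho_mul z w Hz Hw). fold r in Rm.
    set (k := Cmod (1 - Cconj w * z)) in *.
    assert (Hk : k <= d + Cmod (z - w)).
    { assert (E : (1 - Cconj w * z)%C = (RtoC d + - (Cconj w * (z - w)))%C).
      { unfold d, defect. rewrite RtoC_minus, Cmod2_conj. ring. }
      unfold k. rewrite E. eapply Rle_trans; [apply Cmod_triangle|].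
      rewrite Cmod_opp, Cmod_mult, Cmod_conj, Cmod_R, (Rabs_pos_eq d) by lra.
      assert (Q := Cmod_ge_0 (z - w)). assert (Q' := Cmod_ge_0 w).
      assert (W : Cmod w < 1) by exact Hw.
      assert (Cmod w * Cmod (z - w) <= 1 * Cmod (z - w)) by (apply Rmult_le_compat_r; lra).
      lra. }
    assert (Pk : 0 <= k) by apply Cmod_ge_0.
    assert (Hk' : k <= 4 / 3 * d) by nra.
    assert (Hzw : Cmod (z - w) <= 4 / 3 * d * r) by nra.
    assert (Hzw' : Cmod (z - w) <= d / 3) by nra.
    (* All points of the segment have defect between [d / 3] and [5 d / 3]. *)
    assert (Comp : forall x, disk x -> Cmod (x - w) <= Cmod (z - w) -> d / 3 <= defect x <= 5 / 3 * d).
    { intros x Hx Hxw. assert (T := defect_diff x w Hx Hw). fold d in T.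
      apply Rabs_le_between in T. lra. }
    assert (Cz := Comp z Hz (Rle_refl _)).
    assert (Cw : d / 3 <= d <= 5 / 3 * d) by lra.
    assert (V1 : Cmod (h z - h w) <= B / Rpower (d / 3) (s + 1) * Cmod (z - w)).
    { replace (h z - h w)%C with (h z - h w - (z - w) * 0)%C by ring.
      apply (complex_mean_value h dh). intros t Ht x.
      assert (Dx : disk x) by now apply segment_in_disk.
      split; [now apply Hd|]. replace (dh x - 0)%C with (dh x) by ring.
      assert (Hxw : Cmod (x - w) <= Cmod (z - w)).
      { apply segment_in_ball; [|apply Rle_refl|exact Ht].
        rewrite Cmod_minus_diag. apply Cmod_ge_0. }
      destruct (Comp x Dx Hxw) as [L _].
      assert (Pp := Rpower_pos (d / 3) (s + 1)).
      apply Rmult_le_reg_r with (Rpower (d / 3) (s + 1)); [exact Pp|].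
      unfold Rdiv at 2. rewrite Rmult_assoc, Rinv_l, Rmult_1_r by lra.
      rewrite Rmult_comm. eapply Rle_trans; [|apply (HB x Dx)].
      apply Rmult_le_compat_r; [apply Cmod_ge_0|]. apply Rle_Rpower_l; lra. }
    assert (V2 : Rabs (Rpower (defect z) s - Rpower d s) <=
       s * Rpower (5 / 3 * d) s / (d / 3) * (2 * Cmod (z - w))).
    { eapply Rle_trans.
      - apply (Rpower_variation s (d / 3) (5 / 3 * d)); [lra|lra|exact Cz|exact Cw].
      - apply Rmult_le_compat_l; [|now apply defect_diff].
        apply Rdiv_le_0_compat; [|lra]. apply Rmult_le_pos; [lra|apply Rlt_le, Rpower_pos]. }
    replace (RtoC (Rpower (defect z) s) * h z - RtoC (Rpower d s) * h w)%C
      with (RtoC (Rpower (defect z) s) * (h z - h w)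
            + RtoC (Rpower (defect z) s - Rpower d s) * h w)%C by (rewrite RtoC_minus; ring).
    eapply Rle_trans; [apply Cmod_triangle|]. rewrite !Cmod_mult, !Cmod_R.
    rewrite (Rabs_pos_eq (Rpower (defect z) s)) by apply Rlt_le, Rpower_pos.
    set (D3 := Rpower (d / 3) s). assert (P3 : 0 < D3) by apply Rpower_pos.
    assert (E53 : Rpower (5 / 3 * d) s = Rpower 5 s * D3).
    { unfold D3. rewrite <- Rpower_scale by lra. f_equal. field. }
    assert (E53' : Rpower (5 / 3 * d) s = Rpower (5 / 3) s * Rpower d s) by (apply Rpower_scale; lra).
    assert (S1 : Rpower (defect z) s * Cmod (h z - h w) <= 4 * Rpower 5 s * B * r).
    { apply Rle_trans with ((Rpower 5 s * D3) * (B / Rpower (d / 3) (s + 1) * Cmod (z - w))).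
      - apply Rmult_le_compat; [apply Rlt_le, Rpower_pos|apply Cmod_ge_0| |exact V1].
        rewrite <- E53. apply Rle_Rpower_l; lra.
      - rewrite Rpower_plus, Rpower_1 by lra. fold D3.
        replace (Rpower 5 s * D3 * (B / (D3 * (d / 3)) * Cmod (z - w)))
          with (Rpower 5 s * B * (3 / d) * Cmod (z - w)) by (field; lra).
        apply Rle_trans with (Rpower 5 s * B * (3 / d) * (4 / 3 * d * r)).
        + apply Rmult_le_compat_l; [|exact Hzw].
          apply Rmult_le_pos; [nra|apply Rdiv_le_0_compat; lra].
        + right. field. lra. }
    assert (S2 : Rabs (Rpower (defect z) s - Rpower d s) * Cmod (h w) <= 8 * s * Rpower (5 / 3) s * A * r).
    { apply Rle_trans with (s * Rpower (5 / 3 * d) s / (d / 3) * (2 * (4 / 3 * d * r)) * Cmod (h w)).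
      - apply Rmult_le_compat_r; [apply Cmod_ge_0|]. eapply Rle_trans; [exact V2|].
        apply Rmult_le_compat_l; [|lra].
        apply Rdiv_le_0_compat; [|lra]. apply Rmult_le_pos; [lra|apply Rlt_le, Rpower_pos].
      - rewrite E53'.
        replace (s * (Rpower (5 / 3) s * Rpower d s) / (d / 3) * (2 * (4 / 3 * d * r)) * Cmod (h w))
          with (8 * s * Rpower (5 / 3) s * r * (Rpower d s * Cmod (h w))) by (field; lra).
        replace (8 * s * Rpower (5 / 3) s * A * r) with (8 * s * Rpower (5 / 3) s * r * A) by ring.
        apply Rmult_le_compat_l; [nra|]. now apply HA. }
    rewrite Exp. nra.
Qed.

(** * Growth of derivatives *)

(** Cauchy's estimate on the circle of radius [(1 - |x|) / 2], where the defect
    is at least a quarter of the defect at [x]. *)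
Lemma derive_growth (f : C -> C) (p M : R) :
  holomorphic f -> 0 <= p ->
  (forall x, disk x -> Rpower (defect x) p * Cmod (f x) <= M) ->
  forall x, disk x -> Rpower (defect x) (p + 1) * Cmod (C_derive f x) <= Rpower 4 (p + 1) * M.
Proof.
  intros Hf Hp HM x Hx.
  destruct (defect_bounds x Hx) as [[L U] P]. assert (T := defect_le_two x Hx).
  set (r := (1 - Cmod x) / 2). assert (Hx' := Hx). red in Hx'.
  assert (Pq := Rpower_pos (defect x / 4) p).
  assert (PM : 0 <= M).
  { eapply Rle_trans; [|apply (HM x Hx)]. apply Rmult_le_pos; [apply Rlt_le, Rpower_pos|apply Cmod_ge_0]. }
  assert (K : Cmod (C_derive f x) <= M / Rpower (defect x / 4) p / r).
  { apply cauchy_estimate; [exact Hf|unfold r; lra|unfold r; lra|].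
    intros w Hw.
    assert (Mw : Cmod w <= Cmod x + r).
    { replace w with ((w - x) + x)%C by ring. eapply Rle_trans; [apply Cmod_triangle|]. lra. }
    assert (Dw : disk w) by (red; unfold r in Mw; lra).
    destruct (defect_bounds w Dw) as [[Lw _] _].
    assert (defect x / 4 <= defect w) by (unfold r in Mw; lra).
    apply Rmult_le_reg_r with (Rpower (defect x / 4) p); [exact Pq|].
    replace (M / Rpower (defect x / 4) p * Rpower (defect x / 4) p) with M by (field; lra).
    rewrite Rmult_comm. eapply Rle_trans; [|apply (HM w Dw)].
    apply Rmult_le_compat_r; [apply Cmod_ge_0|]. apply Rle_Rpower_l; lra. }
  assert (Hr : defect x / 4 <= r) by (unfold r; lra).
  apply Rle_trans with (Rpower (defect x) (p + 1) * (M / Rpower (defect x / 4) p / (defect x / 4))).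
  - apply Rmult_le_compat_l; [apply Rlt_le, Rpower_pos|]. eapply Rle_trans; [exact K|].
    unfold Rdiv at 1 3. apply Rmult_le_compat_l; [apply Rdiv_le_0_compat; lra|].
    apply Rinv_le_contravar; lra.
  - replace (defect x) with (4 * (defect x / 4)) at 1 by field.
    rewrite Rpower_scale by lra.
    rewrite (Rpower_plus p 1 (defect x / 4)), Rpower_1 by lra.
    right. field. lra.
Qed.

Lemma holomorphic_derive_n (f : C -> C) (m : nat) : holomorphic f -> holomorphic (C_derive_n f m).
Proof. intros H. induction m as [|m IH]; [exact H|]. now apply holomorphic_derive. Qed.

Lemma derive_n_growth (alpha : R) (j : nat) : 0 < alpha -> exists K, 0 <= K /\
  forall f N, holomorphic f ->
  (forall x, disk x -> Rpower (defect x) alpha * Cmod (C_derive f x) <= N) ->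
  forall x, disk x ->
  Rpower (defect x) (alpha + INR j) * Cmod (C_derive_n f (S j) x) <= K * N.
Proof.
  intros Ha. induction j as [|j [K [PK IH]]].
  - exists 1. split; [lra|]. intros f N Hf HN x Hx. cbn [INR]. rewrite Rplus_0_r, Rmult_1_l.
    now apply HN.
  - exists (Rpower 4 (alpha + INR j + 1) * K). split.
    { apply Rmult_le_pos; [apply Rlt_le, Rpower_pos|exact PK]. }
    intros f N Hf HN x Hx. rewrite S_INR, <- Rplus_assoc, Rmult_assoc.
    apply (derive_growth (C_derive_n f (S j))).
    + now apply holomorphic_derive_n.
    + generalize (pos_INR j). lra.
    + intros y Hy. now apply IH.
    + exact Hx.
Qed.

(** Along the radius [|f'|] is at most [N (1 - t |x|)^-alpha], whose integral is of
    order [(1 - |x|)^(1 - alpha)] as [alpha > 1]. *)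
Lemma radial_growth (f : C -> C) (alpha N : R) : 1 < alpha ->
  holomorphic f ->
  (forall x, disk x -> Rpower (defect x) alpha * Cmod (C_derive f x) <= N) ->
  forall x, disk x ->
  Rpower (defect x) (alpha - 1) * Cmod (f x) <= Cmod (f 0) + Rpower 2 (alpha - 1) * (N / (alpha - 1)).
Proof.
  intros Ha Hf HN x Hx.
  assert (PN : 0 <= N).
  { eapply Rle_trans; [|apply (HN x Hx)]. apply Rmult_le_pos; [apply Rlt_le, Rpower_pos|apply Cmod_ge_0]. }
  set (r := Cmod x). assert (Pr : 0 <= r) by apply Cmod_ge_0. assert (Hr : r < 1) by exact Hx.
  set (G := fun t => N / (alpha - 1) * Rpower (1 - t * r) (- (alpha - 1))).
  assert (V : Cmod (f x - f 0) <= G 1 - G 0).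
  { replace (f x - f 0)%C with ((fun t => f (0 + RtoC t * x)%C) 1%R - (fun t => f (0 + RtoC t * x)%C) 0%R)%C.
    2: { cbv beta. replace (0 + 1 * x)%C with x by ring. replace (0 + 0 * x)%C with (RtoC 0) by ring. reflexivity. }
    apply (curve_mean_value (fun t => f (0 + RtoC t * x)%C)
      (fun t => (C_derive f (0 + RtoC t * x) * x)%C) G
      (fun t => N * r * Rpower (1 - t * r) (- alpha))); [lra| | |].
    - intros t Ht. apply (curve_deriv_comp f (fun t => 0 + RtoC t * x)%C); [|apply curve_deriv_line].
      apply holomorphic_cderiv; [exact Hf|].
      replace x with (x - 0)%C at 1 by ring. apply segment_in_disk; [apply disk_0|exact Hx|exact Ht].
    - intros t Ht. assert (0 < 1 - t * r) by nra.
      replace (N * r * Rpower (1 - t * r) (- alpha))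
        with (N / (alpha - 1) * (- r * (- (alpha - 1) * Rpower (1 - t * r) (- (alpha - 1) - 1)))).
      + apply is_derive_scal.
        apply (is_derive_comp (fun y => Rpower y (- (alpha - 1))) (fun t => 1 - t * r)).
        * now apply Rpower_deriv.
        * auto_derive; [exact I|ring].
      + replace (- (alpha - 1) - 1) with (- alpha) by ring. field. lra.
    - intros t Ht. rewrite Cmod_mult. fold r.
      replace (N * r * Rpower (1 - t * r) (- alpha)) with (N * Rpower (1 - t * r) (- alpha) * r) by ring.
      apply Rmult_le_compat_r; [exact Pr|].
      set (y := (0 + RtoC t * x)%C).
      assert (My : Cmod y = t * r).
      { unfold y. replace (0 + RtoC t * x)%C with (RtoC t * x)%C by ring.
        rewrite Cmod_mult, Cmod_R, Rabs_pos_eq by lra. reflexivity. }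
      assert (Dy : disk y) by (red; rewrite My; nra).
      destruct (defect_bounds y Dy) as [[Ly _] _]. rewrite My in Ly.
      assert (Q : 0 < 1 - t * r) by nra.
      rewrite Rpower_Ropp. assert (Pq := Rpower_pos (1 - t * r) alpha).
      apply Rmult_le_reg_r with (Rpower (1 - t * r) alpha); [exact Pq|].
      rewrite Rmult_assoc, Rinv_l, Rmult_1_r by lra. rewrite Rmult_comm.
      eapply Rle_trans; [|apply (HN y Dy)].
      apply Rmult_le_compat_r; [apply Cmod_ge_0|]. apply Rle_Rpower_l; lra. }
  assert (G0 : 0 <= G 0).
  { apply Rmult_le_pos; [apply Rdiv_le_0_compat; lra|apply Rlt_le, Rpower_pos]. }
  assert (F : Cmod (f x) <= Cmod (f 0) + G 1).
  { replace (f x) with (f 0 + (f x - f 0))%C by ring. eapply Rle_trans; [apply Cmod_triangle|]. lra. }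
  destruct (defect_bounds x Hx) as [[L U] P]. assert (T := defect_le_two x Hx). fold r in L, T.
  assert (W1 : Rpower (defect x) (alpha - 1) <= 1).
  { replace 1 with (Rpower 1 (alpha - 1)) at 2 by (unfold Rpower; now rewrite ln_1, Rmult_0_r, exp_0).
    apply Rle_Rpower_l; lra. }
  assert (W2 : Rpower (defect x) (alpha - 1) <= Rpower 2 (alpha - 1) * Rpower (1 - r) (alpha - 1)).
  { rewrite <- Rpower_scale by lra. apply Rle_Rpower_l; lra. }
  assert (W0 := Rpower_pos (defect x) (alpha - 1)).
  apply Rle_trans with (Rpower (defect x) (alpha - 1) * (Cmod (f 0) + G 1)).
  { apply Rmult_le_compat_l; [lra|exact F]. }
  rewrite Rmult_plus_distr_l. apply Rplus_le_compat.
  - rewrite <- (Rmult_1_l (Cmod (f 0))) at 2. apply Rmult_le_compat_r; [apply Cmod_ge_0|exact W1].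
  - unfold G. rewrite Rmult_1_l, Rpower_Ropp.
    assert (Pq := Rpower_pos (1 - r) (alpha - 1)).
    assert (PN' : 0 <= N / (alpha - 1)) by (apply Rdiv_le_0_compat; lra).
    apply Rle_trans with (Rpower 2 (alpha - 1) * Rpower (1 - r) (alpha - 1)
      * (N / (alpha - 1) * / Rpower (1 - r) (alpha - 1))).
    + apply Rmult_le_compat_r; [|exact W2]. apply Rmult_le_pos; [exact PN'|].
      apply Rlt_le, Rinv_0_lt_compat, Pq.
    + right. field. split; lra.
Qed.

(** * Suprema as uniform bounds *)

Lemma Rbar_lub_correct (E : Rbar -> Prop) : Rbar_is_lub E (Rbar_lub E).
Proof. exact (proj2_sig (Rbar_ex_lub E)). Qed.

Lemma sup_disk_finite (F : C -> Rbar) :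
  Rbar_lt (sup_disk F) p_infty <-> exists K : R, forall z, disk z -> Rbar_le (F z) K.
Proof.
  unfold sup_disk.
  destruct (Rbar_lub_correct (fun y => exists z, disk z /\ y = F z)) as [U L].
  set (S := Rbar_lub _) in *. split.
  - intros H. exists (match S with Finite x => x | _ => 0 end). intros z Hz.
    assert (B : Rbar_le (F z) S) by (apply U; exists z; now split).
    destruct S as [x| |]; [exact B|contradiction|].
    destruct (F z); easy.
  - intros [K HK]. apply Rbar_le_lt_trans with (Finite K); [|exact I].
    apply L. intros y [z [Hz ->]]. now apply HK.
Qed.

Lemma sup_disk_le (F : C -> Rbar) (K : R) :
  (forall z, disk z -> Rbar_le (F z) K) -> Rbar_le (sup_disk F) K.
Proof.
  intros H. unfold sup_disk.
  destruct (Rbar_lub_correct (fun y => exists z, disk z /\ y = F z)) as [_ L].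
  apply L. intros y [z [Hz ->]]. now apply H.
Qed.

Lemma sup_disk_ge (F : C -> Rbar) (z : C) : disk z -> Rbar_le (F z) (sup_disk F).
Proof.
  intros Hz. unfold sup_disk.
  destruct (Rbar_lub_correct (fun y => exists z, disk z /\ y = F z)) as [U _].
  apply U. exists z. now split.
Qed.

Lemma sup_disk_nonneg (F : C -> Rbar) :
  (forall z, disk z -> Rbar_le 0 (F z)) -> Rbar_le 0 (sup_disk F).
Proof.
  intros H. eapply Rbar_le_trans; [apply (H 0 disk_0)|]. apply sup_disk_ge, disk_0.
Qed.

Lemma Rbar_plus_finite (a b : Rbar) : Rbar_le 0 a -> Rbar_le 0 b ->
  (Rbar_lt (Rbar_plus a b) p_infty <-> Rbar_lt a p_infty /\ Rbar_lt b p_infty).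
Proof. destruct a, b; cbn; tauto. Qed.

Lemma norm_v_nonneg (v : C -> R) (f : C -> C) :
  (forall z, disk z -> 0 < v z) -> Rbar_le 0 (norm_v v f).
Proof.
  intros Hv. apply sup_disk_nonneg. intros z Hz. cbn.
  apply Rmult_le_pos; [now apply Rlt_le, Hv|apply Cmod_ge_0].
Qed.

Lemma norm_v_le (v : C -> R) (f : C -> C) (K : R) :
  Rbar_le (norm_v v f) K <-> forall z, disk z -> v z * Cmod (f z) <= K.
Proof.
  split.
  - intros H z Hz. apply (Rbar_le_trans (Finite (v z * Cmod (f z))) (norm_v v f) K); [|exact H].
    now apply (sup_disk_ge (fun z => Finite (v z * Cmod (f z)))).
  - intros H. now apply sup_disk_le.
Qed.

Lemma norm_v_finite (v : C -> R) (f : C -> C) :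
  Rbar_lt (norm_v v f) p_infty <-> exists K : R, forall z, disk z -> v z * Cmod (f z) <= K.
Proof.
  unfold norm_v. rewrite sup_disk_finite. reflexivity.
Qed.

Lemma norm_Bloch_le (alpha K1 K2 : R) (f : C -> C) :
  Cmod (f 0) <= K1 ->
  (forall z, disk z -> Rpower (defect z) alpha * Cmod (C_derive f z) <= K2) ->
  Rbar_le (norm_Bloch alpha f) (K1 + K2).
Proof.
  intros H1 H2. change (Finite (K1 + K2)) with (Rbar_plus K1 K2).
  apply Rbar_plus_le_compat; [exact H1|]. apply sup_disk_le. exact H2.
Qed.

Lemma norm_Bloch_spec (alpha : R) (f : C -> C) : Rbar_lt (norm_Bloch alpha f) p_infty ->
  exists N : R, norm_Bloch alpha f = N /\ Cmod (f 0) <= N /\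
  forall z, disk z -> Rpower (defect z) alpha * Cmod (C_derive f z) <= N.
Proof.
  unfold norm_Bloch. intros H.
  set (F := fun z => Finite (Rpower (1 - Cmod z ^ 2) alpha * Cmod (C_derive f z))) in *.
  assert (P : Rbar_le 0 (sup_disk F)).
  { apply sup_disk_nonneg. intros z _. cbn.
    apply Rmult_le_pos; [apply Rlt_le, Rpower_pos|apply Cmod_ge_0]. }
  assert (B : forall z, disk z -> Rbar_le (F z) (sup_disk F)) by apply sup_disk_ge.
  assert (P0 := Cmod_ge_0 (f 0)).
  destruct (sup_disk F) as [S| |]; try contradiction.
  exists (Cmod (f 0) + S). split; [reflexivity|]. cbn in P. split; [lra|].
  intros z Hz. apply Rle_trans with S; [exact (B z Hz)|lra].
Qed.

(** * Weighted differentiation composition operators *)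

Definition weighted_value (v : C -> R) (u : C -> C) (z : C) : C := (RtoC (v z) * u z)%C.

Lemma weighted_wdc_diff (m : nat) (v : C -> R) (u1 u2 phi1 phi2 f : C -> C) (z : C) :
  0 <= v z ->
  v z * Cmod (wdc_diff m phi1 u1 phi2 u2 f z) =
  Cmod (weighted_value v u1 z * C_derive_n f m (phi1 z)
        - weighted_value v u2 z * C_derive_n f m (phi2 z)).
Proof.
  intros Hv. unfold wdc_diff, wdc_op, weighted_value.
  rewrite <- (Rabs_pos_eq (v z)) at 1 by exact Hv. rewrite <- Cmod_R, <- Cmod_mult.
  f_equal. ring.
Qed.

Lemma weighted_power_diff (n : nat) (v : C -> R) (u1 u2 phi1 phi2 : C -> C) (z : C) :
  0 <= v z ->
  v z * Cmod (u1 z * phi1 z ^ n - u2 z * phi2 z ^ n) =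
  Cmod (weighted_value v u1 z * phi1 z ^ n - weighted_value v u2 z * phi2 z ^ n).
Proof.
  intros Hv. unfold weighted_value.
  rewrite <- (Rabs_pos_eq (v z)) at 1 by exact Hv. rewrite <- Cmod_R, <- Cmod_mult.
  f_equal. ring.
Qed.

Lemma wdc_diff_holomorphic (m : nat) (u1 u2 phi1 phi2 f : C -> C) :
  holomorphic u1 -> holomorphic u2 -> self_map phi1 -> self_map phi2 -> holomorphic f ->
  holomorphic (wdc_diff m phi1 u1 phi2 u2 f).
Proof.
  assert (One : forall u phi, holomorphic u -> self_map phi -> holomorphic f ->
    forall z, disk z -> exists l, cderiv (wdc_op m phi u f) z l).
  { intros u phi Hu [Hp Hd] Hf z Hz. eexists. apply (cderiv_mult u (fun w => C_derive_n f m (phi w))).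
    - now apply holomorphic_cderiv.
    - apply (cderiv_comp (C_derive_n f m) phi); [|now apply holomorphic_cderiv].
      apply holomorphic_cderiv; [now apply holomorphic_derive_n|now apply Hd]. }
  intros H1 H2 H3 H4 Hf z Hz.
  destruct (One u1 phi1 H1 H3 Hf z Hz) as [l1 E1]. destruct (One u2 phi2 H2 H4 Hf z Hz) as [l2 E2].
  exists (l1 - l2)%C. now apply cderiv_minus.
Qed.

(** * Monomials as test functions *)

(** [(n + 1) (n + 2) ... (n + m)], the factor produced by differentiating [z^(n+m)]
    [m] times. *)
Fixpoint rising (n m : nat) : R :=
  match m with O => 1 | S k => rising (S n) k * INR (S n) end.

Lemma derive_n_pow (n m : nat) (x : C) :
  C_derive_n (fun z => (z ^ (n + m))%C) m x = (RtoC (rising n m) * x ^ n)%C.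
Proof.
  revert n x. induction m as [|m IH]; intros n x.
  - cbn. rewrite Nat.add_0_r. ring.
  - change (C_derive (C_derive_n (fun z => (z ^ (n + S m))%C) m) x = (RtoC (rising n (S m)) * x ^ n)%C).
    apply cderiv_unique.
    apply cderiv_ext with (fun y => (RtoC (rising (S n) m) * y ^ S n)%C).
    { intros y. now rewrite <- IH, Nat.add_succ_r. }
    cbn [rising]. rewrite RtoC_mult, <- Cmult_assoc.
    apply cderiv_scal, cderiv_pow.
Qed.

Lemma rising_lower (n m : nat) : INR n ^ m <= rising n m.
Proof.
  revert n. induction m as [|m IH]; intros n; [cbn; lra|].
  cbn [rising pow]. rewrite (Rmult_comm (INR n)).
  assert (P := pos_INR n). specialize (IH (S n)). rewrite S_INR in *.
  apply Rmult_le_compat; [apply pow_le, P|exact P| |lra].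
  eapply Rle_trans; [|exact IH]. apply pow_incr. lra.
Qed.

Lemma Rpower_1_base (s : R) : Rpower 1 s = 1.
Proof. unfold Rpower. now rewrite ln_1, Rmult_0_r, exp_0. Qed.

Lemma Rpower_exp_bound (y alpha : R) : 0 < y -> 0 < alpha ->
  Rpower y alpha <= Rpower alpha alpha * exp y.
Proof.
  intros Hy Ha. unfold Rpower. rewrite <- exp_plus.
  assert (K : alpha * ln y <= alpha * ln alpha + y).
  { assert (E := exp_ineq1_le (ln (y / alpha))).
    assert (Pq : 0 < y / alpha) by now apply Rdiv_lt_0_compat.
    rewrite exp_ln in E by exact Pq. rewrite ln_div in E by assumption.
    assert (alpha * (1 + (ln y - ln alpha)) <= alpha * (y / alpha)) by (apply Rmult_le_compat_l; lra).
    replace (alpha * (y / alpha)) with y in H by (field; lra). lra. }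
  destruct (Rle_lt_or_eq_dec _ _ K) as [L|E].
  - now apply Rlt_le, exp_increasing.
  - rewrite E. lra.
Qed.

Lemma pow_le_exp (x : R) (n : nat) : 0 <= x -> x ^ n <= exp (- (INR n * (1 - x))).
Proof.
  intros Hx. replace (exp (- (INR n * (1 - x)))) with (exp (- (1 - x)) ^ n).
  - apply pow_incr. split; [exact Hx|]. generalize (exp_ineq1_le (- (1 - x))). lra.
  - induction n as [|n IH]; [cbn; now rewrite Rmult_0_l, Ropp_0, exp_0|].
    cbn [pow]. rewrite IH, <- exp_plus, S_INR. f_equal. ring.
Qed.

(** With [y = (n + 1) (1 - |x|)] the product is at most
    [(2 y)^alpha |x|^n], and [|x|^n <= e^(1 - y)] while [y^alpha <= alpha^alpha e^y]. *)
Lemma monomial_weight (alpha : R) (n : nat) (x : C) : 0 < alpha -> disk x ->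
  Rpower (INR (S n)) alpha * (Rpower (defect x) alpha * Cmod x ^ n) <= Rpower 2 alpha * Rpower alpha alpha * exp 1.
Proof.
  intros Ha Hx. destruct (defect_bounds x Hx) as [[L U] P]. assert (T := defect_le_two x Hx).
  assert (Hx' := Hx). red in Hx'. assert (P0 := Cmod_ge_0 x).
  assert (PN : 0 < INR (S n)) by (apply lt_0_INR; lia).
  set (y := INR (S n) * (1 - Cmod x)). assert (Py : 0 < y) by (apply Rmult_lt_0_compat; lra).
  assert (W : Rpower (INR (S n)) alpha * Rpower (defect x) alpha <= Rpower 2 alpha * Rpower y alpha).
  { rewrite <- !Rpower_scale by lra. apply Rle_Rpower_l; [lra|]. split; [nra|]. unfold y. nra. }
  assert (W2 := Rpower_exp_bound y alpha Py Ha).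
  assert (W3 := pow_le_exp (Cmod x) n P0).
  assert (W4 : exp y * exp (- (INR n * (1 - Cmod x))) <= exp 1).
  { rewrite <- exp_plus. unfold y. rewrite S_INR.
    replace ((INR n + 1) * (1 - Cmod x) + - (INR n * (1 - Cmod x))) with (1 - Cmod x) by ring.
    destruct (Req_dec (Cmod x) 0) as [->|N]; [rewrite Rminus_0_r; lra|].
    apply Rlt_le, exp_increasing. lra. }
  assert (Q1 := Rpower_pos 2 alpha). assert (Q2 := Rpower_pos alpha alpha).
  assert (Q3 := Rpower_pos y alpha). assert (Q4 := exp_pos y).
  assert (Q5 := exp_pos (- (INR n * (1 - Cmod x)))).
  rewrite <- Rmult_assoc.
  apply Rle_trans with (Rpower 2 alpha * (Rpower alpha alpha * exp y) * exp (- (INR n * (1 - Cmod x)))).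
  - apply Rmult_le_compat; [|apply pow_le, P0| |exact W3].
    + apply Rlt_le, Rmult_lt_0_compat; apply Rpower_pos.
    + eapply Rle_trans; [exact W|]. apply Rmult_le_compat_l; lra.
  - replace (Rpower 2 alpha * (Rpower alpha alpha * exp y) * exp (- (INR n * (1 - Cmod x))))
      with (Rpower 2 alpha * Rpower alpha alpha * (exp y * exp (- (INR n * (1 - Cmod x))))) by ring.
    apply Rmult_le_compat_l; [nra|exact W4].
Qed.

Lemma pow_holomorphic (n : nat) : holomorphic (fun z => (z ^ n)%C).
Proof.
  intros z _. destruct n as [|n].
  - exists (RtoC 0). change (cderiv (fun _ => RtoC 1) z 0). apply cderiv_const.
  - exists (RtoC (INR (S n)) * z ^ n)%C. exact (cderiv_pow n z).
Qed.

Definition monomial_const (alpha : R) : R := Rpower 2 alpha * Rpower alpha alpha * exp 1.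

Lemma pow_norm_Bloch (alpha : R) (n : nat) : 0 < alpha ->
  Rbar_le (norm_Bloch alpha (fun z => (z ^ S n)%C)) (monomial_const alpha * Rpower (INR (S n)) (1 - alpha)).
Proof.
  intros Ha.
  replace (monomial_const alpha * Rpower (INR (S n)) (1 - alpha))
    with (0 + monomial_const alpha * Rpower (INR (S n)) (1 - alpha)) by ring.
  apply norm_Bloch_le.
  - rewrite Cpow_S, Cmult_0_l, Cmod_0. lra.
  - intros z Hz. rewrite (cderiv_unique _ _ _ (cderiv_pow n z)).
    assert (PN : 0 < INR (S n)) by (apply lt_0_INR; lia).
    rewrite Cmod_mult, Cmod_R, Cmod_pow, Rabs_pos_eq by lra.
    unfold Rminus. rewrite Rpower_plus, Rpower_1, Rpower_Ropp by exact PN.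
    assert (Pp := Rpower_pos (INR (S n)) alpha).
    assert (M := monomial_weight alpha n z Ha Hz). fold (monomial_const alpha) in M.
    apply Rmult_le_reg_l with (Rpower (INR (S n)) alpha); [exact Pp|].
    replace (Rpower (INR (S n)) alpha * (Rpower (defect z) alpha * (INR (S n) * Cmod z ^ n)))
      with (INR (S n) * (Rpower (INR (S n)) alpha * (Rpower (defect z) alpha * Cmod z ^ n))) by ring.
    replace (Rpower (INR (S n)) alpha * (monomial_const alpha * (INR (S n) * / Rpower (INR (S n)) alpha)))
      with (INR (S n) * monomial_const alpha) by (field; lra).
    apply Rmult_le_compat_l; lra.
Qed.

Lemma one_norm_Bloch (alpha : R) : Rbar_le (norm_Bloch alpha (fun z => (z ^ 0)%C)) (1 + 0).
Proof.
  apply norm_Bloch_le.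
  - cbn. rewrite Cmod_1. lra.
  - intros z _. rewrite (cderiv_unique (fun z => (z ^ 0)%C) z 0); [rewrite Cmod_0; lra|].
    exact (cderiv_const 1 z).
Qed.

Lemma pow_in_Bloch (alpha : R) (n : nat) : 0 < alpha -> in_Bloch alpha (fun z => (z ^ n)%C).
Proof.
  intros Ha. split; [apply pow_holomorphic|]. destruct n as [|n].
  - eapply Rbar_le_lt_trans; [apply one_norm_Bloch|exact I].
  - eapply Rbar_le_lt_trans; [now apply pow_norm_Bloch|exact I].
Qed.

Lemma Rpower_INR_pow (n m : nat) : Rpower (INR (S n)) (INR m) = INR (S n) ^ m.
Proof. apply Rpower_pow, lt_0_INR. lia. Qed.

Lemma Rpower_ratio (n m : nat) (p : R) :
  Rpower (INR (S n + m)) p <= Rpower (1 + INR m) (Rabs p) * Rpower (INR (S n)) p.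
Proof.
  assert (PN : 1 <= INR (S n)) by (rewrite S_INR; generalize (pos_INR n); lra).
  assert (Pm := pos_INR m). rewrite plus_INR.
  set (N := INR (S n)) in *. set (q := (N + INR m) / N).
  assert (Eq : N + INR m = q * N) by (unfold q; field; lra).
  assert (Hq : 1 <= q <= 1 + INR m).
  { unfold q. split.
    - apply Rmult_le_reg_r with N; [lra|]. unfold Rdiv. rewrite Rmult_assoc, Rinv_l by lra. lra.
    - apply Rmult_le_reg_r with N; [lra|]. unfold Rdiv. rewrite Rmult_assoc, Rinv_l by lra. nra. }
  rewrite Eq, Rpower_scale by lra. apply Rmult_le_compat_r; [apply Rlt_le, Rpower_pos|].
  apply Rle_trans with (Rpower q (Rabs p)).
  - apply Rle_Rpower; [lra|apply Rle_abs].
  - apply Rle_Rpower_l; [apply Rabs_pos|lra].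
Qed.

(** With [N = n + m], the operator bound on [z^N] reads
    [n^m v |u_1 phi_1^n - u_2 phi_2^n| <= C N^(1 - alpha)], and [N <= (m + 1) n] for
    [n >= 1].  For [n = 0] only finiteness is at stake. *)
Lemma bounded_implies_power (m : nat) (alpha : R) (v : C -> R) (u1 u2 phi1 phi2 : C -> C) :
  0 < alpha -> (forall z, disk z -> 0 < v z) ->
  bounded_Bloch_Hv alpha v (wdc_diff m phi1 u1 phi2 u2) ->
  power_condition (alpha + INR m - 1) v phi1 u1 phi2 u2.
Proof.
  intros Ha Hv [K HK]. set (s := alpha + INR m - 1).
  assert (Val : forall n z, disk z ->
    v z * Cmod (wdc_diff m phi1 u1 phi2 u2 (fun z => (z ^ (n + m))%C) z) =
    rising n m * (v z * Cmod (u1 z * phi1 z ^ n - u2 z * phi2 z ^ n))).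
  { intros n z Hz. unfold wdc_diff, wdc_op. rewrite !derive_n_pow.
    replace (u1 z * (RtoC (rising n m) * phi1 z ^ n) - u2 z * (RtoC (rising n m) * phi2 z ^ n))%C
      with (RtoC (rising n m) * (u1 z * phi1 z ^ n - u2 z * phi2 z ^ n))%C by ring.
    rewrite Cmod_mult, Cmod_R, Rabs_pos_eq; [ring|].
    eapply Rle_trans; [|apply rising_lower]. apply pow_le, pos_INR. }
  assert (Rpos : forall n, 0 < rising n m).
  { intros n. clear. revert n. induction m as [|k IH]; intros n; [cbn; lra|].
    cbn [rising]. apply Rmult_lt_0_compat; [apply IH|apply lt_0_INR; lia]. }
  assert (Fin : forall n, Rbar_lt (norm_v v (fun z => (u1 z * phi1 z ^ n - u2 z * phi2 z ^ n)%C)) p_infty).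
  { intros n. destruct (HK _ (pow_in_Bloch alpha (n + m) Ha)) as [[_ F] _].
    apply norm_v_finite in F. destruct F as [M HM]. apply norm_v_finite.
    exists (M / rising n m). intros z Hz. specialize (HM z Hz). rewrite Val in HM by exact Hz.
    specialize (Rpos n). apply Rmult_le_reg_l with (rising n m); [exact Rpos|].
    replace (rising n m * (M / rising n m)) with M by (field; lra). exact HM. }
  split; [exact Fin|].
  set (c := Rpower (1 + INR m) (Rabs (1 - alpha))).
  set (K' := Rabs K * monomial_const alpha * c).
  assert (PM : 0 < monomial_const alpha).
  { unfold monomial_const. repeat apply Rmult_lt_0_compat; apply exp_pos. }
  assert (Pc : 0 < c) by apply Rpower_pos.
  assert (PK := Rabs_pos K).
  apply Rbar_le_lt_trans with (Finite K'); [|exact I].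
  rewrite Rbar_sup_eq_lub. apply Rbar_lub_correct. intros y [n ->].
  set (d := fun z => (u1 z * phi1 z ^ n - u2 z * phi2 z ^ n)%C).
  specialize (Fin n). fold d in Fin.
  assert (B : Rbar_le 0 (norm_v v d)) by now apply norm_v_nonneg.
  destruct n as [|n].
  - cbn [nat_Rpower]. rewrite Rbar_mult_0_l. cbn. unfold K'.
    apply Rmult_le_pos; [|lra]. apply Rmult_le_pos; lra.
  - set (N := INR (S n)). assert (PN : 0 < N) by (apply lt_0_INR; lia).
    assert (Bd : Rbar_le (norm_v v d) (K' / Rpower N s)).
    { apply norm_v_le. intros z Hz.
      destruct (HK _ (pow_in_Bloch alpha (S n + m) Ha)) as [_ F].
      assert (NB := pow_norm_Bloch alpha (n + m) Ha).
      change (S (n + m)) with (S n + m)%nat in NB.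
      destruct (norm_Bloch_spec alpha _ (proj2 (pow_in_Bloch alpha (S n + m) Ha))) as [b [Eb [Pb _]]].
      rewrite Eb in F, NB. cbn [Rbar_mult] in F.
      assert (F' := proj1 (norm_v_le _ _ _) F z Hz). rewrite Val in F' by exact Hz. fold d in F'.
      assert (P0 := Cmod_ge_0 (0 ^ (S n + m))).
      change (b <= monomial_const alpha * Rpower (INR (S n + m)) (1 - alpha)) in NB.
      assert (R1 := Rpower_ratio n m (1 - alpha)). fold c N in R1.
      assert (R2 := rising_lower (S n) m). fold N in R2.
      assert (Pv : 0 <= v z * Cmod (d z)) by (apply Rmult_le_pos; [now apply Rlt_le, Hv|apply Cmod_ge_0]).
      assert (K * b <= Rabs K * b) by (apply Rmult_le_compat_r; [lra|apply Rle_abs]).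
      assert (C1 : N ^ m * (v z * Cmod (d z)) <= K' * Rpower N (1 - alpha)).
      { apply Rle_trans with (rising (S n) m * (v z * Cmod (d z))); [now apply Rmult_le_compat_r|].
        eapply Rle_trans; [exact F'|]. eapply Rle_trans; [eassumption|].
        unfold K'. rewrite !Rmult_assoc. apply Rmult_le_compat_l; [exact PK|].
        eapply Rle_trans; [exact NB|]. apply Rmult_le_compat_l; lra. }
      assert (Ps := Rpower_pos N s). assert (Pa := Rpower_pos N (1 - alpha)).
      apply Rmult_le_reg_l with (Rpower N s); [exact Ps|].
      replace (Rpower N s * (K' / Rpower N s)) with K' by (field; lra).
      apply Rmult_le_reg_r with (Rpower N (1 - alpha)); [exact Pa|].
      replace (Rpower N s * (v z * Cmod (d z)) * Rpower N (1 - alpha))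
        with (N ^ m * (v z * Cmod (d z))); [exact C1|].
      unfold N. rewrite <- Rpower_INR_pow.
      replace (INR m) with (s + (1 - alpha)) by (unfold s; ring).
      rewrite Rpower_plus. ring. }
    destruct (norm_v v d) as [x| |]; try contradiction.
    change (x <= K' / Rpower N s) in Bd. change (Rpower N s * x <= K').
    assert (Ps := Rpower_pos N s).
    apply Rmult_le_compat_l with (r := Rpower N s) in Bd; [|lra].
    replace (Rpower N s * (K' / Rpower N s)) with K' in Bd by (field; lra). exact Bd.
Qed.

(** * Bounds on the test functions from bounds on powers *)

Lemma iter_primitive0_holomorphic (h : C -> C) (m : nat) :
  holomorphic h -> holomorphic (Nat.iter m primitive0 h).
Proof.
  intros H. induction m as [|m IH]; [exact H|]. intros z Hz.
  exists (Nat.iter m primitive0 h z). exact (primitive0_deriv _ z IH Hz).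
Qed.

Lemma derive_n_iter_primitive0 (m : nat) (h : C -> C) (x : C) :
  holomorphic h -> disk x -> C_derive_n (Nat.iter m primitive0 h) m x = h x.
Proof.
  revert h x. induction m as [|m IH]; intros h x H Hx; [reflexivity|].
  change (C_derive (C_derive_n (Nat.iter (S m) primitive0 h) m) x = h x).
  rewrite Nat.iter_succ_r. apply cderiv_unique.
  apply (cderiv_ext_loc (primitive0 h) _ _ _ (1 - Cmod x)); [red in Hx; lra| |].
  - intros w Hw. symmetry. apply IH; [|now apply (disk_open x)].
    now apply (iter_primitive0_holomorphic h 1).
  - now apply primitive0_deriv.
Qed.

(** The [m]-th derivative of the test function [f_test] when [p = alpha] and
    [b = 2 alpha + m - 1]; other [p] occur when [g_test] is split. *)
Definition kernel (p b : R) (a x : C) : C :=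
  (RtoC (Rpower (defect a) p) / Cpower (1 - Cconj a * x) b)%C.

Definition kernel_deriv (p b : R) (a x : C) : C :=
  (RtoC b * Cconj a * kernel p b a x / (1 - Cconj a * x))%C.

Definition moebius (a x : C) : C := ((a - x) / (1 - Cconj a * x))%C.

Lemma affine_deriv (a b x : C) : cderiv (fun y => (b - a * y)%C) x (- a)%C.
Proof.
  apply cderiv_eq with (0 - a * 1)%C; [|ring].
  apply cderiv_minus; [apply cderiv_const|apply cderiv_scal, cderiv_id].
Qed.

Lemma cderiv_kernel (p b : R) (a x : C) : disk a -> disk x ->
  cderiv (kernel p b a) x (kernel_deriv p b a x).
Proof.
  intros Ha Hx.
  assert (D : disk (Cconj a * x)) by (apply Cmult_disk; [now apply Cconj_disk|exact Hx]).
  assert (N := kernel_neq_0 a x Ha Hx). assert (NP := Cpower_neq_0 (1 - Cconj a * x) b).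
  eapply cderiv_eq.
  - apply (cderiv_scal (RtoC (Rpower (defect a) p)) (fun y => / Cpower (1 - Cconj a * y) b)%C).
    apply (cderiv_inv (fun y => Cpower (1 - Cconj a * y) b)); [exact NP|].
    apply (cderiv_comp (fun y => Cpower (1 - y) b) (fun y => (Cconj a * y)%C)).
    + now apply Cpower_one_minus_deriv.
    + apply cderiv_scal, cderiv_id.
  - unfold kernel_deriv, kernel. field. split; assumption.
Qed.

Lemma kernel_holomorphic (p b : R) (a : C) : disk a -> holomorphic (kernel p b a).
Proof. intros Ha x Hx. eexists. exact (cderiv_kernel p b a x Ha Hx). Qed.

Lemma kernel_moebius_holomorphic (p b : R) (a : C) : disk a ->
  holomorphic (fun x => (kernel p b a x * moebius a x)%C).
Proof.
  intros Ha x Hx. eexists.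
  apply (cderiv_mult (kernel p b a) (moebius a)); [now apply cderiv_kernel|].
  apply (cderiv_mult (fun y => (a - y)%C) (fun y => (/ (1 - Cconj a * y))%C)).
  - apply cderiv_minus; [apply cderiv_const|apply cderiv_id].
  - apply (cderiv_inv (fun y => (1 - Cconj a * y)%C)); [now apply kernel_neq_0|apply affine_deriv].
Qed.

Lemma f_test_derive_n (m : nat) (alpha : R) (a x : C) : disk a -> disk x ->
  C_derive_n (f_test m alpha a) m x = kernel alpha (2 * alpha + INR m - 1) a x.
Proof.
  intros Ha Hx.
  apply (derive_n_iter_primitive0 m (kernel alpha (2 * alpha + INR m - 1) a)); [|exact Hx].
  now apply kernel_holomorphic.
Qed.

Lemma g_test_derive_n (m : nat) (alpha : R) (a x : C) : disk a -> disk x ->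
  C_derive_n (g_test m alpha a) m x =
  (kernel alpha (2 * alpha + INR m - 1) a x * moebius a x)%C.
Proof.
  intros Ha Hx.
  apply (derive_n_iter_primitive0 m
    (fun x => kernel alpha (2 * alpha + INR m - 1) a x * moebius a x)%C); [|exact Hx].
  now apply kernel_moebius_holomorphic.
Qed.

(** The decay that the power condition provides, with a separate value at 0, where
    [n^-s] has none. *)
Definition power_decay (K s : R) (n : nat) : R :=
  match n with O => K | S _ => K / Rpower (INR n) s end.

Lemma power_decay_le (K s : R) (n : nat) : 0 <= K -> 0 < s -> power_decay K s n <= K.
Proof.
  intros HK Hs. destruct n as [|n]; [apply Rle_refl|]. unfold power_decay.
  assert (1 <= INR (S n)) by (rewrite S_INR; generalize (pos_INR n); lra).
  assert (1 <= Rpower (INR (S n)) s).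
  { rewrite <- (Rpower_1_base s). apply Rle_Rpower_l; lra. }
  apply Rmult_le_reg_r with (Rpower (INR (S n)) s); [lra|].
  unfold Rdiv. rewrite Rmult_assoc, Rinv_l by lra. nra.
Qed.

Lemma power_condition_decay (s : R) (v : C -> R) (u1 u2 phi1 phi2 : C -> C) :
  (forall z, disk z -> 0 < v z) -> power_condition s v phi1 u1 phi2 u2 ->
  exists K, 0 <= K /\ forall n z, disk z ->
    Cmod (weighted_value v u1 z * phi1 z ^ n - weighted_value v u2 z * phi2 z ^ n)
    <= power_decay K s n.
Proof.
  intros Hv [Fin Fsup].
  set (d := fun n z => (u1 z * phi1 z ^ n - u2 z * phi2 z ^ n)%C) in *.
  set (top := Sup_seq (fun n => Rbar_mult (nat_Rpower n s) (norm_v v (d n)))) in *.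
  assert (US : forall n, Rbar_le (Rbar_mult (nat_Rpower n s) (norm_v v (d n))) top).
  { intros n. unfold top. rewrite Rbar_sup_eq_lub. apply Rbar_lub_correct. now exists n. }
  change (Rbar_lt top p_infty) in Fsup. clearbody top.
  destruct (proj1 (norm_v_finite _ _) (Fin 0%nat)) as [K0 HK0].
  assert (SK : exists y : R, forall x : R, Rbar_le x top -> x <= y).
  { destruct top as [y| |]; [exists y; easy|contradiction|exists 0; easy]. }
  destruct SK as [y SK]. set (K := Rmax (Rmax K0 0) y).
  exists K. split; [unfold K; eapply Rle_trans; [|apply Rmax_l]; apply Rmax_r|].
  intros n z Hz. assert (Hvz := Rlt_le _ _ (Hv z Hz)).
  rewrite <- weighted_power_diff by exact Hvz.
  destruct n as [|n].
  - cbn [power_decay]. apply Rle_trans with K0; [exact (HK0 z Hz)|].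
    unfold K. eapply Rle_trans; [|apply Rmax_l]. apply Rmax_l.
  - unfold power_decay. set (w := Rpower (INR (S n)) s). assert (Pw : 0 < w) by apply Rpower_pos.
    specialize (US (S n)).
    specialize (Fin (S n)). change (Rbar_lt (norm_v v (d (S n))) p_infty) in Fin.
    assert (NN := norm_v_nonneg v (d (S n)) Hv).
    assert (B : Rbar_le (Finite (v z * Cmod (d (S n) z))) (norm_v v (d (S n)))).
    { now apply (sup_disk_ge (fun z => Finite (v z * Cmod (d (S n) z)))). }
    change (nat_Rpower (S n) s) with w in US.
    destruct (norm_v v (d (S n))) as [x| |]; try contradiction.
    change (v z * Cmod (d (S n) z) <= x) in B.
    change (Rbar_le (w * x) top) in US.
    assert (Bx : w * x <= K).
    { unfold K. eapply Rle_trans; [|apply Rmax_r]. apply SK, US. }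
    apply Rle_trans with x; [exact B|].
    apply Rmult_le_reg_l with w; [exact Pw|].
    replace (w * (K / w)) with K by (field; lra). exact Bx.
Qed.

Definition growth_const (p s : R) : R := (1 + s / p) * exp s.

Lemma growth_const_ge_1 (p s : R) : 0 < p -> 0 < s -> 1 <= growth_const p s.
Proof.
  intros Hp Hs. unfold growth_const.
  assert (0 < s / p) by now apply Rdiv_lt_0_compat.
  assert (1 + s <= exp s) by apply exp_ineq1_le. nra.
Qed.

Lemma binom_coef_decay (p s K : R) (k : nat) : 0 < p -> 0 < s -> 0 <= K ->
  binom_coef (p + s) k * power_decay K s k <= K * growth_const p s * binom_coef p k.
Proof.
  intros Hp Hs HK. destruct k as [|k].
  - cbn [binom_coef power_decay]. assert (G := growth_const_ge_1 p s Hp Hs). nra.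
  - unfold power_decay. set (w := Rpower (INR (S k)) s). assert (Pw : 0 < w) by apply Rpower_pos.
    assert (G := binom_coef_growth p s k Hp Hs). fold w in G. fold (growth_const p s) in G.
    apply Rle_trans with (growth_const p s * w * binom_coef p (S k) * (K / w)).
    + apply Rmult_le_compat_r; [apply Rdiv_le_0_compat; lra|exact G].
    + right. field. lra.
Qed.

(** Summing the termwise bound [binom_coef_decay] gives a multiple of
    [(1 - |a|)^-p], which the factor [defect(a)^p] of the kernel absorbs. *)
Lemma kernel_difference (p s K : R) (l1 l2 a x1 x2 : C) :
  0 < p -> 0 < s -> 0 <= K -> disk a -> disk x1 -> disk x2 ->
  (forall n, Cmod (l1 * x1 ^ n - l2 * x2 ^ n) <= power_decay K s n) ->
  Cmod (l1 * kernel p (p + s) a x1 - l2 * kernel p (p + s) a x2)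
  <= K * growth_const p s * Rpower 2 p.
Proof.
  intros Hp Hs HK Ha H1 H2 HB.
  assert (Da := Cconj_disk a Ha).
  destruct (defect_bounds a Ha) as [[La Ua] Pa]. assert (Ta := defect_le_two a Ha).
  set (r := Cmod a) in *. assert (Hr : 0 <= r < 1) by (split; [apply Cmod_ge_0|exact Ha]).
  assert (G := growth_const_ge_1 p s Hp Hs).
  set (L := K * growth_const p s). assert (PL : 0 <= L) by (unfold L; nra).
  assert (W : Rpower (defect a) p <= Rpower 2 p * Rpower (1 - r) p).
  { rewrite <- Rpower_scale by lra. apply Rle_Rpower_l; lra. }
  assert (Pw := Rpower_pos (defect a) p). assert (P1 := Rpower_pos (1 - r) p).
  assert (Comb : Cmod (l1 / Cpower (1 - Cconj a * x1) (p + s) - l2 / Cpower (1 - Cconj a * x2) (p + s))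
    <= L * Rpower (1 - r) (- p)).
  { apply binom_combination with (B := power_decay K s); try assumption; [lra|].
    intros N. rewrite Cmod_conj. fold r.
    apply Rle_trans with (sum_f_R0 (fun k => binom_coef p k * r ^ k * L) N).
    - apply sum_Rle. intros k _.
      replace (binom_coef (p + s) k * r ^ k * power_decay K s k)
        with (r ^ k * (binom_coef (p + s) k * power_decay K s k)) by ring.
      replace (binom_coef p k * r ^ k * L) with (r ^ k * (L * binom_coef p k)) by ring.
      apply Rmult_le_compat_l; [apply pow_le; lra|]. now apply binom_coef_decay.
    - rewrite <- scal_sum. apply Rmult_le_compat_l; [exact PL|].
      apply (binom_sum_R_bound p N r); lra. }
  replace (l1 * kernel p (p + s) a x1 - l2 * kernel p (p + s) a x2)%C
    with (RtoC (Rpower (defect a) p) *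
      (l1 / Cpower (1 - Cconj a * x1) (p + s) - l2 / Cpower (1 - Cconj a * x2) (p + s)))%C
    by (unfold kernel, Cdiv; ring).
  rewrite Cmod_mult, Cmod_R, Rabs_pos_eq by lra.
  apply Rle_trans with (Rpower 2 p * Rpower (1 - r) p * (L * Rpower (1 - r) (- p))).
  - apply Rmult_le_compat; [lra|apply Cmod_ge_0|exact W|exact Comb].
  - rewrite Rpower_Ropp. right. field. lra.
Qed.

Lemma defect_conj (a : C) : RtoC (defect a) = (1 - Cconj a * a)%C.
Proof. unfold defect. rewrite RtoC_minus, Cmod2_conj. ring. Qed.

(** The identity [(a - x) / (1 - conj a x) = (1 - defect a / (1 - conj a x)) / conj a]
    writes the second kernel as a difference of kernels of the first type.  Near
    [a = 0], where this degenerates, the coefficients are summable without any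
    decay of the powers. *)
Lemma kernel_moebius_difference (p s K : R) (l1 l2 a x1 x2 : C) :
  0 < p -> 0 < s -> 0 <= K -> disk a -> disk x1 -> disk x2 ->
  (forall n, Cmod (l1 * x1 ^ n - l2 * x2 ^ n) <= power_decay K s n) ->
  Cmod (l1 * (kernel p (p + s) a x1 * moebius a x1) - l2 * (kernel p (p + s) a x2 * moebius a x2))
  <= 2 * (K * growth_const p s * Rpower 2 p + K * growth_const (p + 1) s * Rpower 2 (p + 1))
     + 2 * K * Rpower 2 (p + s + 1).
Proof.
  intros Hp Hs HK Ha H1 H2 HB.
  assert (G1 := growth_const_ge_1 p s Hp Hs).
  assert (G2 := growth_const_ge_1 (p + 1) s ltac:(lra) Hs).
  assert (Q1 := Rpower_pos 2 p). assert (Q2 := Rpower_pos 2 (p + 1)).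
  assert (Q3 := Rpower_pos 2 (p + s + 1)).
  assert (Z1 : 0 <= K * growth_const p s * Rpower 2 p) by (apply Rmult_le_pos; nra).
  assert (Z2 : 0 <= K * growth_const (p + 1) s * Rpower 2 (p + 1)) by (apply Rmult_le_pos; nra).
  assert (Z3 : 0 <= 2 * K * Rpower 2 (p + s + 1)) by (apply Rmult_le_pos; nra).
  destruct (defect_bounds a Ha) as [[La Ua] Pa].
  assert (Split : forall x, disk x -> Cpower (1 - Cconj a * x) (p + s + 1)
     = (Cpower (1 - Cconj a * x) (p + s) * (1 - Cconj a * x))%C).
  { intros x Hx. rewrite Cpower_plus, Cpower_1; [reflexivity|].
    apply Re_one_minus, Cmult_disk; [now apply Cconj_disk|exact Hx]. }
  destruct (Rle_lt_dec (/ 2) (Cmod a)) as [Far|Near].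
  - assert (Na : a <> 0) by (apply Cmod_gt_0; lra).
    assert (Nca : Cconj a <> 0) by (apply Cmod_gt_0; rewrite Cmod_conj; lra).
    assert (D1 := kernel_difference p s K l1 l2 a x1 x2 Hp Hs HK Ha H1 H2 HB).
    assert (D2 := kernel_difference (p + 1) s K l1 l2 a x1 x2 ltac:(lra) Hs HK Ha H1 H2 HB).
    assert (Rw : forall x, disk x -> (kernel p (p + s) a x * moebius a x =
      / Cconj a * (kernel p (p + s) a x - kernel (p + 1) (p + 1 + s) a x))%C).
    { intros x Hx. unfold kernel, moebius.
      replace (p + 1 + s) with (p + s + 1) by ring.
      rewrite Split, Rpower_plus, Rpower_1, RtoC_mult, defect_conj by assumption.
      assert (N1 := kernel_neq_0 a x Ha Hx). assert (N2 := Cpower_neq_0 (1 - Cconj a * x) (p + s)).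
      field. repeat split; assumption. }
    rewrite !Rw by assumption.
    match goal with |- Cmod ?e <= _ => replace e with
      (/ Cconj a * ((l1 * kernel p (p + s) a x1 - l2 * kernel p (p + s) a x2)
       - (l1 * kernel (p + 1) (p + 1 + s) a x1 - l2 * kernel (p + 1) (p + 1 + s) a x2)))%C by ring end.
    rewrite Cmod_mult, Cmod_inv, Cmod_conj by exact Nca.
    assert (I2 : / Cmod a <= 2).
    { rewrite <- (Rinv_inv 2). apply Rinv_le_contravar; lra. }
    assert (I0 : 0 < / Cmod a) by (apply Rinv_0_lt_compat; lra).
    match goal with |- _ * Cmod ?e <= _ => assert (T : Cmod e <=
      K * growth_const p s * Rpower 2 p + K * growth_const (p + 1) s * Rpower 2 (p + 1)) end.
    { eapply Rle_trans; [apply Cmod_triangle|]. rewrite Cmod_opp. lra. }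
    eapply Rle_trans; [apply Rmult_le_compat; [lra|apply Cmod_ge_0|exact I2|exact T]|]. lra.
  - set (r := Cmod a) in *. assert (Pr : 0 <= r) by apply Cmod_ge_0.
    assert (Comb : Cmod (l1 * (a - x1) / Cpower (1 - Cconj a * x1) (p + s + 1)
        - l2 * (a - x2) / Cpower (1 - Cconj a * x2) (p + s + 1)) <= 2 * K * Rpower 2 (p + s + 1)).
    { apply binom_combination with (B := fun _ => 2 * K); try assumption.
      - lra.
      - now apply Cconj_disk.
      - intros k.
        replace (l1 * (a - x1) * x1 ^ k - l2 * (a - x2) * x2 ^ k)%C
          with (a * (l1 * x1 ^ k - l2 * x2 ^ k) - (l1 * x1 ^ S k - l2 * x2 ^ S k))%C
          by (rewrite !Cpow_S; ring).
        eapply Rle_trans; [apply Cmod_triangle|]. rewrite Cmod_opp, Cmod_mult. fold r.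
        assert (B1 := HB k). assert (B2 := HB (S k)).
        assert (L1 := power_decay_le K s k HK Hs). assert (L2 := power_decay_le K s (S k) HK Hs).
        assert (P := Cmod_ge_0 (l1 * x1 ^ k - l2 * x2 ^ k)). nra.
      - intros N. rewrite Cmod_conj. fold r. rewrite <- scal_sum.
        apply Rmult_le_compat_l; [lra|].
        eapply Rle_trans; [apply (binom_sum_R_bound (p + s + 1) N r); lra|].
        rewrite Rpower_Ropp.
        replace (Rpower 2 (p + s + 1)) with (/ Rpower (/ 2) (p + s + 1)).
        + apply Rinv_le_contravar; [apply Rpower_pos|]. apply Rle_Rpower_l; lra.
        + rewrite <- Rpower_Ropp. unfold Rpower. rewrite ln_Rinv by lra. f_equal. ring. }
    assert (Rw : forall l x, disk x -> (l * (kernel p (p + s) a x * moebius a x) =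
      RtoC (Rpower (defect a) p) * (l * (a - x) / Cpower (1 - Cconj a * x) (p + s + 1)))%C).
    { intros l x Hx. unfold kernel, moebius. rewrite Split by exact Hx.
      assert (N1 := kernel_neq_0 a x Ha Hx). assert (N2 := Cpower_neq_0 (1 - Cconj a * x) (p + s)).
      field. repeat split; assumption. }
    rewrite !Rw by assumption.
    match goal with |- Cmod (?c * ?x - ?c * ?y)%C <= _ =>
      replace (c * x - c * y)%C with (c * (x - y))%C by ring end.
    assert (Pw := Rpower_pos (defect a) p).
    rewrite Cmod_mult, Cmod_R, Rabs_pos_eq by lra.
    assert (W1 : Rpower (defect a) p <= 1).
    { rewrite <- (Rpower_1_base p). apply Rle_Rpower_l; lra. }
    eapply Rle_trans; [apply Rmult_le_compat; [lra|apply Cmod_ge_0|exact W1|exact Comb]|]. lra.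
Qed.

(** * Recovering the symbols from the test functions *)

(** [Tcal] at a point, as a function of the value [l = v u] and the image [x]. *)
Definition normalized (s : R) (l x : C) : C := (l / RtoC (Rpower (defect x) s))%C.

(** Both [1 - |a|^2] and [1 - |x|^2] are at most [2 |1 - conj a x|]. *)
Lemma kernel_size (p b s : R) (a x : C) : 0 < p -> 0 < s -> p + s = b -> disk a -> disk x ->
  Rpower (defect x) s * Cmod (kernel p b a x) <= Rpower 2 b.
Proof.
  intros Hp Hs <- Ha Hx. unfold kernel.
  destruct (kernel_lower a x Ha Hx) as [K1 [K2 K3]]. set (k := Cmod (1 - Cconj a * x)) in *.
  destruct (defect_bounds a Ha) as [_ Pa]. assert (Ta := defect_le_two a Ha).
  destruct (defect_bounds x Hx) as [_ Px]. assert (Tx := defect_le_two x Hx).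
  rewrite Cmod_div by apply Cpower_neq_0. rewrite Cmod_Cpower. fold k.
  rewrite Cmod_R, Rabs_pos_eq by apply Rlt_le, Rpower_pos.
  assert (Pk := Rpower_pos k (p + s)).
  apply Rmult_le_reg_r with (Rpower k (p + s)); [exact Pk|].
  replace (Rpower (defect x) s * (Rpower (defect a) p / Rpower k (p + s)) * Rpower k (p + s))
    with (Rpower (defect a) p * Rpower (defect x) s) by (field; lra).
  rewrite <- Rpower_scale by lra. rewrite Rpower_plus.
  apply Rmult_le_compat; try (apply Rlt_le, Rpower_pos); apply Rle_Rpower_l; lra.
Qed.

Lemma kernel_deriv_size (p b s : R) (a x : C) : 0 < p -> 0 < s -> p + s = b -> disk a -> disk x ->
  Rpower (defect x) (s + 1) * Cmod (kernel_deriv p b a x) <= b * (2 * Rpower 2 b).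
Proof.
  intros Hp Hs E Ha Hx. unfold kernel_deriv.
  assert (KS := kernel_size p b s a x Hp Hs E Ha Hx).
  destruct (kernel_lower a x Ha Hx) as [K1 [K2 K3]].
  destruct (defect_bounds x Hx) as [_ Px]. assert (Tx := defect_le_two x Hx).
  rewrite Cmod_div by now apply kernel_neq_0.
  set (k := Cmod (1 - Cconj a * x)) in *.
  rewrite !Cmod_mult, Cmod_R, Cmod_conj, Rabs_pos_eq by lra.
  rewrite Rpower_plus, Rpower_1 by exact Px.
  assert (Pa := Cmod_ge_0 a). assert (La : Cmod a < 1) by exact Ha.
  set (t := Cmod (kernel p b a x)) in *. assert (Pt : 0 <= t) by apply Cmod_ge_0.
  assert (Pw := Rpower_pos (defect x) s). set (w := Rpower (defect x) s) in *.
  assert (Q : defect x / k <= 2).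
  { apply Rmult_le_reg_r with k; [exact K3|].
    replace (defect x / k * k) with (defect x) by (field; lra). lra. }
  assert (Q0 : 0 <= defect x / k) by (apply Rdiv_le_0_compat; lra).
  replace (w * defect x * (b * Cmod a * t / k)) with (b * ((Cmod a * (defect x / k)) * (w * t)))
    by (field; lra).
  apply Rmult_le_compat_l; [lra|].
  apply Rmult_le_compat; [nra|nra|nra|exact KS].
Qed.

Lemma normalized_mult (s : R) (l x y : C) :
  (l * y = normalized s l x * (RtoC (Rpower (defect x) s) * y))%C.
Proof.
  unfold normalized. field. intros E. apply RtoC_inj in E.
  assert (P := Rpower_pos (defect x) s). lra.
Qed.

Lemma kernel_diag (p s : R) (a : C) : disk a ->
  (RtoC (Rpower (defect a) s) * kernel p (p + s) a a)%C = 1.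
Proof.
  intros Ha. destruct (defect_bounds a Ha) as [_ P].
  unfold kernel. rewrite <- defect_conj, Cpower_R, Rpower_plus, RtoC_mult by exact P.
  assert (P1 := Rpower_pos (defect a) p). assert (P2 := Rpower_pos (defect a) s).
  field. split; intros E; apply RtoC_inj in E; lra.
Qed.

Lemma Cmod_moebius (a x : C) : Cmod (moebius a x) = rho x a.
Proof.
  unfold moebius, rho. rewrite <- Cmod_opp. f_equal. unfold Cdiv. ring.
Qed.

Lemma rho_refl (a : C) : rho a a = 0.
Proof. unfold rho, Cdiv. replace ((a - a) * / (1 - Cconj a * a))%C with (RtoC 0) by ring. apply Cmod_0. Qed.

(** [X] is the normalized kernel with pole parameter [x1] at [x2]; its value at [x1]
    is 1, so [weighted_lipschitz] bounds [X - 1].  The first kernel gives the bound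
    on [T_1 - T_2 X], the second, which vanishes at [x1], the bound on
    [|T_2 X| rho]. *)
Lemma test_at_first_point (p s K : R) (l1 l2 x1 x2 : C) :
  0 < p -> 0 < s -> disk x1 -> disk x2 ->
  Cmod (l1 * kernel p (p + s) x1 x1 - l2 * kernel p (p + s) x1 x2) <= K ->
  Cmod (l1 * (kernel p (p + s) x1 x1 * moebius x1 x1)
        - l2 * (kernel p (p + s) x1 x2 * moebius x1 x2)) <= K ->
  exists X, Cmod (normalized s l1 x1 - normalized s l2 x2 * X) <= K /\
    Cmod (normalized s l1 x1) * rho x1 x2 <= 2 * K /\
    Cmod (X - 1) <= lipschitz_const s * (Rpower 2 (p + s) + (p + s) * (2 * Rpower 2 (p + s))) * rho x1 x2.
Proof.
  intros Hp Hs H1 H2 HF HG.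
  set (X := (RtoC (Rpower (defect x2) s) * kernel p (p + s) x1 x2)%C).
  assert (EX : Cmod (normalized s l1 x1 - normalized s l2 x2 * X) <= K).
  { rewrite (normalized_mult s l1 x1), (normalized_mult s l2 x2), kernel_diag in HF by exact H1.
    fold X in HF. rewrite Cmult_1_r in HF. exact HF. }
  exists X. split; [exact EX|]. split.
  - assert (G : Cmod (normalized s l2 x2 * X) * rho x1 x2 <= K).
    { rewrite (rho_sym x1 x2), <- Cmod_moebius, <- Cmod_mult by assumption.
      replace (moebius x1 x1) with (RtoC 0) in HG.
      2: { symmetry. apply Cmod_eq_0. rewrite Cmod_moebius. apply rho_refl. }
      rewrite <- Cmod_opp in HG.
      match type of HG with Cmod ?e <= _ =>
        replace e with (l2 * kernel p (p + s) x1 x2 * moebius x1 x2)%C in HG by ring end.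
      rewrite (normalized_mult s l2 x2) in HG. fold X in HG. exact HG. }
    assert (R0 := rho_ge_0 x1 x2). assert (R1 := rho_le_1 x1 x2 H1 H2).
    assert (T : Cmod (normalized s l1 x1) <=
      Cmod (normalized s l1 x1 - normalized s l2 x2 * X) + Cmod (normalized s l2 x2 * X)).
    { eapply Rle_trans; [|apply Cmod_triangle]. right. f_equal. ring. }
    assert (PK : 0 <= K) by (eapply Rle_trans; [apply Cmod_ge_0|exact EX]).
    apply Rle_trans with ((Cmod (normalized s l1 x1 - normalized s l2 x2 * X)
      + Cmod (normalized s l2 x2 * X)) * rho x1 x2); [now apply Rmult_le_compat_r|].
    assert (Cmod (normalized s l1 x1 - normalized s l2 x2 * X) * rho x1 x2 <= K * 1)
      by (apply Rmult_le_compat; try assumption; apply Cmod_ge_0).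
    lra.
  - rewrite <- (kernel_diag p s x1 H1). unfold X. rewrite (rho_sym x1 x2) by assumption.
    apply (weighted_lipschitz s _ _ (kernel p (p + s) x1) (kernel_deriv p (p + s) x1));
      try assumption.
    + intros; now apply cderiv_kernel.
    + intros; now apply (kernel_size p (p + s) s).
    + intros; now apply (kernel_deriv_size p (p + s) s).
Qed.

Definition symbol_const (p s : R) : R :=
  1 + 2 * (lipschitz_const s * (Rpower 2 (p + s) + (p + s) * (2 * Rpower 2 (p + s)))).

Lemma lipschitz_const_pos (s : R) : 0 < s -> 0 < lipschitz_const s.
Proof.
  intros Hs. unfold lipschitz_const. assert (P1 := Rpower_pos 5 s).
  assert (P2 := Rpower_pos (5 / 3) s). nra.
Qed.

Lemma test_points (p s K : R) (l1 l2 x1 x2 : C) :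
  0 < p -> 0 < s -> disk x1 -> disk x2 ->
  (forall a, disk a ->
    Cmod (l1 * kernel p (p + s) a x1 - l2 * kernel p (p + s) a x2) <= K /\
    Cmod (l1 * (kernel p (p + s) a x1 * moebius a x1)
          - l2 * (kernel p (p + s) a x2 * moebius a x2)) <= K) ->
  Cmod (normalized s l1 x1) * rho x1 x2 <= 2 * K /\
  Cmod (normalized s l2 x2) * rho x1 x2 <= 2 * K /\
  Cmod (normalized s l1 x1 - normalized s l2 x2) <= symbol_const p s * K.
Proof.
  intros Hp Hs H1 H2 HT.
  assert (Sw : forall x y : C, Cmod (x - y) = Cmod (y - x)).
  { intros x y. rewrite <- Cmod_opp. f_equal. ring. }
  destruct (HT x1 H1) as [F1 G1]. destruct (HT x2 H2) as [F2 G2].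
  rewrite Sw in F2, G2.
  destruct (test_at_first_point p s K l1 l2 x1 x2 Hp Hs H1 H2 F1 G1) as [X [A1 [A2 A3]]].
  destruct (test_at_first_point p s K l2 l1 x2 x1 Hp Hs H2 H1 F2 G2) as [Y [_ [B2 _]]].
  rewrite (rho_sym x2 x1) in B2 by assumption.
  split; [exact A2|]. split; [exact B2|].
  set (c := lipschitz_const s * (Rpower 2 (p + s) + (p + s) * (2 * Rpower 2 (p + s)))) in *.
  assert (Pc : 0 <= c).
  { assert (L := lipschitz_const_pos s Hs). assert (Q := Rpower_pos 2 (p + s)).
    unfold c. apply Rmult_le_pos; [lra|]. nra. }
  replace (normalized s l1 x1 - normalized s l2 x2)%C
    with ((normalized s l1 x1 - normalized s l2 x2 * X) + normalized s l2 x2 * (X - 1))%C by ring.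
  eapply Rle_trans; [apply Cmod_triangle|]. rewrite Cmod_mult.
  assert (D : Cmod (normalized s l2 x2) * Cmod (X - 1) <= c * (2 * K)).
  { apply Rle_trans with (Cmod (normalized s l2 x2) * (c * rho x1 x2)).
    - apply Rmult_le_compat_l; [apply Cmod_ge_0|exact A3].
    - replace (Cmod (normalized s l2 x2) * (c * rho x1 x2))
        with (c * (Cmod (normalized s l2 x2) * rho x1 x2)) by ring.
      now apply Rmult_le_compat_l. }
  unfold symbol_const. fold c. lra.
Qed.

(** * Boundedness from the symbols *)

(** For [m = 0] the value of [f] itself has to be controlled; then [s > 0] says
    [alpha > 1], as [radial_growth] requires.  For [m > 0] both bounds are instances
    of [derive_n_growth]. *)
Lemma Bloch_derivative_growth (m : nat) (alpha : R) :
  0 < alpha -> 0 < alpha + INR m - 1 -> exists A, 0 <= A /\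
  forall f N, holomorphic f -> Cmod (f 0) <= N ->
  (forall z, disk z -> Rpower (defect z) alpha * Cmod (C_derive f z) <= N) ->
  forall z, disk z ->
    Rpower (defect z) (alpha + INR m - 1) * Cmod (C_derive_n f m z) <= A * N /\
    Rpower (defect z) (alpha + INR m - 1 + 1) * Cmod (C_derive_n f (S m) z) <= A * N.
Proof.
  intros Ha Hs. destruct m as [|m].
  - cbn [INR] in *.
    set (c := Rpower 2 (alpha - 1) / (alpha - 1)).
    assert (Pc : 0 < c) by (apply Rdiv_lt_0_compat; [apply Rpower_pos|lra]).
    exists (1 + c). split; [lra|]. intros f N Hf H0 HN z Hz.
    assert (PN : 0 <= N) by (eapply Rle_trans; [apply Cmod_ge_0|exact H0]).
    replace (alpha + 0 - 1) with (alpha - 1) by ring.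
    replace (alpha - 1 + 1) with alpha by ring. split.
    + eapply Rle_trans; [apply (radial_growth f alpha N); [lra|assumption|assumption|exact Hz]|].
      replace (Rpower 2 (alpha - 1) * (N / (alpha - 1))) with (c * N) by (unfold c; field; lra). lra.
    + eapply Rle_trans; [apply (HN z Hz)|]. nra.
  - destruct (derive_n_growth alpha m Ha) as [A1 [P1 B1]].
    destruct (derive_n_growth alpha (S m) Ha) as [A2 [P2 B2]].
    exists (A1 + A2). split; [lra|]. intros f N Hf H0 HN z Hz.
    assert (PN : 0 <= N) by (eapply Rle_trans; [apply Cmod_ge_0|exact H0]).
    specialize (B1 f N Hf HN z Hz). specialize (B2 f N Hf HN z Hz).
    replace (alpha + INR (S m) - 1 + 1) with (alpha + INR (S m)) by ring.
    rewrite S_INR in *.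
    replace (alpha + (INR m + 1) - 1) with (alpha + INR m) by ring.
    assert (0 <= A1 * N) by nra. assert (0 <= A2 * N) by nra.
    split; lra.
Qed.

(** [T_1 F(x_1) - T_2 F(x_2) = T_1 (F(x_1) - F(x_2)) + (T_1 - T_2) F(x_2)] with
    [F = defect^s f^(m)]. *)
Lemma symbols_bound_operator (m : nat) (alpha : R) :
  0 < alpha -> 0 < alpha + INR m - 1 -> exists A, 0 <= A /\
  forall f N l1 l2 x1 x2 M, holomorphic f -> Cmod (f 0) <= N ->
  (forall z, disk z -> Rpower (defect z) alpha * Cmod (C_derive f z) <= N) ->
  disk x1 -> disk x2 ->
  Cmod (normalized (alpha + INR m - 1) l1 x1) * rho x1 x2 <= M ->
  Cmod (normalized (alpha + INR m - 1) l1 x1 - normalized (alpha + INR m - 1) l2 x2) <= M ->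
  Cmod (l1 * C_derive_n f m x1 - l2 * C_derive_n f m x2) <= A * M * N.
Proof.
  intros Ha Hs. destruct (Bloch_derivative_growth m alpha Ha Hs) as [A [PA HA]].
  set (s := alpha + INR m - 1) in *.
  assert (PL := lipschitz_const_pos s Hs).
  exists (2 * A * lipschitz_const s + A). split; [nra|].
  intros f N l1 l2 x1 x2 M Hf H0 HN H1 H2 HM HD.
  specialize (HA f N Hf H0 HN).
  set (h := C_derive_n f m) in *.
  assert (Lip : Cmod (RtoC (Rpower (defect x1) s) * h x1 - RtoC (Rpower (defect x2) s) * h x2)
    <= lipschitz_const s * (A * N + A * N) * rho x1 x2).
  { apply (weighted_lipschitz s (A * N) (A * N) h (C_derive h)); try assumption.
    - intros x Hx. apply holomorphic_cderiv; [|exact Hx]. now apply holomorphic_derive_n.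
    - intros x Hx. now apply HA.
    - intros x Hx. now apply (HA x Hx). }
  rewrite (normalized_mult s l1 x1), (normalized_mult s l2 x2).
  destruct (HA x2 H2) as [S2 _].
  set (F1 := (RtoC (Rpower (defect x1) s) * h x1)%C) in *.
  set (F2 := (RtoC (Rpower (defect x2) s) * h x2)%C) in *.
  assert (S2' : Cmod F2 <= A * N).
  { unfold F2. rewrite Cmod_mult, Cmod_R, Rabs_pos_eq; [exact S2|apply Rlt_le, Rpower_pos]. }
  set (T1 := normalized s l1 x1) in *. set (T2 := normalized s l2 x2) in *.
  replace (T1 * F1 - T2 * F2)%C with (T1 * (F1 - F2) + (T1 - T2) * F2)%C by ring.
  eapply Rle_trans; [apply Cmod_triangle|]. rewrite !Cmod_mult.
  assert (PN : 0 <= N) by (eapply Rle_trans; [apply Cmod_ge_0|exact H0]).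
  assert (E1 : Cmod T1 * Cmod (F1 - F2) <= lipschitz_const s * (A * N + A * N) * M).
  { apply Rle_trans with (Cmod T1 * (lipschitz_const s * (A * N + A * N) * rho x1 x2)).
    - apply Rmult_le_compat_l; [apply Cmod_ge_0|exact Lip].
    - replace (Cmod T1 * (lipschitz_const s * (A * N + A * N) * rho x1 x2))
        with (lipschitz_const s * (A * N + A * N) * (Cmod T1 * rho x1 x2)) by ring.
      apply Rmult_le_compat_l; [|exact HM].
      apply Rmult_le_pos; [lra|]. nra. }
  assert (E2 : Cmod (T1 - T2) * Cmod F2 <= M * (A * N))
    by (apply Rmult_le_compat; try assumption; apply Cmod_ge_0).
  lra.
Qed.

(** * The equivalence *)

Lemma sup_norm_v_finite (v : C -> R) (T : C -> C -> C) :
  Rbar_lt (sup_disk (fun a => norm_v v (T a))) p_infty <->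
  exists K : R, forall a z, disk a -> disk z -> v z * Cmod (T a z) <= K.
Proof.
  rewrite sup_disk_finite. split; intros [K HK]; exists K.
  - intros a z Ha Hz. exact (proj1 (norm_v_le v (T a) K) (HK a Ha) z Hz).
  - intros a Ha. apply norm_v_le. intros z Hz. now apply HK.
Qed.

Theorem theorem2p4 :
  forall (m : nat) (alpha : R) (v : C -> R) (u1 u2 phi1 phi2 : C -> C),
  0 < alpha ->
  0 < alpha + INR m - 1 ->
  weight v ->
  holomorphic u1 -> holomorphic u2 ->
  self_map phi1 -> self_map phi2 ->
  let s := alpha + INR m - 1 in
  let D := wdc_diff m phi1 u1 phi2 u2 in
  let T1 := Tcal s v phi1 u1 in
  let T2 := Tcal s v phi2 u2 in
  let r z := rho (phi1 z) (phi2 z) in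
  let sup_diff := sup_disk (fun z => Cmod (T1 z - T2 z)%C) in
  let i := bounded_Bloch_Hv alpha v D in
  let ii :=
    Rbar_lt (Rbar_plus (sup_disk (fun z => Cmod (T1 z) * r z)) sup_diff) p_infty /\
    Rbar_lt (Rbar_plus (sup_disk (fun z => Cmod (T2 z) * r z)) sup_diff) p_infty in
  let iii :=
    Rbar_lt (Rbar_plus (sup_disk (fun a => norm_v v (D (f_test m alpha a))))
                       (sup_disk (fun a => norm_v v (D (g_test m alpha a))))) p_infty in
  let iv := power_condition s v phi1 u1 phi2 u2 in
  (i <-> ii) /\ (ii <-> iii) /\ (iii <-> iv).
Proof.
  intros m alpha v u1 u2 phi1 phi2 Ha Hs [Hv _] Hu1 Hu2 Hp1 Hp2 s D T1 T2 r sup_diff i ii iii iv.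
  set (l1 := weighted_value v u1). set (l2 := weighted_value v u2).
  assert (Hv' : forall z, disk z -> 0 <= v z) by (intros; now apply Rlt_le, Hv).
  assert (Nf : forall (T : C -> C) z, disk z -> Rbar_le 0 (Finite (Cmod (T z) * r z))).
  { intros T z _. apply Rmult_le_pos; [apply Cmod_ge_0|apply rho_ge_0]. }
  assert (Eii : ii <-> exists K, forall z, disk z ->
    Cmod (T1 z) * r z <= K /\ Cmod (T2 z) * r z <= K /\ Cmod (T1 z - T2 z)%C <= K).
  { unfold ii.
    assert (P1 : Rbar_le 0 (sup_disk (fun z => Cmod (T1 z) * r z))) by (apply sup_disk_nonneg, Nf).
    assert (P2 : Rbar_le 0 (sup_disk (fun z => Cmod (T2 z) * r z))) by (apply sup_disk_nonneg, Nf).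
    assert (P3 : Rbar_le 0 sup_diff) by (apply sup_disk_nonneg; intros; apply Cmod_ge_0).
    rewrite !Rbar_plus_finite by assumption. unfold sup_diff. rewrite !sup_disk_finite. split.
    - intros [[[K1 B1] [K2 B2]] [[K3 B3] _]]. exists (Rmax K1 (Rmax K3 K2)). intros z Hz.
      specialize (B1 z Hz). specialize (B2 z Hz). specialize (B3 z Hz). cbn in B1, B2, B3.
      assert (M1 := Rmax_l K1 (Rmax K3 K2)). assert (M2 := Rmax_r K1 (Rmax K3 K2)).
      assert (M3 := Rmax_l K3 K2). assert (M4 := Rmax_r K3 K2).
      repeat split; lra.
    - intros [K B]. repeat split; exists K; intros z Hz; now apply B. }
  assert (Eiii : iii <-> exists K, forall a z, disk a -> disk z ->
    v z * Cmod (D (f_test m alpha a) z) <= K /\ v z * Cmod (D (g_test m alpha a) z) <= K).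
  { unfold iii. rewrite Rbar_plus_finite.
    - rewrite !sup_norm_v_finite. split.
      + intros [[K1 B1] [K2 B2]]. exists (Rmax K1 K2). intros a z Ha' Hz.
        assert (M1 := Rmax_l K1 K2). assert (M2 := Rmax_r K1 K2).
        specialize (B1 a z Ha' Hz). specialize (B2 a z Ha' Hz). split; lra.
      + intros [K B]. split; exists K; intros a z Ha' Hz; now apply B.
    - apply sup_disk_nonneg. intros a _. now apply norm_v_nonneg.
    - apply sup_disk_nonneg. intros a _. now apply norm_v_nonneg. }
  assert (Eb : 2 * alpha + INR m - 1 = alpha + s) by (unfold s; ring).
  assert (VF : forall a z, disk a -> disk z -> v z * Cmod (D (f_test m alpha a) z) =
    Cmod (l1 z * kernel alpha (alpha + s) a (phi1 z) - l2 z * kernel alpha (alpha + s) a (phi2 z))).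
  { intros a z Ha' Hz. unfold D. rewrite weighted_wdc_diff by now apply Hv'.
    rewrite !f_test_derive_n, Eb by (try apply Hp1; try apply Hp2; assumption). reflexivity. }
  assert (VG : forall a z, disk a -> disk z -> v z * Cmod (D (g_test m alpha a) z) =
    Cmod (l1 z * (kernel alpha (alpha + s) a (phi1 z) * moebius a (phi1 z))
          - l2 z * (kernel alpha (alpha + s) a (phi2 z) * moebius a (phi2 z)))).
  { intros a z Ha' Hz. unfold D. rewrite weighted_wdc_diff by now apply Hv'.
    rewrite !g_test_derive_n, Eb by (try apply Hp1; try apply Hp2; assumption). reflexivity. }
  assert (I_IV : i -> iv) by now apply bounded_implies_power.
  assert (IV_III : iv -> iii).
  { intros H. apply Eiii.
    destruct (power_condition_decay s v u1 u2 phi1 phi2 Hv H) as [K [PK HK]].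
    set (KF := K * growth_const alpha s * Rpower 2 alpha).
    set (KG := 2 * (K * growth_const alpha s * Rpower 2 alpha
        + K * growth_const (alpha + 1) s * Rpower 2 (alpha + 1)) + 2 * K * Rpower 2 (alpha + s + 1)).
    exists (Rmax KF KG). intros a z Ha' Hz.
    assert (D1 : disk (phi1 z)) by now apply Hp1. assert (D2 : disk (phi2 z)) by now apply Hp2.
    rewrite VF, VG by assumption. split.
    - eapply Rle_trans; [|apply Rmax_l]. apply kernel_difference; try assumption.
      intros n. now apply HK.
    - eapply Rle_trans; [|apply Rmax_r]. apply kernel_moebius_difference; try assumption.
      intros n. now apply HK. }
  assert (III_II : iii -> ii).
  { intros H. apply Eiii in H. destruct H as [K HK]. apply Eii.
    exists (Rmax (2 * K) (symbol_const alpha s * K)). intros z Hz.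
    assert (D1 : disk (phi1 z)) by now apply Hp1. assert (D2 : disk (phi2 z)) by now apply Hp2.
    destruct (test_points alpha s K (l1 z) (l2 z) (phi1 z) (phi2 z) Ha Hs D1 D2) as [B1 [B2 B3]].
    { intros a Ha'. rewrite <- VF, <- VG by assumption. now apply HK. }
    repeat split.
    - eapply Rle_trans; [exact B1|apply Rmax_l].
    - eapply Rle_trans; [exact B2|apply Rmax_l].
    - eapply Rle_trans; [exact B3|apply Rmax_r]. }
  assert (II_I : ii -> i).
  { intros H. apply Eii in H. destruct H as [M HM].
    destruct (symbols_bound_operator m alpha Ha Hs) as [A [PA HA]].
    exists (A * M). intros f [Hf HN].
    destruct (norm_Bloch_spec alpha f HN) as [N [EN [H0 HB]]].
    assert (B : forall z, disk z -> v z * Cmod (D f z) <= A * M * N).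
    { intros z Hz. unfold D. rewrite weighted_wdc_diff by now apply Hv'.
      destruct (HM z Hz) as [B1 [_ B3]].
      apply HA; try assumption; [now apply Hp1|now apply Hp2]. }
    split; [split|].
    - now apply wdc_diff_holomorphic.
    - apply norm_v_finite. now exists (A * M * N).
    - rewrite EN. now apply norm_v_le. }
  tauto.
Qed.
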